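(* Assume that $f\in C^1([-1,1])$ and that $F(t)\le\min\{F(-1),F(1)\}$ for all $t\in(-1,1)$, where $F'=f$. Let $u$ be a monotone and asymptotically convergent classical solution of $$-\operatorname{div}(\gamma(\mathbf x')\nabla u(\mathbf x))=\lambda(\mathbf x')f(u(\mathbf x)),\qquad \mathbf x=(\mathbf x',\mathbf x'')\in\mathbf{R}^d\times\mathbf{R}^s=\mathbf{R}^n.$$ Suppose that there exists a positive constant $k$ such that $|\nabla\gamma(\mathbf x')|\le k\gamma(\mathbf x')$ and $\lambda(\mathbf x')\le k\gamma(\mathbf x')$ for all $\mathbf x'$ outside a compact set in $\mathbf R^d$. Suppose moreover that there are $g\in\mathcal G$ and a constant $k$ independent of $R$ such that either $$\int_{B_R}\gamma(\mathbf x')\,d\mathbf x'\le k\,g(R)\ \text{ for all } R>1\quad\text{and}\quad n\le d+3,$$ or $$\int_{B_R}\gamma(\mathbf x')\,d\mathbf x'\le k\,R\,g(R)\ \text{ for all } R>1\quad\text{and}\quad n\le d+2,$$ where $B_R$ is the ball of radius $R$ centered at the origin in $\mathbf R^d$. Then $u$ is at most $(d+1)$-dimensional.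
   Context: Here $d,s\ge 1$ are integers and $n=d+s$. The weights $\gamma,\lambda$ are smooth functions on $\mathbf R^d$ with $\gamma>0$ and $\lambda>0$ (except that $\lambda$ is allowed to vanish, say, at a point). The class $\mathcal G$ is the set of nondecreasing functions $g:\mathbf R^+\to\mathbf R^+$ with $\int_1^\infty \frac{1}{r g(r)}\,dr=\infty$. Write also $\mathbf x=(\mathbf x''',x_n)\in\mathbf R^{n-1}\times\mathbf R$. A classical solution $u$ is monotone if $\partial_{x_n}u(\mathbf x)>0$ for all $\mathbf x\in\mathbf R^n$; it is asymptotically convergent if $\lim_{x_n\to\pm\infty}u(\mathbf x''',x_n)=\pm1$ for every $\mathbf x'''\in\mathbf R^{n-1}$ (pointwise, not necessarily uniformly). A function $u$ on $\mathbf R^n$ is at most $m$-dimensional if it depends on at most $m$ variables (up to a linear change of coordinates), i.e. there are a linear map $L:\mathbf R^n\to\mathbf R^m$ and a function $w:\mathbf R^m\to\mathbf R$ with $u=w\circ L$. *)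

(* Defs.v *)
From HB Require Import structures.
From mathcomp Require Import all_boot all_order all_algebra.
From mathcomp Require Import all_classical all_reals all_analysis.

Set Implicit Arguments.
Unset Strict Implicit.
Unset Printing Implicit Defensive.

Import Order.TTheory GRing.Theory Num.Theory.
Import numFieldNormedType.Exports.

Local Open Scope classical_set_scope.
Local Open Scope ring_scope.

Section euclidean.
Context {R : realType} {n : nat}.
Implicit Types (f : 'rV[R]_n -> R) (x : 'rV[R]_n).

(* The library norm on 'rV[R]_n is the sup norm. *)
Definition enorm x : R := Num.sqrt (\sum_(i < n) x 0 i ^+ 2).

Definition partial (i : 'I_n) f : 'rV[R]_n -> R := 'D_(delta_mx 0 i) f.

Definition grad f x : 'rV[R]_n := \row_(i < n) partial i f x.

Definition divergence (V : 'rV[R]_n -> 'rV[R]_n) x : R :=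
  \sum_(i < n) partial i (fun y => V y 0 i) x.

Fixpoint of_class_C (k : nat) f : Prop :=
  match k with
  | 0 => continuous f
  | k'.+1 => continuous f /\ forall i : 'I_n,
      (forall x, derivable f x (delta_mx 0 i)) /\ of_class_C k' (partial i f)
  end.

Definition smooth f : Prop := forall k, of_class_C k f.

(* The last coordinate is the index i with i + 1 = n. The point (x''', t) of
   R^{n-1} x R is [set_last x t], where x is any point extending x'''. *)
Definition set_last x (t : R) : 'rV[R]_n :=
  \row_(i < n) if i.+1 == n then t else x 0 i.

Definition monotone_in_last (u : 'rV[R]_n -> R) : Prop :=
  forall i : 'I_n, i.+1 = n -> forall x, 0 < partial i u x.

Definition asymptotically_convergent (u : 'rV[R]_n -> R) : Prop :=
  forall x, (u (set_last x t) @[t --> +oo] --> (1 : R)) /\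
            (u (set_last x t) @[t --> -oo] --> (-1 : R)).

Definition at_most_dimensional (m : nat) (u : 'rV[R]_n -> R) : Prop :=
  exists (L : {linear 'rV[R]_n -> 'rV[R]_m}) (w : 'rV[R]_m -> R),
    forall x, u x = w (L x).

End euclidean.

Section one_variable.
Context {R : realType}.

(* On a closed interval D this is the derivative in the interior and the
   one-sided derivative at the endpoints; only the values of f on D matter. *)
Definition has_derivative_on (D : set R) (f f' : R -> R) : Prop :=
  forall t, D t -> (f y - f t) / (y - t) @[y --> within D t^'] --> f' t.

Definition C1_on (D : set R) (f : R -> R) : Prop :=
  exists f' : R -> R, has_derivative_on D f f' /\ {within D, continuous f'}.

(* R^+ is the set of positive reals; values of g outside it are irrelevant. *)
Definition class_G (g : R -> R) : Prop :=
  [/\ forall r, 0 < r -> 0 < g r,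
      forall r r', 0 < r -> r <= r' -> g r <= g r' &
      (\int[@lebesgue_measure R]_(r in `[1%R, +oo[) ((r * g r)^-1)%:E = +oo)%E].

End one_variable.

Section lebesgue_measure_Rd.
Context {R : realType}.
Local Notation R' := (measurableTypeR R).

Definition tuple_of_pair d (p : d.-tuple R' * R') : d.+1.-tuple R' :=
  [tuple of p.2 :: p.1].

Lemma measurable_tuple_of_pair d : measurable_fun setT (@tuple_of_pair d).
Proof. exact: measurable_cons. Qed.

(* The product with the Lebesgue measure of R, transported to tuples. *)
Definition lebesgue_step d (mu : {measure set (d.-tuple R') -> \bar R}) :
    {measure set (d.+1.-tuple R') -> \bar R} :=
  measure_function_pushforward__canonical__measure_function_Measure
    (mu \x @lebesgue_measure R)%E (@measurable_tuple_of_pair d).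

Fixpoint lebesgue_tuple (d : nat) : {measure set (d.-tuple R') -> \bar R} :=
  match d with
  | 0 => dirac [tuple]
  | d'.+1 => lebesgue_step (lebesgue_tuple d')
  end.

Definition row_of_tuple d (t : d.-tuple R') : 'rV[R]_d :=
  \row_(i < d) tnth t i.

Definition ball_integral d (h : 'rV[R]_d -> R) (r : R) : \bar R :=
  (\int[lebesgue_tuple d]_(t in [set t | (enorm (row_of_tuple t) < r)%R])
    (h (row_of_tuple t))%:E)%E.

End lebesgue_measure_Rd.

(* x' = lsubmx x for x in R^{d+s}. As f is only meant on [-1, 1], a solution
   takes its values there. *)
Definition classical_solution (R : realType) (d s : nat)
    (gam lam : 'rV[R]_d -> R) (f : R -> R) (u : 'rV[R]_(d + s) -> R) : Prop :=
  [/\ of_class_C 2 u,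
      forall x, -1 <= u x <= 1 &
      forall x, - divergence (fun y => gam (lsubmx y) *: grad u y) x =
                lam (lsubmx x) * f (u x)].

(* Main.v *)
Require Import Defs.
From HB Require Import structures.
From mathcomp Require Import all_boot all_order all_algebra.
From mathcomp Require Import all_classical all_reals all_analysis.
From mathcomp Require Import measurable_realfun.
From mathcomp Require Import ring lra.
Set Implicit Arguments.
Unset Strict Implicit.
Unset Printing Implicit Defensive.
Import Order.TTheory GRing.Theory Num.Theory.
Import numFieldNormedType.Exports.
Local Open Scope classical_set_scope.
Local Open Scope ring_scope.

(** The proof follows the strategy for De Giorgi's conjecture in low dimensions:
    an energy estimate on large boxes, then a Liouville property for the
    quotient of two partial derivatives of [u].  Write [n = d + s], [e_n] for
    the last direction, [G x = gam (lsubmx x)] and [L x = lam (lsubmx x)]; both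
    weights are constant in the last [s] directions.

    Gradient bound.  Dividing the equation by [G] gives
    [Laplacian u + b . Du = h] with [b] and [h] bounded ([weights_comparable]),
    hence [Du] is bounded ([gradient_bound]).  The bound comes from the maximum
    principle after a doubling of variables, so that no regularity theory for
    elliptic equations enters.

    Energy growth.  Let [eps = 1] or [eps = -1] be the end where [F] is smaller.
    The energy density [G |Du|^2 / 2 + L (F eps - F u)] is at least
    [G |Du|^2 / 2], and since the weights do not depend on the last variable,
    its derivative in that direction is the divergence of [G d_n u Du].  So the
    energy of [u] in a window of size [r] exceeds the energy in the window
    translated by [T e_n] by at most [C] times the integral of [G d_n u] over the
    tube between them.  On each line in the direction [e_n] the integral of
    [d_n u > 0] is at most 2, against a length of order [r] for a box: this is at
    most [C / r] times the weighted volume of a box, for all [T] ([line_saving],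
    [window_shift_energy]).  As [T] tends to infinity on the side where [u] tends
    to [eps], the energy in the translated window vanishes ([energy_tail],
    [energy_tail_cvg]).  Hence the integral of [G |Du|^2] over a box of size [r]
    is at most [C / r] times the weighted volume of a larger box
    ([gradient_growth]).  That volume is at most [C r^3 g(K r)] under either
    growth assumption ([weighted_volume_growth]): the last [s] directions
    contribute a factor [r^s].

    Liouville property.  Let [v] be the derivative of [u] in one of the last
    [s] directions and [phi = d_n u > 0].  Both solve the linearized equation, in
    the weak sense only, because [u] is merely twice differentiable
    ([linearized_equation], which rests on [I_exchange_derivatives]).  With
    [a(r)] the integral of [zeta_r^2 G phi^2 |D(v / phi)|^2], testing with
    [zeta_r^2 v / phi] gives
    [a(r/2) a(2r) <= 8 E(r) (a(2r) - a(r/2))] where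
    [E(r) = C r^-2 int G v^2 zeta_{2r} <= C g(K r)]
    ([caccioppoli_step]).  If [b_j = a(4^j)] did not vanish, the increments
    [1 / b_j - 1 / b_{j+1}] would dominate a multiple of [1 / g(K 4^j)], whose sum
    diverges because [1 / (r g(r))] is not integrable at infinity
    ([class_G_growth]).  So [v / phi] is constant.

    Conclusion.  The derivatives of [u] in the last [s] directions are constant
    multiples [c_k] of one function, so [u] depends on the first [d] variables
    and on the linear form with coefficients [c_k] in the others
    ([at_most_dimensional_proportional]). *)

(** * Lebesgue measure on tuples *)
Section tuple_measure.
Context {R : realType}.
Local Notation R' := (measurableTypeR R).
Local Notation leb := (@lebesgue_measure R).
Local Notation mu n := (@lebesgue_tuple R n).

Definition tuple_box n (k : R) : set (n.-tuple R') :=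
  [set t | forall i, `|tnth t i| <= k].

Arguments tuple_box : clear implicits.

Lemma measurable_tuple_cube n (c : nat -> R) k :
  measurable [set t : n.-tuple R' | forall i, `|tnth t i - c i| <= k].
Proof.
rewrite (_ : [set t | _] =
  \bigcap_(i in [set: 'I_n]) (fun t : n.-tuple R' => tnth t i) @^-1` `[c i - k, c i + k]).
  apply: fin_bigcap_measurable => // i _; rewrite -[X in measurable X]setTI.
  exact: measurable_tnth.
apply/seteqP; split => [t tk i _|t tk i] /=.
  by rewrite in_itv/= -ler_distl tk.
by rewrite ler_distl; have := tk i I; rewrite /= in_itv.
Qed.

Lemma measurable_tuple_box n k : measurable (tuple_box n k).
Proof.
rewrite (_ : tuple_box n k =
    [set t : n.-tuple R' | forall i, `|tnth t i - (fun=> 0) (i : nat)| <= k]).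
  exact: (@measurable_tuple_cube n (fun=> 0) k).
by apply/seteqP; split => t tk i; have := tk i; rewrite subr0.
Qed.

Lemma lebesgue_tuple_cube n (c : nat -> R) (k : R) : 0 <= k ->
  mu n [set t : n.-tuple R' | forall i, `|tnth t i - c i| <= k] = EFin ((2 * k) ^+ n).
Proof.
move=> k0; elim: n => [|n IH] in c *.
  by rewrite /= diracE expr0 mem_set// => -[].
rewrite /= /pushforward.
rewrite (_ : _ @^-1` _ =
  [set t : n.-tuple R' | forall i, `|tnth t i - c i.+1| <= k]
    `*` `[c 0 - k, c 0 + k]%classic); last first.
  apply/seteqP; split => [[t r] tk|[t r] [tk rk] i] /=.
    split => [i|].
      by have := tk (lift ord0 i); rewrite tnthS/=.
    by have := tk ord0; rewrite tnth0 in_itv/= ler_distl.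
  have [->|i0] := eqVneq i ord0.
    by rewrite tnth0/= ler_distl; move: rk; rewrite /= in_itv.
  case: (unliftP ord0 i) i0 => [j ->|->]; last by rewrite eqxx.
  by rewrite tnthS /= => _; exact: tk.
rewrite product_measure1E//; last exact: (@measurable_tuple_cube _ (c \o S)).
rewrite (IH (c \o S)) exprSr EFinM; congr (_ * _)%E.
have [->|kn0] := eqVneq k 0.
  by rewrite subr0 addr0 mulr0 set_itv1; exact: lebesgue_measure_set1.
have kp : 0 < k by rewrite lt_neqAle eq_sym kn0.
rewrite [LHS](lebesgue_measure_itv `[c 0 - k, c 0 + k])/= lte_fin.
case: ifPn => [_|/negP[]]; last by lra.
by rewrite -EFinB; congr EFin; lra.
Qed.

Lemma lebesgue_tuple_box n (k : R) : 0 <= k ->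
  (mu n (tuple_box n k) = ((2 * k) ^+ n)%:E)%E.
Proof.
move=> k0; rewrite -(lebesgue_tuple_cube n (fun=> 0) k0); congr (mu n _).
by apply/seteqP; split => t tk i; have := tk i; rewrite subr0.
Qed.

Lemma sigma_finite_lebesgue_tuple n : sigma_finite setT (mu n).
Proof.
exists (fun k => tuple_box n k%:R) => [|k]; last first.
  by split; [exact: measurable_tuple_box|by rewrite lebesgue_tuple_box// ltry].
apply/seteqP; split => // t _.
exists (Num.truncn (\sum_i `|tnth t i|)).+1 => // i /=.
rewrite (@le_trans _ _ (\sum_i `|tnth t i|))//; last first.
  by rewrite ltW// truncnS_gt.
by rewrite (bigD1 i)//= lerDl sumr_ge0.
Qed.

(** A copy of [lebesgue_tuple] that can carry the structure of a sigma-finite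
    measure, which Fubini's theorem requires: [lebesgue_tuple] is a fixpoint
    with values in measures, so no further instance can be attached to it. *)
Definition lebesgue_tuple_fun n : set (n.-tuple R') -> \bar R := mu n.

Arguments lebesgue_tuple_fun : clear implicits.

HB.instance Definition _ n := isMeasure.Build _ _ _ (lebesgue_tuple_fun n)
  (measure0 (mu n)) (measure_ge0 (mu n)) (@measure_semi_sigma_additive _ _ _ (mu n)).

HB.instance Definition _ n := @Measure_isSigmaFinite.Build _ _ _
  (lebesgue_tuple_fun n) (@sigma_finite_lebesgue_tuple n).

End tuple_measure.
Section measurable_rows.
Context {R : realType}.
Local Notation R' := (measurableTypeR R).
Local Notation leb := (@lebesgue_measure R).
Local Notation mu n := (@lebesgue_tuple R n).

(** An open set of rows is a countable union of cubes with rational centres.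
    This is the link between the topology of rows and the product
    sigma-algebra of tuples. *)
Lemma measurable_open_row n (V : set 'rV[R]_n) : open V ->
  measurable ((@row_of_tuple R n) @^-1` V).
Proof.
move=> oV.
pose B (p : n.-tuple rat * nat) : set (n.-tuple R') :=
  [set t | forall i, `|tnth t i - ratr (tnth p.1 i)| < p.2.+1%:R^-1].
pose W k := if unpickle k is Some p then
  (if `[< B p `<=` (@row_of_tuple R n) @^-1` V >] then B p else set0) else set0.
rewrite (_ : _ @^-1` _ = \bigcup_k W k).
  apply: bigcupT_measurable => k; rewrite /W.
  case: unpickle => [p|//]; case: ifPn => // _.
  rewrite (_ : B p = \bigcap_(i in [set: 'I_n]) (fun t : n.-tuple R' => tnth t i) @^-1`
     (ball (ratr (tnth p.1 i) : R) (p.2.+1%:R^-1))).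
    apply: fin_bigcap_measurable => // i _; rewrite -[X in measurable X]setTI.
    by apply: measurable_tnth => //; apply: open_measurable; apply: ball_open; rewrite invr_gt0.
  apply/seteqP; split => [t Bt i _|t Bt i] /=.
    by rewrite -ball_normE /= distrC; exact: Bt.
  by have := Bt i I; rewrite /= -ball_normE /= distrC.
apply/seteqP; split => [t Vt|t [k _]]; last first.
  by rewrite /W; case: unpickle => [p|//]; case: asboolP => // + Bt; exact.
have /nbhs_ballP[e /= e0 eV] : nbhs (row_of_tuple t) V by exact: open_nbhs_nbhs.
pose m := Num.truncn (2 / e).
have me : 2 * m.+1%:R^-1 < e.
  rewrite ltr_pdivrMr// mulrC -ltr_pdivrMr//.
  by rewrite truncnS_gt.
have qP i : {q : rat | `|tnth t i - ratr q| < m.+1%:R^-1}.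
  apply: cid; have : tnth t i - m.+1%:R^-1 < tnth t i + m.+1%:R^-1.
    by rewrite ltrD2l gtrN// invr_gt0.
  move=> /(@rat_in_itvoo R)[q]; rewrite in_itv/= => qt; exists q.
  by rewrite distrC ltr_distl.
pose q := [tuple sval (qP i) | i < n].
have Btq : B (q, m) t by move=> i /=; rewrite tnth_mktuple; case: (qP i).
exists (pickle (q, m)) => //; rewrite /W pickleK asboolT// => t' Bt'.
apply: eV; split => // i j; rewrite !mxE -ball_normE /=.
rewrite (le_lt_trans (ler_distD (ratr (tnth q j)) _ _))//.
rewrite (lt_trans _ me)// mulr_natl mulr2n ltrD//.
by rewrite distrC; exact: (Bt' j).
Qed.

Lemma measurable_continuous_row n (phi : 'rV[R]_n -> R) : continuous phi ->
  measurable_fun setT (phi \o @row_of_tuple R n).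
Proof.
move=> cphi; apply: (measurability _ (RGenOInfty.measurableE R)).
move=> /= _ [_ [a ->]] <-; rewrite setTI comp_preimage.
apply: measurable_open_row; apply: open_comp => //.
Qed.

End measurable_rows.

Arguments tuple_box {R} n k _.
Arguments lebesgue_tuple_fun {R} n _.

Section tuple_integral.
Context {R : realType}.
Local Notation R' := (measurableTypeR R).
Local Notation leb := (@lebesgue_measure R).
Local Notation mu n := (@lebesgue_tuple R n).

(** A class of integrable functions that is stable under freezing coordinates,
    so that Fubini's theorem can be applied to one coordinate at a time. *)
Record bounded_measurable n (phi : n.-tuple R' -> R) : Prop := BoundedMeasurable {
  bm_measurable : measurable_fun setT phi ;
  bm_bounded : exists M : R, forall t, `|phi t| <= M ;
  bm_support : exists k, forall t, ~ tuple_box n k t -> phi t = 0 }.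

Lemma bm_integrable n phi : @bounded_measurable n phi ->
  (mu n).-integrable setT (EFin \o phi).
Proof.
case=> mphi [M phiM] [k phi0].
have -> : EFin \o phi = (EFin \o phi) \_ (tuple_box n `|k|).
  apply/funext => t; rewrite patchE; case: ifPn => // /negP kt /=.
  rewrite phi0// => tk; apply: kt; rewrite inE => i.
  exact: le_trans (tk i) (ler_norm k).
apply/(integrable_mkcond _ (@measurable_tuple_box R n `|k|)).
apply: measurable_bounded_integrable.
- exact: measurable_tuple_box.
- by rewrite lebesgue_tuple_box ?normr_ge0// ltry.
- exact: measurable_funTS.
- exists M; split; first exact: num_real.
  by move=> x Mx t _ /=; rewrite (le_trans (phiM _))// ltW.
Qed.

Lemma integral_tuple_ge0 n (phi : n.+1.-tuple R' -> \bar R) :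
  measurable_fun setT phi -> (forall t, 0 <= phi t)%E ->
  (\int[mu n.+1]_t phi t = \int[mu n]_t \int[leb]_r phi [tuple of r :: t])%E.
Proof.
move=> mphi phi0.
transitivity (\int[mu n \x leb]_p (phi \o @tuple_of_pair R n) p)%E.
  rewrite (@ge0_integral_pushforward _ _ _ _ _ _ (@measurable_tuple_of_pair R n)) //.
have mphi' : measurable_fun setT (phi \o @tuple_of_pair R n).
  apply: measurableT_comp => //; exact: measurable_tuple_of_pair.
exact: (@fubini_tonelli1 _ _ _ _ _ (lebesgue_tuple_fun n) leb _ mphi' (fun p => phi0 _)).
Qed.

Lemma integrable_pair n (phi : n.+1.-tuple R' -> R) : bounded_measurable phi ->
  (lebesgue_tuple_fun n \x leb)%E.-integrable setT
    (EFin \o phi \o @tuple_of_pair R n).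
Proof.
move=> bphi; have /integrableP[mphi iphi] := bm_integrable bphi.
apply/integrableP; split.
  by apply: measurableT_comp => //; exact: measurable_tuple_of_pair.
move: iphi.
rewrite (@ge0_integral_pushforward _ _ _ _ _ _ (@measurable_tuple_of_pair R n)) //.
by apply/measurable_EFinP; apply: measurableT_comp => //; exact: bm_measurable.
Qed.

Lemma integral_tuple_head n (phi : n.+1.-tuple R' -> R) : bounded_measurable phi ->
  (\int[mu n.+1]_t (phi t)%:E = \int[mu n]_t \int[leb]_r (phi [tuple of r :: t])%:E)%E.
Proof.
move=> bphi; have /integrableP[mphi iphi] := bm_integrable bphi.
rewrite (integral12_prod_meas1 (integrable_pair bphi)).
rewrite (@integral_pushforward _ _ _ _ _ _ (@measurable_tuple_of_pair R n)) //.
exact: integrable_pair.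
Qed.

Lemma integral_tuple_behead n (phi : n.+1.-tuple R' -> R) : bounded_measurable phi ->
  (\int[mu n.+1]_t (phi t)%:E = \int[leb]_r \int[mu n]_t (phi [tuple of r :: t])%:E)%E.
Proof.
move=> bphi; rewrite (integral_tuple_head bphi).
exact: (Fubini (integrable_pair bphi)).
Qed.

Lemma integral_le0 d (T : measurableType d) (m : {measure set T -> \bar R})
    (h : T -> \bar R) :
  (forall t, h t <= 0)%E -> (\int[m]_t h t <= 0)%E.
Proof.
move=> h0; rewrite integralE (_ : h^\+%E = cst 0%E); last first.
  by apply/funext => t; rewrite funeposE; apply/max_idPr.
by rewrite integral0 sub0e oppe_le0; apply: integral_ge0.
Qed.

Definition tuple_set n (t : n.-tuple R') (i : 'I_n) (r : R') : n.-tuple R' :=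
  [tuple if j == i then r else tnth t j | j < n].

Lemma bm_slice n (phi : n.+1.-tuple R' -> R) (r : R) : bounded_measurable phi ->
  bounded_measurable (fun t : n.-tuple R' => phi [tuple of r :: t]).
Proof.
case=> mphi [M phiM] [k phi0]; split.
- apply: measurableT_comp => //.
  by apply: measurable_cons => //; exact: measurable_id.
- by exists M.
- exists k => t tk; apply: phi0 => H; apply: tk => i.
  by have := H (lift ord0 i); rewrite tnthS.
Qed.

(** By Fubini's theorem, once the chosen coordinate has been brought to the head
    by induction.  Comparison, invariance by translation and integration by
    parts in [R^n] all reduce to one variable through this lemma. *)
Lemma integral_lines_le0 n (phi : n.-tuple R' -> R) (i : 'I_n) :
  bounded_measurable phi ->
  (forall t, \int[leb]_r (phi (tuple_set t i r))%:E <= 0)%E ->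
  (\int[mu n]_t (phi t)%:E <= 0)%E.
Proof.
elim: n => [|n IH] in phi i *; first by case: i.
move=> bphi; case: (unliftP ord0 i) => [j ->|->] hphi.
  rewrite (integral_tuple_behead bphi); apply: integral_le0.
  move=> r; apply: (IH _ j); first exact: bm_slice.
  move=> t; have := hphi [tuple of r :: t].
  congr (_ <= _)%E; apply: eq_integral => q _; congr (phi _)%:E.
  apply: eq_from_tnth => l; rewrite tnth_mktuple.
  have [->|l0] := eqVneq l ord0; first by rewrite !tnth0 (negbTE (neq_lift _ _)).
  case: (unliftP ord0 l) l0 => [l' ->|->]; last by rewrite eqxx.
  by rewrite !tnthS tnth_mktuple (inj_eq lift_inj).
rewrite (integral_tuple_head bphi); apply: integral_le0.
move=> t; have := hphi [tuple of 0 :: t].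
congr (_ <= _)%E; apply: eq_integral => q _; congr (phi _)%:E.
apply: eq_from_tnth => l; rewrite tnth_mktuple.
have [->|l0] := eqVneq l ord0; first by rewrite !tnth0.
case: (unliftP ord0 l) l0 => [l' ->|->]; last by rewrite eqxx.
by rewrite !tnthS.
Qed.

End tuple_integral.

Section tuple_product.
Context {R : realType}.
Local Notation R' := (measurableTypeR R).
Local Notation leb := (@lebesgue_measure R).
Local Notation mu n := (@lebesgue_tuple R n).

Definition tuple_l d s (t : (d + s).-tuple R') : d.-tuple R' :=
  [tuple tnth t (lshift s i) | i < d].
Definition tuple_r d s (t : (d + s).-tuple R') : s.-tuple R' :=
  [tuple tnth t (rshift d i) | i < s].

Lemma measurable_tuple_l d s : measurable_fun setT (@tuple_l d s).
Proof.
apply/measurable_fun_tnthP => i.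
rewrite (_ : _ \o _ = fun t => tnth t (lshift s i)); first exact: measurable_tnth.
by apply/funext => t /=; rewrite tnth_mktuple.
Qed.

Lemma measurable_tuple_r d s : measurable_fun setT (@tuple_r d s).
Proof.
apply/measurable_fun_tnthP => i.
rewrite (_ : _ \o _ = fun t => tnth t (rshift d i)); first exact: measurable_tnth.
by apply/funext => t /=; rewrite tnth_mktuple.
Qed.

(** Tonelli's theorem, one of the first [d] coordinates at a time. *)
Lemma integral_tuple_product d s (h : d.-tuple R' -> \bar R) (k : s.-tuple R' -> \bar R) :
  measurable_fun setT h -> measurable_fun setT k ->
  (forall t, 0 <= h t)%E -> (forall t, 0 <= k t)%E ->
  (\int[mu (d + s)]_t (h (tuple_l t) * k (tuple_r t)) =
   \int[mu d]_t h t * \int[mu s]_t k t)%E.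
Proof.
elim: d => [|d IH] in h * => mh mk h0 k0.
  rewrite [X in (_ = X * _)%E](_ : _ = h [tuple]); last first.
    by rewrite integral_dirac// diracT mul1e.
  rewrite -ge0_integralZl//; apply: eq_integral => t _.
  congr (h _ * k _)%E; first by apply: val_inj; rewrite [tuple_l t]tuple0.
  by apply: eq_from_tnth => i; rewrite tnth_mktuple; congr tnth; exact/val_inj.
have mhk : measurable_fun setT (fun t : (d.+1 + s).-tuple R' => (h (tuple_l t) * k (tuple_r t))%E).
  apply: emeasurable_funM; apply: measurableT_comp => //.
    exact: measurable_tuple_l.
  exact: measurable_tuple_r.
pose H (t : d.-tuple R') := (\int[leb]_r h [tuple of r :: t])%E.
have mH : measurable_fun setT H.
  have mh' : measurable_fun setT (h \o @tuple_of_pair R d).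
    by apply: measurableT_comp => //; exact: measurable_tuple_of_pair.
  exact: (measurable_fun_fubini_tonelli_F (m2 := leb) _ mh' (fun p => h0 _)).
rewrite (integral_tuple_ge0 mh h0) -(IH H)//; last first.
  by move=> t; apply: integral_ge0.
pose c (t : (d + s).-tuple R') r : (d.+1 + s).-tuple R' := @tuple_of_pair R (d + s) (t, r).
transitivity (\int[mu (d + s)]_t (\int[leb]_r (h (tuple_l (c t r)) * k (tuple_r (c t r)))))%E.
  by apply: (integral_tuple_ge0 mhk) => t; exact: mule_ge0.
apply: eq_integral => t _; rewrite muleC -ge0_integralZl//; last 1 first.
- have mh' : measurable_fun setT (h \o @tuple_of_pair R d).
    by apply: measurableT_comp => //; exact: measurable_tuple_of_pair.
  exact: (measurableT_comp mh' (pair1_measurable (tuple_l t))).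
apply: eq_integral => r _; rewrite muleC; congr (k _ * h _)%E.
  apply: eq_from_tnth => i; rewrite !tnth_mktuple.
  rewrite (_ : rshift d.+1 i = lift ord0 (rshift d i)) ?tnthS//.
  exact/val_inj.
apply: eq_from_tnth => i; rewrite !tnth_mktuple.
have [->|l0] := eqVneq i ord0.
  by rewrite (_ : lshift s ord0 = ord0) ?tnth0//; exact/val_inj.
case: (unliftP ord0 i) l0 => [l' ->|->]; last by rewrite eqxx.
rewrite (_ : lshift s (lift ord0 l') = lift ord0 (lshift s l')); last exact/val_inj.
by rewrite !tnthS tnth_mktuple.
Qed.

End tuple_product.

(** * Integration of continuous functions of bounded support *)
Section line_integral.
Context {R : realType}.
Local Notation leb := (@lebesgue_measure R).

Lemma is_derive_line (V : normedModType R) (f : V -> R) (x v : V) (r d : R) :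
  is_derive (x + r *: v) v f d <-> is_derive r 1 (fun t => f (x + t *: v)) d.
Proof.
have E : (fun h : R => h^-1 *: ((f \o shift (x + r *: v)) (h *: v) - f (x + r *: v))) =
   (fun h => h^-1 *: (((fun t => f (x + t *: v)) \o shift r) (h *: 1) - f (x + r *: v))).
  apply/funext => h /=; do 3 f_equal.
  by rewrite /shift /= [h *: 1]mulr1 scalerDl addrCA.
by split => -[dd dv]; split; move: dd dv; rewrite /derivable /derive E.
Qed.

Lemma integral_support (g : R -> R) a b : (forall r, ~~ (a <= r <= b) -> g r = 0) ->
  (\int[leb]_r (g r)%:E = \int[leb]_(r in `[a, b]) (g r)%:E)%E.
Proof.
move=> g0; rewrite [RHS]integral_mkcond; apply: eq_integral => r _.
rewrite patchE; case: ifPn => // /negP rab; rewrite g0//.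
by apply/negP => h; apply: rab; rewrite inE /= in_itv.
Qed.

Lemma integrable_support (g : R -> R) a b : continuous g ->
  (forall r, ~~ (a <= r <= b) -> g r = 0) -> leb.-integrable setT (EFin \o g).
Proof.
move=> cg g0.
have -> : EFin \o g = (EFin \o g) \_ `[a, b].
  apply/funext => r /=; rewrite patchE; case: ifPn => // /negP rab; rewrite /= g0//.
  by apply/negP => h; apply: rab; rewrite inE /= in_itv.
apply: (integrable_mkcond (mu := leb) (D := `[a, b]%classic) (EFin \o g) (measurable_itv _)).1.
apply: continuous_compact_integrable; first exact: segment_compact.
exact: continuous_subspaceT.
Qed.

Lemma FTC_line (f F : R -> R) (a b : R) : a < b -> continuous f ->
  (forall r : R, is_derive r 1 F (f r)) ->
  (\int[leb]_(r in `[a, b]) (f r)%:E = (F b - F a)%:E)%E.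
Proof.
move=> ab cf dF; rewrite EFinB; apply: continuous_FTC2 => //.
- exact: continuous_subspaceT.
- have cF (r : R) : {for r, continuous F}.
    by apply: differentiable_continuous; apply/derivable1_diffP; case: (dF r).
  split; first by move=> r _; case: (dF r).
  + exact/cvg_at_right_filter/cF.
  + exact/cvg_at_left_filter/cF.
- by move=> r _; rewrite derive1E; case: (dF r).
Qed.

Lemma integral_shift (g : R -> R) (k t : R) : continuous g ->
  (forall r, k < `|r| -> g r = 0) ->
  (\int[leb]_r (g (r + t))%:E = \int[leb]_r (g r)%:E)%E.
Proof.
move=> cg g0.
pose K := `|k| + `|t| + 1; pose F r := r + t.
have dF (r : R) : is_derive r 1 F 1.
  by rewrite -[X in is_derive _ _ _ X]addr0; apply: is_deriveD.
have dF1 : F^`()%classic = cst 1.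
  by apply/funext => r; rewrite derive1E; case: (dF r).
have cF : continuous F.
  move=> r; apply: differentiable_continuous; apply/derivable1_diffP.
  by case: (dF r).
have kK : k <= `|k| by exact: ler_norm.
have tK : `|t| <= `|t| by [].
have t0 : 0 <= `|t| by [].
rewrite (@integral_support _ (- K) K); last first.
  move=> r; rewrite -ler_norml -ltNge => Kr; apply: g0.
  have := ler_normB (r + t) t; rewrite addrK; rewrite /K in Kr; lra.
rewrite (@integral_support _ (F (- K)) (F K)); last first.
  move=> r; have -> : (F (- K) <= r <= F K) = (`|r - t| <= K) by rewrite ler_norml /F lerBlDr lerBrDr.
  rewrite -ltNge => Kr; apply: g0.
  have := ler_normD r (- t); rewrite normrN; rewrite /K in Kr; lra.
rewrite integration_by_substitution_increasing.
- by apply: eq_integral => r _; rewrite dF1 /= fctE /= mulr1.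
- by rewrite /K; have := normr_ge0 k; lra.
- by move=> r r' _ _; rewrite /F ltrD2r.
- by rewrite dF1 => r _; exact: cvg_cst.
- by rewrite dF1; exact: is_cvg_cst.
- by rewrite dF1; exact: is_cvg_cst.
- split; first by move=> r _; case: (dF r).
  + exact/cvg_at_right_filter/cF.
  + exact/cvg_at_left_filter/cF.
- exact: continuous_subspaceT.
Qed.

End line_integral.

Section row_integral.
Context {R : realType} {n : nat}.
Local Notation leb := (@lebesgue_measure R).
Local Notation R' := (measurableTypeR R).
Implicit Types (phi psi : 'rV[R]_n -> R) (x : 'rV[R]_n).

Definition bsupp phi := exists k : R, forall x i, k < `|x 0 i| -> phi x = 0.

Definition Cc phi := continuous phi /\ bsupp phi.

(** The integral is real-valued: it is only used for functions in [Cc], or for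
    its sign. *)
Definition I phi : R := (\int[lebesgue_tuple n]_t phi (row_of_tuple t))%R.

Lemma box_compact (k : R) : compact [set x : 'rV[R]_n | forall i, `|x 0 i| <= k].
Proof.
rewrite (_ : [set x | _] = [set x : 'rV[R]_n | forall i, `[- k, k]%classic (x ord0 i)]).
  apply: (@rV_compact _ _ (fun=> `[- k, k]%classic)) => _.
  exact: segment_compact.
by apply/seteqP; split => x xk i; have := xk i; rewrite /= in_itv /= ler_norml.
Qed.

Lemma bounded_on_box (k : R) phi : continuous phi ->
  exists2 M, 0 < M & forall x, (forall i, `|x 0 i| <= k) -> `|phi x| <= M.
Proof.
move=> cphi.
have := continuous_compact (continuous_subspaceT cphi) (@box_compact k).
move=> /compact_bounded[M [_ HM]]; exists (`|M| + 1) => [|x xk].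
  by rewrite ltr_pwDr.
apply: (HM (`|M| + 1)); first by rewrite (le_lt_trans (ler_norm _))// ltrDl.
by exists x.
Qed.

Lemma Cc_bounded phi : Cc phi -> exists M, forall x, `|phi x| <= M.
Proof.
case=> cphi [k phi0]; have [M M0 HM] := bounded_on_box k cphi.
exists M => x.
have [xk|/existsNP[i]] := pselect (forall i, `|x 0 i| <= k); first exact: HM.
by move=> /negP; rewrite -ltNge => /phi0 ->; rewrite normr0 ltW.
Qed.

Lemma Cc_bm phi : Cc phi -> bounded_measurable (phi \o @row_of_tuple R n).
Proof.
move=> cphi; have [M HM] := Cc_bounded cphi; case: cphi => cphi [k phi0].
split; first exact: measurable_continuous_row.
  by exists M => t; exact: HM.
exists k => t /existsNP[i /negP]; rewrite -ltNge => ti.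
by apply: (phi0 _ i); rewrite mxE.
Qed.

Lemma Cc_integrable phi : Cc phi ->
  (lebesgue_tuple n).-integrable setT (EFin \o (phi \o @row_of_tuple R n)).
Proof. by move=> /Cc_bm/bm_integrable. Qed.

Lemma I_EFin phi : Cc phi ->
  ((I phi)%:E = \int[lebesgue_tuple n]_t (phi (row_of_tuple t))%:E)%E.
Proof.
by move=> cp; rewrite /I /Rintegral fineK//; exact: (integrable_fin_num measurableT (Cc_integrable cp)).
Qed.

Lemma Cc0 : Cc (fun=> 0).
Proof. by split; [exact: cst_continuous|exists 0]. Qed.

Lemma CcD phi psi : Cc phi -> Cc psi -> Cc (fun x => phi x + psi x).
Proof.
move=> [cp [k pk]] [cq [l ql]]; split; first by move=> x; exact: (cvgD (cp x) (cq x)).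
exists (Num.max k l) => x i; rewrite gt_max => /andP[xk xl].
by rewrite (pk _ _ xk) (ql _ _ xl) addr0.
Qed.

Lemma CcMl phi psi : continuous phi -> Cc psi -> Cc (fun x => phi x * psi x).
Proof.
move=> cp [cq [l ql]]; split; first by move=> x; exact: (cvgM (cp x) (cq x)).
by exists l => x i xl; rewrite (ql _ _ xl) mulr0.
Qed.

Lemma CcMr phi psi : Cc phi -> continuous psi -> Cc (fun x => phi x * psi x).
Proof.
move=> cp cq; rewrite (_ : (fun x => _) = (fun x => psi x * phi x)).
  exact: CcMl.
by apply/funext => x; rewrite mulrC.
Qed.

Lemma CcZ (a : R) phi : Cc phi -> Cc (fun x => a * phi x).
Proof. by move=> cp; apply: CcMl => //; exact: cst_continuous. Qed.

Lemma CcN phi : Cc phi -> Cc (fun x => - phi x).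
Proof.
move=> /(CcZ (-1)); congr Cc; apply/funext => x; exact: mulN1r.
Qed.

Lemma CcB phi psi : Cc phi -> Cc psi -> Cc (fun x => phi x - psi x).
Proof. by move=> cp cq; apply: CcD => //; exact: CcN. Qed.

Lemma Cc_sum (J : Type) (s : seq J) (P : pred J) (phi : J -> 'rV[R]_n -> R) :
  (forall j, P j -> Cc (phi j)) -> Cc (fun x => \sum_(j <- s | P j) phi j x).
Proof.
move=> cp; elim: s => [|j s IH].
  rewrite (_ : (fun x => _) = (fun=> 0)); first exact: Cc0.
  by apply/funext => x; rewrite big_nil.
rewrite (_ : (fun x => _) = (fun x =>
    (if P j then phi j x else 0) + \sum_(j <- s | P j) phi j x)).
  apply: (CcD _ IH); case: (boolP (P j)) => Pj; [exact: cp|exact: Cc0].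
by apply/funext => x; rewrite big_cons; case: ifP => //; rewrite add0r.
Qed.

Lemma ID phi psi : Cc phi -> Cc psi -> I (fun x => phi x + psi x) = I phi + I psi.
Proof.
move=> /Cc_integrable cp /Cc_integrable cq; exact: (RintegralD measurableT cp cq).
Qed.

Lemma IZ (a : R) phi : Cc phi -> I (fun x => a * phi x) = a * I phi.
Proof. by move=> /Cc_integrable cp; exact: (RintegralZl a measurableT cp). Qed.

Lemma IN phi : Cc phi -> I (fun x => - phi x) = - I phi.
Proof.
move=> /(IZ (-1)); rewrite mulN1r => <-; congr I.
by apply/funext => x; rewrite mulN1r.
Qed.

Lemma IB phi psi : Cc phi -> Cc psi -> I (fun x => phi x - psi x) = I phi - I psi.
Proof. by move=> cp cq; rewrite ID ?IN//; exact: CcN. Qed.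

Lemma I_sum (J : Type) (s : seq J) (P : pred J) (phi : J -> 'rV[R]_n -> R) :
  (forall j, P j -> Cc (phi j)) ->
  I (fun x => \sum_(j <- s | P j) phi j x) = \sum_(j <- s | P j) I (phi j).
Proof.
move=> cp; elim: s => [|j s IH].
  rewrite big_nil -[RHS](mul0r (I (fun=> 0))) -IZ; last exact: Cc0.
  by congr I; apply/funext => x; rewrite big_nil mul0r.
rewrite big_cons -IH; case: ifPn => Pj.
  by rewrite -ID; [congr I; apply/funext => x; rewrite big_cons Pj|exact: cp|exact: Cc_sum].
by congr I; apply/funext => x; rewrite big_cons (negbTE Pj).
Qed.

Lemma I_le phi psi : Cc phi -> Cc psi -> (forall x, phi x <= psi x) -> I phi <= I psi.
Proof.
by move=> /Cc_integrable cp /Cc_integrable cq pq; apply: le_Rintegral.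
Qed.

Lemma I_ge0 phi : (forall x, 0 <= phi x) -> 0 <= I phi.
Proof. by move=> p0; apply: Rintegral_ge0. Qed.

Lemma I_lines_le0 phi (i : 'I_n) : Cc phi ->
  (forall x, \int[leb]_r (phi (x + r *: delta_mx 0 i))%:E <= 0)%E -> I phi <= 0.
Proof.
move=> cphi hphi; rewrite -lee_fin I_EFin//.
apply: (integral_lines_le0 (i := i) (Cc_bm cphi)) => t.
have := hphi (row_of_tuple t - tnth t i *: delta_mx 0 i).
congr (_ <= _)%E; apply: eq_integral => r _; congr (phi _)%:E.
apply/rowP => j; rewrite !mxE tnth_mktuple eqxx /= eq_sym.
by case: eqVneq => [->|_]; rewrite /= ?mulr1 ?mulr0 ?subrr ?subr0 ?add0r ?addr0.
Qed.

Lemma Cc_line phi x i : Cc phi ->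
  continuous (fun r : R => phi (x + r *: delta_mx 0 i)) /\
  exists2 k, 0 < k & forall r, k < `|r| -> phi (x + r *: delta_mx 0 i) = 0.
Proof.
case=> cphi [k phi0]; split.
  move=> r; apply: continuous_comp; last exact: cphi.
  by apply: cvgD; [exact: cvg_cst|apply: cvgZl; exact: cvg_id].
exists (`|k| + `|x 0 i| + 1) => [|r rk].
  by rewrite ltr_pwDr// addr_ge0.
apply: (phi0 _ i); rewrite !mxE !eqxx mulr1.
have := ler_normB (x 0 i + r) (x 0 i); rewrite addrAC subrr add0r.
have := ler_norm k; lra.
Qed.

Lemma Cc_line_integrable phi x i : Cc phi ->
  leb.-integrable setT (fun r : R => (phi (x + r *: delta_mx 0 i))%:E).
Proof.
move=> /(Cc_line x i)[cl [k k0 lk]].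
apply: (@integrable_support _ (fun r => phi (x + r *: delta_mx 0 i)) (- k) k) => // r.
by rewrite -ler_norml -ltNge; exact: lk.
Qed.

(** The functions need not be comparable pointwise: their integrals along the
    lines in one direction suffice. *)
Lemma I_lines_le phi psi (i : 'I_n) : Cc phi -> Cc psi ->
  (forall x, \int[leb]_r (phi (x + r *: delta_mx 0 i))%:E <=
             \int[leb]_r (psi (x + r *: delta_mx 0 i))%:E)%E -> I phi <= I psi.
Proof.
move=> cp cq pq; rewrite -subr_le0 -IB//.
apply: (I_lines_le0 (i := i)); first exact: CcB.
move=> x; rewrite integralB_EFin//; try exact: Cc_line_integrable.
by rewrite sube_le0; exact: pq.
Qed.

Lemma I_lines phi psi (i : 'I_n) : Cc phi -> Cc psi ->
  (forall x, \int[leb]_r (phi (x + r *: delta_mx 0 i))%:E =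
             \int[leb]_r (psi (x + r *: delta_mx 0 i))%:E)%E -> I phi = I psi.
Proof.
move=> cp cq pq; apply/eqP; rewrite eq_le.
by apply/andP; split; apply: (I_lines_le (i := i)) => // x; rewrite pq.
Qed.

Lemma Cc_shift phi (v : 'rV[R]_n) : Cc phi -> Cc (fun x => phi (x + v)).
Proof.
case=> cp [k p0]; split.
  move=> x; apply: continuous_comp; last exact: cp.
  exact: (cvgD (@cvg_id _ _) (cvg_cst v)).
exists (`|k| + \sum_j `|v 0 j|) => x i xk; apply: (p0 _ i); rewrite mxE.
have vi : `|v 0 i| <= \sum_j `|v 0 j| by rewrite (bigD1 i)//= lerDl sumr_ge0.
have := ler_normB (x 0 i + v 0 i) (v 0 i); rewrite addrK.
have := ler_norm k; lra.
Qed.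

Lemma I_shift phi (i : 'I_n) (t : R) : Cc phi ->
  I (fun x => phi (x + t *: delta_mx 0 i)) = I phi.
Proof.
move=> cp; apply: (I_lines (i := i)) => //; first exact: Cc_shift.
move=> x; have [cl [k k0 lk]] := Cc_line x i cp.
rewrite -(integral_shift t cl lk); apply: eq_integral => r _.
by rewrite -addrA -scalerDl.
Qed.

Lemma bsupp_derive phi dphi (v : 'rV[R]_n) : bsupp phi ->
  (forall x, is_derive x v phi (dphi x)) -> bsupp dphi.
Proof.
case=> k p0 dp; exists k => x i xk.
have [_ <-] := dp x.
rewrite (@near_eq_derive _ _ _ _ (cst 0)) ?derive_cst//.
near=> y; apply: (p0 _ i); near: y.
by apply: (cvgr_norm_gt (x 0 i)) => //; exact: coord_continuous.
Unshelve. all: by end_near. Qed.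

Lemma I_derive phi dphi (i : 'I_n) : Cc phi -> continuous dphi ->
  (forall x, is_derive x (delta_mx 0 i) phi (dphi x)) -> I dphi = 0.
Proof.
move=> cp cd dp.
have cdp : Cc dphi by split => //; exact: bsupp_derive cp.2 dp.
rewrite -[RHS](mul0r (I (fun=> 0))) -IZ; last exact: Cc0.
apply: (I_lines (i := i)) => // [|x]; first exact: CcZ Cc0.
rewrite [RHS](eq_integral (cst 0%E)) ?integral0; last by move=> r _; rewrite mul0r.
have [_ [k k0 lk]] := Cc_line x i cp.
have [cl [l l0 ll]] := Cc_line x i cdp.
pose K := k + l + 1.
rewrite (@integral_support _ _ (- K) K); last first.
  by move=> r; rewrite -ler_norml -ltNge /K => rK; apply: ll; lra.
have dl (r : R) : is_derive r 1 (fun r => phi (x + r *: delta_mx 0 i))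
    (dphi (x + r *: delta_mx 0 i)).
  exact: (is_derive_line phi x (delta_mx 0 i) r _).1 (dp _).
have KK : - K < K by rewrite /K; lra.
rewrite (FTC_line KK cl dl).
by rewrite !lk ?subrr// ?normrN gtr0_norm /K; lra.
Qed.

End row_integral.

Section row_integral_limits.
Context {R : realType} {n : nat}.
Local Notation R' := (measurableTypeR R).
Implicit Types (phi psi : 'rV[R]_n -> R) (x : 'rV[R]_n).

(** Dominated convergence. *)
Lemma I_cvg (phi_ : nat -> 'rV[R]_n -> R) phi psi :
  (forall k, Cc (phi_ k)) -> Cc phi -> Cc psi ->
  (forall k x, `|phi_ k x| <= psi x) ->
  (forall x, phi_ k x @[k --> \oo] --> phi x) ->
  I (phi_ k) @[k --> \oo] --> I phi.
Proof.
move=> c_ cp cq le_ cvg_.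
have : (\int[lebesgue_tuple n]_t (phi_ k (row_of_tuple t))%:E)%E @[k --> \oo] -->
        (\int[lebesgue_tuple n]_t (phi (row_of_tuple t))%:E)%E.
  apply: (@dominated_cvg _ _ _ _ _ _ _ _
      (fun t => (psi (row_of_tuple t))%:E)) => //.
  - by move=> k; apply/measurable_EFinP; exact: (bm_measurable (Cc_bm (c_ k))).
  - by move=> t _; apply/cvg_EFin; [exact: nearW|exact: cvg_].
  - exact: Cc_integrable.
  - by move=> k t _; rewrite abse_EFin lee_fin.
rewrite -(I_EFin cp) (_ : (fun k => _) = (EFin \o (fun k => I (phi_ k)))).
  by move=> /fine_cvg.
by apply/funext => k /=; rewrite I_EFin.
Qed.

Lemma I_gt0 phi x0 : Cc phi -> (forall x, 0 <= phi x) -> 0 < phi x0 -> 0 < I phi.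
Proof.
move=> cp p0 px0.
have c2 : phi x0 / 2 < phi x0 by lra.
have /nbhs_ballP[e /= e0 eV] : nbhs x0 [set x | phi x0 / 2 < phi x].
  have H := @cvgr_gt R _ (nbhs x0) _ phi (phi x0) (cp.1 x0) _ c2; exact: H.
pose c (i : nat) : R := if insub i is Some j then x0 0 j else 0.
have cE (j : 'I_n) : c j = x0 0 j by rewrite /c valK.
pose B := [set t : n.-tuple R' | forall i, `|tnth t i - c i| <= e / 2].
have mB : measurable B by exact: measurable_tuple_cube.
rewrite -lte_fin I_EFin//.
apply: (@lt_le_trans _ _ (\int[lebesgue_tuple n]_(t in B) (cst (phi x0 / 2)%:E t))%E).
  rewrite integral_cst// lebesgue_tuple_cube; last by lra.
  by rewrite -EFinM lte_fin mulr_gt0// ?exprn_gt0//; lra.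
apply: (@le_trans _ _ (\int[lebesgue_tuple n]_(t in B) (phi (row_of_tuple t))%:E)%E).
  apply: ge0_le_integral => //.
  - by move=> t _; rewrite lee_fin; lra.
  - by apply: measurable_funTS; apply/measurable_EFinP; exact: (bm_measurable (Cc_bm cp)).
  - move=> t Bt; rewrite lee_fin ltW//; apply: eV; split => // i j.
    rewrite -ball_normE /= !ord1 mxE distrC -cE (le_lt_trans (Bt j))//; lra.
apply: ge0_subset_integral => //.
  by apply/measurable_EFinP; exact: (bm_measurable (Cc_bm cp)).
by move=> t _; rewrite lee_fin.
Qed.

End row_integral_limits.

Section big_continuous.
Context {R : realType} {T : topologicalType} {J : Type}.

Lemma continuous_sum (s : seq J) (P : pred J) (f : J -> T -> R) :
  (forall j, continuous (f j)) -> continuous (fun x => \sum_(j <- s | P j) f j x).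
Proof.
move=> cf; elim: s => [|j s IH] x.
  rewrite (_ : (fun x => _) = cst 0); first exact: cst_continuous.
  by apply/funext => y; rewrite big_nil.
rewrite (_ : (fun x => _) = (fun x =>
    (if P j then f j x else 0) + \sum_(j <- s | P j) f j x)); last first.
  by apply/funext => y; rewrite big_cons; case: ifP => //; rewrite add0r.
apply: cvgD; last exact: IH.
by case: (P j); [exact: cf|exact: cst_continuous].
Qed.

Lemma continuous_prod (s : seq J) (P : pred J) (f : J -> T -> R) :
  (forall j, continuous (f j)) -> continuous (fun x => \prod_(j <- s | P j) f j x).
Proof.
move=> cf; elim: s => [|j s IH] x.
  rewrite (_ : (fun x => _) = cst 1); first exact: cst_continuous.
  by apply/funext => y; rewrite big_nil.
rewrite (_ : (fun x => _) = (fun x =>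
    (if P j then f j x else 1) * \prod_(j <- s | P j) f j x)); last first.
  by apply/funext => y; rewrite big_cons; case: ifP => //; rewrite mul1r.
apply: cvgM; last exact: IH.
by case: (P j); [exact: cf|exact: cst_continuous].
Qed.

End big_continuous.

Section ball.
Context {R : realType}.
Local Notation R' := (measurableTypeR R).

Lemma enorm_continuous n : continuous (@enorm R n).
Proof.
move=> x; apply: continuous_comp; last exact: sqrt_continuous.
apply: (continuous_sum (f := fun i (x : 'rV[R]_n) => x 0 i ^+ 2)) => i y.
apply: (@continuous_comp _ _ _ (fun z : 'rV[R]_n => z 0 i) (fun r : R => r ^+ 2)).
  exact: coord_continuous.
exact: exprn_continuous.
Qed.

Lemma enorm_le_box n (x : 'rV[R]_n) (k : R) : 0 <= k ->
  (forall i, `|x 0 i| <= k) -> enorm x <= n%:R * k.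
Proof.
move=> k0 xk; rewrite /enorm -[leRHS]ger0_norm ?mulr_ge0// -sqrtr_sqr ler_wsqrtr//.
rewrite (@le_trans _ _ (\sum_(i < n) k ^+ 2))//.
  by apply: ler_sum => i _; rewrite -real_normK ?num_real// lerXn2r ?nnegrE.
rewrite sumr_const card_ord exprMn -[leLHS]mulr_natl ler_wpM2r ?sqr_ge0//.
case: n {x xk} => [|n]; first by rewrite expr0n.
by rewrite expr2 ler_peMl// ler1n.
Qed.

Lemma row_of_tuple_l d s (t : (d + s).-tuple R') :
  row_of_tuple (tuple_l t) = lsubmx (row_of_tuple t).
Proof. by apply/rowP => i; rewrite !mxE tnth_mktuple. Qed.

Lemma tuple_box_split d s (t : (d + s).-tuple R') (k : R) :
  tuple_box (d + s) k t <-> tuple_box d k (tuple_l t) /\ tuple_box s k (tuple_r t).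
Proof.
split=> [tk|[tl tr] i]; first by split => i; rewrite tnth_mktuple; exact: tk.
case: (split_ordP i) => j ->.
  by have := tl j; rewrite tnth_mktuple.
by have := tr j; rewrite tnth_mktuple.
Qed.

(** A cube of half-side [k] is the product of a cube of [R^d], which lies in the
    ball of radius [r] since [d k < r], and a cube of [R^s] of volume
    [(2 k) ^ s]. *)
Lemma I_le_ball_integral d s (gam : 'rV[R]_d -> R) (phi : 'rV[R]_(d + s) -> R) (k r : R) :
  continuous gam -> (forall x, 0 <= gam x) -> Cc phi -> 0 <= k -> d%:R * k < r ->
  (forall x : 'rV[R]_(d + s), phi x <= gam (lsubmx x)) ->
  (forall x : 'rV[R]_(d + s), ~ (forall i, `|x 0 i| <= k) -> phi x <= 0) ->
  ((I phi)%:E <= ((2 * k) ^+ s)%:E * ball_integral gam r)%E.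
Proof.
move=> cg g0 cp k0 kr pg p0; rewrite I_EFin//.
have mrow : measurable_fun setT (gam \o @row_of_tuple R d) by exact: measurable_continuous_row.
have mind m : measurable_fun setT (\1_(tuple_box m k) : m.-tuple R' -> R).
  by apply: measurable_indic; exact: measurable_tuple_box.
pose g (t : d.-tuple R') : R := gam (row_of_tuple t) * \1_(tuple_box d k) t.
pose g' (t : s.-tuple R') : R := \1_(tuple_box s k) t.
have mg : measurable_fun setT g by apply: (measurable_funM mrow); exact: mind.
have mg' : measurable_fun setT g' by exact: mind.
pose h t := (g t)%:E; pose h' t := (g' t)%:E.
have mh : measurable_fun setT h by exact/measurable_EFinP.
have mh' : measurable_fun setT h' by exact/measurable_EFinP.
have h0 t : (0 <= h t)%E by rewrite lee_fin mulr_ge0.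
have h'0 t : (0 <= h' t)%E by rewrite lee_fin.
have [M M0 HM] := bounded_on_box k cg.
have bm : bounded_measurable (fun t : (d + s).-tuple R' => g (tuple_l t) * g' (tuple_r t)).
  split.
  - apply: measurable_funM.
      by apply: measurableT_comp => //; exact: measurable_tuple_l.
    by apply: measurableT_comp => //; exact: measurable_tuple_r.
  - exists M => t; rewrite /g /g' !indicE.
    have [tb|tb] := boolP (_ \in _); last by rewrite mulr0 mul0r normr0 ltW.
    have [tb'|tb'] := boolP (_ \in _); last by rewrite mulr0 normr0 ltW.
    rewrite !mulr1; apply: HM => i; rewrite mxE.
    by move: tb; rewrite inE; exact.
  - exists k => t tk; rewrite /g /g' !indicE.
    have [tb|tb] := boolP (_ \in _); last by rewrite mulr0 mul0r.
    have [tb'|tb'] := boolP (_ \in _); last by rewrite mulr0.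
    by exfalso; apply: tk; apply/tuple_box_split; rewrite !inE in tb tb'.
apply: (@le_trans _ _ (\int[lebesgue_tuple (d + s)]_t (h (tuple_l t) * h' (tuple_r t)))%E).
  apply: le_integral => //.
  - exact: Cc_integrable.
  - exact: (bm_integrable bm).
  - move=> t _; rewrite -EFinM lee_fin /g /g' !indicE.
    have [tb|tb] := pselect (tuple_box (d + s) k t).
      have [tl tr] := (tuple_box_split _ _).1 tb.
      by rewrite !mem_set// !mulr1 row_of_tuple_l.
    rewrite (@le_trans _ _ 0)//; last by rewrite !mulr_ge0.
    by apply: p0 => H; apply: tb => i; have := H i; rewrite mxE.
rewrite integral_tuple_product// muleC.
have -> : (\int[lebesgue_tuple s]_t h' t = ((2 * k) ^+ s)%:E)%E.
  rewrite integral_indic//; last exact: measurable_tuple_box.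
  by rewrite setIT lebesgue_tuple_box.
apply: lee_wpmul2l; first by rewrite lee_fin exprn_ge0// mulr_ge0.
rewrite /ball_integral [leRHS]integral_mkcond; apply: ge0_le_integral => //.
  apply/(measurable_restrictT _ _).1.
    apply: (@measurable_open_row R d ((@enorm R d) @^-1` [set y | y < r])).
    by apply: open_comp; [move=> x _; exact: (@enorm_continuous d x)|exact: open_lt].
  exact/measurable_funTS/measurable_EFinP.
move=> t _; rewrite /h /g indicE patchE.
have [tb|tb] := boolP (_ \in tuple_box _ _); last first.
  by rewrite mulr0; case: ifPn => // _; rewrite lee_fin.
rewrite mem_set ?mulr1// /mkset (le_lt_trans _ kr)// enorm_le_box// => i.
by rewrite mxE; move: tb; rewrite inE; exact.
Qed.

End ball.

(** * Differential calculus along lines *)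
Section calculus.
Context {R : realType}.

Lemma is_derive_line0 (V : normedModType R) (f : V -> R) (x v : V) (d : R) :
  is_derive x v f d <-> is_derive (0 : R) 1 (fun t : R => f (x + t *: v)) d.
Proof.
have := is_derive_line f x v 0 d.
by rewrite scale0r addr0.
Qed.

Lemma is_derive1_comp_line (V : normedModType R) (f : V -> R) (h : R -> R) (x v : V) (d d' : R) :
  is_derive x v f d -> is_derive (f x) 1 h d' -> is_derive x v (h \o f) (d' * d).
Proof.
move=> /is_derive_line0 df dh; apply/is_derive_line0.
have dh' : is_derive ((fun t => f (x + t *: v)) 0) 1 h d' by rewrite scale0r addr0.
exact: (@is_derive1_comp _ h (fun t => f (x + t *: v)) 0 d' d).
Qed.

Lemma MVT_line (V : normedModType R) (f b : V -> R) (v : V) :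
  (forall x, is_derive x v f (b x)) -> forall x (h : R),
  exists2 xi : R, `|xi| <= `|h| & f (x + h *: v) - f x = h * b (x + xi *: v).
Proof.
move=> df x h.
have dl (r : R) : is_derive r 1 (fun t => f (x + t *: v)) (b (x + r *: v)).
  exact: (is_derive_line f x v r _).1 (df _).
have cl : continuous (fun t : R => f (x + t *: v)).
  by move=> r; apply: differentiable_continuous; apply/derivable1_diffP; case: (dl r).
have [h0|h0|->] := ltgtP h 0; last first.
- by exists 0; rewrite ?normr0// mul0r scale0r addr0 subrr.
- have [c] := MVT h0 (fun r _ => dl r) (continuous_subspaceT cl).
  rewrite in_itv/= => /andP[c0 ch]; rewrite scale0r addr0 subr0 mulrC => ->.
  by exists c => //; rewrite !gtr0_norm// ltW.
- have [c] := MVT h0 (fun r _ => dl r) (continuous_subspaceT cl).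
  rewrite in_itv/= => /andP[ch c0]; rewrite scale0r addr0 sub0r => E.
  exists c; first by rewrite !ltr0_norm// lerN2 ltW.
  by rewrite -[LHS]opprB E mulrN opprK mulrC.
Qed.

(** The increment along [v + w] is an increment along [v] followed by one along
    [w]; the mean value theorem rewrites the latter, whence the continuity of
    the derivative along [w] alone. *)
Lemma is_deriveDv (V : normedModType R) (f a b : V -> R) (v w : V) :
  (forall x, is_derive x v f (a x)) -> (forall x, is_derive x w f (b x)) ->
  continuous b -> forall x, is_derive x (v + w) f (a x + b x).
Proof.
move=> dv dw cb x.
suff H : h^-1 *: ((f \o shift x) (h *: (v + w)) - f x) @[h --> 0^'] --> a x + b x.
  by split; [apply/cvg_ex; exists (a x + b x)|exact/cvg_lim].
have -> : (fun h : R => h^-1 *: ((f \o shift x) (h *: (v + w)) - f x)) =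
  (fun h => h^-1 *: ((f \o shift x) (h *: v) - f x) +
            h^-1 *: (f (x + h *: v + h *: w) - f (x + h *: v))).
  apply/funext => h; rewrite -[RHS]scalerDr /shift /= [h *: v + x]addrC.
  rewrite [h *: (v + w) + x]addrC [h *: (v + w)]scalerDr !addrA; f_equal; ring.
apply: cvgD; first by case: (dv x) => d <-.
apply/cvgrPdist_le => e e0.
have /nbhs_ballP[dl /= dl0 bdl] : nbhs x [set y | `|b x - b y| <= e].
  by have /cvgrPdist_le := cb x; apply.
near=> h.
have h0 : h != 0 by near: h; exact: nbhs_dnbhs_neq.
have hs : `|h| * (`|v| + `|w| + 1) < dl.
  rewrite -ltr_pdivlMr ?ltr_pwDr ?addr_ge0//.
  near: h; apply: dnbhs0_lt; rewrite divr_gt0// ltr_pwDr ?addr_ge0//.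
have [xi xih ->] := MVT_line dw (x + h *: v) h.
rewrite [_ *: _]mulrA mulVf// mul1r; apply: bdl.
rewrite -ball_normE /= -addrA opprD addNKr normrN.
apply: le_lt_trans hs; rewrite mulrDr mulrDr mulr1.
rewrite (le_trans (ler_normD _ _))// !normrZ ler_wpDr// lerD2l.
by rewrite ler_wpM2r.
Unshelve. all: by end_near. Qed.

Lemma is_deriveZv (V : normedModType R) (f : V -> R) (v : V) (x : V) (a k : R) :
  is_derive x v f a -> is_derive x (k *: v) f (k * a).
Proof.
move=> /is_derive_line0 d1; apply/is_derive_line0.
have -> : (fun t : R => f (x + t *: (k *: v))) = (fun t => f (x + t *: v)) \o (fun t => t * k).
  by apply/funext => t /=; rewrite scalerA.
rewrite mulrC.
apply: is_derive1_comp; first by rewrite mul0r.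
have -> : (fun t : R => t * k) = k \*: (@id R).
  by apply/funext => t /=; rewrite mulrC.
by apply: is_derive_eq; rewrite [LHS]mulr1.
Qed.

Lemma is_derive_translate (V : normedModType R) (f : V -> R) (x u v : V) (d : R) :
  is_derive (x + u) v f d -> is_derive x v (fun y => f (y + u)) d.
Proof.
move=> /is_derive_line0 df; apply/is_derive_line0.
rewrite (_ : (fun t => _) = fun t => f ((x + u) + t *: v))//.
by apply/funext => t; rewrite addrAC.
Qed.

(** If [d2 > 0] then [dg > 0] just to the right of the critical point 0, and the
    mean value theorem contradicts the maximum. *)
Lemma second_derivative_test (g dg : R -> R) (d2 e : R) : 0 < e ->
  (forall t : R, is_derive t 1 g (dg t)) -> is_derive (0 : R) 1 dg d2 ->
  (forall t, `|t| < e -> g t <= g 0) -> d2 <= 0.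
Proof.
move=> e0 dg1 dg2 gmax; rewrite leNgt; apply/negP => d20.
have cg : continuous g.
  by move=> r; apply: differentiable_continuous; apply/derivable1_diffP; case: (dg1 r).
have dg0 : dg 0 = 0.
  have H : is_derive (0 : R) 1 g 0.
    apply: (@derive1_at_max R g (- e) e 0); first by lra.
    - by move=> t _; case: (dg1 t).
    - by rewrite in_itv/= oppr_lt0 e0.
    - by move=> t; rewrite in_itv/= -ltr_norml; exact: gmax.
  by case: (dg1 0) => _ <-; case: H.
have : h^-1 *: ((dg \o shift 0) (h *: 1) - dg 0) @[h --> 0^'] --> d2.
  by case: dg2 => d <-.
move=> /cvgrPdist_lt /(_ _ d20); rewrite near_withinE => /nbhs_ballP[dl /= dl0 bdl].
pose h := Num.min (dl / 2) (e / 2).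
have h0 : 0 < h by rewrite lt_min; apply/andP; split; lra.
have hdl : h <= dl / 2 by rewrite ge_min lexx.
have he : h <= e / 2 by rewrite ge_min lexx orbT.
have [c] := MVT h0 (fun r _ => dg1 r) (continuous_subspaceT cg).
rewrite in_itv/= subr0 => /andP[c0 ch] E.
have dgc : 0 < dg c.
  have /= := bdl c; rewrite -ball_normE /= sub0r normrN gtr0_norm// gt_eqF//.
  move=> /(_ _ isT) H; have {}H : `|d2 - c^-1 * dg c| < d2.
    by move: H; rewrite addr0 [c *: 1]mulr1 dg0 subr0; apply; lra.
  have : 0 < c^-1 * dg c by have := ler_norm (d2 - c^-1 * dg c); lra.
  by rewrite pmulr_rgt0// invr_gt0.
have := gmax h; rewrite gtr0_norm// => /(_ _) H.
have : 0 < dg c * h by rewrite mulr_gt0.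
rewrite -E subr_gt0 ltNge H//; lra.
Qed.

(** The mean value theorem, applied twice to the second difference in either
    order, expresses it by each of the two mixed derivatives. *)
Lemma schwarz (V : normedModType R) (f fv fw fvw fwv : V -> R) (v w : V) :
  (forall x, is_derive x v f (fv x)) -> (forall x, is_derive x w f (fw x)) ->
  (forall x, is_derive x w fv (fvw x)) -> (forall x, is_derive x v fw (fwv x)) ->
  continuous fvw -> continuous fwv -> fvw =1 fwv.
Proof.
move=> dv dw dvw dwv cvw cwv x.
(* the second difference of f, for equal increments h *)
have key (h : R) : exists xi eta xi' eta', [/\ `|xi| <= `|h|, `|eta| <= `|h|,
    `|xi'| <= `|h|, `|eta'| <= `|h| &
    h * (h * fvw (x + xi *: v + eta *: w)) = h * (h * fwv (x + xi' *: w + eta' *: v))].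
  have d1 y : is_derive y v (fun y => f (y + h *: w) - f y) (fv (y + h *: w) - fv y).
    exact: (is_deriveB (is_derive_translate (dv (y + h *: w))) (dv y)).
  have d2 y : is_derive y w (fun y => f (y + h *: v) - f y) (fw (y + h *: v) - fw y).
    exact: (is_deriveB (is_derive_translate (dw (y + h *: v))) (dw y)).
  have [xi xih E1] := MVT_line d1 x h.
  have [eta etah E2] := MVT_line dvw (x + xi *: v) h.
  have [xi' xih' E1'] := MVT_line d2 x h.
  have [eta' etah' E2'] := MVT_line dwv (x + xi' *: w) h.
  exists xi, eta, xi', eta'; split => //.
  rewrite -E2 -E2' -E1 -E1' (addrAC x (h *: v)).
  ring.
apply/eqP; rewrite -subr_eq0 -normr_le0; apply/ler_addgt0Pl => e e0; rewrite addr0.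
have e20 : 0 < e / 2 by lra.
have /nbhs_ballP[r1 /= r10 b1] : nbhs x [set y | `|fvw x - fvw y| <= e / 2].
  by have /cvgrPdist_le := cvw x; apply.
have /nbhs_ballP[r2 /= r20 b2] : nbhs x [set y | `|fwv x - fwv y| <= e / 2].
  by have /cvgrPdist_le := cwv x; apply.
pose r := Num.min r1 r2.
have r0 : 0 < r by rewrite lt_min r10.
have rr1 : r <= r1 by rewrite ge_min lexx.
have rr2 : r <= r2 by rewrite ge_min lexx orbT.
pose h := r / 2 / (`|v| + `|w| + 1).
have N0 : 0 < `|v| + `|w| + 1 by rewrite ltr_pwDr ?addr_ge0.
have h0 : 0 < h by rewrite !divr_gt0.
have hr : h * (`|v| + `|w|) < r.
  have E : h * (`|v| + `|w| + 1) = r / 2 by rewrite /h divfK ?gt_eqF.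
  by rewrite mulrDr mulr1 in E; lra.
have [xi [eta [xi' [eta' []]]]] := key h; rewrite (gtr0_norm h0) => H1 H2 H3 H4.
have hn0 : h != 0 by rewrite gt_eqF.
move=> /(mulfI hn0)/(mulfI hn0) E.
have B a b (p q : V) : `|a| <= h -> `|b| <= h -> `|p| + `|q| = `|v| + `|w| ->
    ball x r (x + a *: p + b *: q).
  move=> ah bh pq; rewrite -ball_normE /= -addrA opprD addNKr normrN.
  apply: le_lt_trans hr; rewrite -pq mulrDr (le_trans (ler_normD _ _))// !normrZ.
  by rewrite lerD// ler_wpM2r.
have F1 := b1 _ (le_ball rr1 (B _ _ _ _ H1 H2 erefl)).
have F2 := b2 _ (le_ball rr2 (B _ _ _ _ H3 H4 (addrC _ _))).
rewrite /= in F1 F2.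
rewrite -E in F2.
rewrite (le_trans (ler_distD (fvw (x + xi *: v + eta *: w)) _ _))//.
rewrite [X in _ + X]distrC; lra.
Qed.

End calculus.

(** * Functions of class C1 with their gradients *)
Section C1.
Context {R : realType} {n : nat}.
Implicit Types (f g : 'rV[R]_n -> R) (df dg : 'I_n -> 'rV[R]_n -> R).
Local Notation e_ i := (delta_mx 0 i : 'rV[R]_n).

(** The gradient is a parameter rather than computed from [f], so that the
    rules of calculus below produce it explicitly. *)
Record C1 f df : Prop := C1Def {
  C1_continuous : continuous f ;
  C1_derive : forall i x, is_derive x (e_ i) f (df i x) ;
  C1_continuous_grad : forall i, continuous (df i) }.

Lemma continuousM f g : continuous f -> continuous g -> continuous (fun x => f x * g x).
Proof. by move=> cf cg x; exact: (cvgM (cf x) (cg x)). Qed.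

Lemma continuousA f g : continuous f -> continuous g -> continuous (fun x => f x + g x).
Proof. by move=> cf cg x; exact: (cvgD (cf x) (cg x)). Qed.

Lemma continuous_opp f : continuous f -> continuous (fun x => - f x).
Proof. by move=> cf x; exact: (cvgN (cf x)). Qed.

Lemma continuousMc (a : R) f : continuous f -> continuous (fun x => a * f x).
Proof. by move=> cf; apply: continuousM => //; exact: cst_continuous. Qed.

Lemma continuous_comp1 (h : R -> R) f : continuous h -> continuous f -> continuous (h \o f).
Proof. by move=> ch cf x; apply: continuous_comp; [exact: cf|exact: ch]. Qed.

Lemma continuous_norm f : continuous f -> continuous (fun x => `|f x|).
Proof. by move=> cf x; exact: (cvg_norm (cf x)). Qed.

Lemma C1M f df g dg : C1 f df -> C1 g dg ->
  C1 (fun x => f x * g x) (fun i x => f x * dg i x + df i x * g x).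
Proof.
move=> [cf ddf cdf] [cg ddg cdg]; split; first exact: continuousM.
  move=> i x; apply: is_derive_eq (is_deriveM (ddf i x) (ddg i x)) _.
  by rewrite [in LHS]/GRing.scale /= [g x * _]mulrC.
by move=> i; apply: continuousA; exact: continuousM.
Qed.

Lemma C1D f df g dg : C1 f df -> C1 g dg ->
  C1 (fun x => f x + g x) (fun i x => df i x + dg i x).
Proof.
move=> [cf ddf cdf] [cg ddg cdg]; split; first exact: continuousA.
  by move=> i x; exact: is_deriveD.
by move=> i; exact: continuousA.
Qed.

Lemma C1_cst (a : R) : C1 (cst a) (fun _ => cst 0).
Proof.
split; first exact: cst_continuous.
  by move=> i x; exact: is_derive_cst.
by move=> i; exact: cst_continuous.
Qed.

Lemma C1Z (a : R) f df : C1 f df -> C1 (fun x => a * f x) (fun i x => a * df i x).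
Proof.
move=> /(C1M (C1_cst a)); congr C1.
by apply/funext => i; apply/funext => x; rewrite mul0r addr0.
Qed.

Lemma C1V f df : (forall x, 0 < f x) -> C1 f df ->
  C1 (fun x => (f x)^-1) (fun i x => - (f x) ^- 2 * df i x).
Proof.
move=> f0 [cf ddf cdf]; have fn0 x : f x != 0 by rewrite gt_eqF.
have cV : continuous (fun x => (f x)^-1) by move=> x; exact: (cvgV (fn0 x) (cf x)).
split => //.
  move=> i x; split; first by apply: derivableV => //; case: (ddf i x).
  by rewrite deriveV//; case: (ddf i x) => _ ->.
move=> i; apply: continuousM => //; apply: continuous_opp.
rewrite (_ : (fun x => _) = (fun x => (f x)^-1 * (f x)^-1)); first exact: continuousM.
by apply/funext => x; rewrite -exprVn expr2.
Qed.

Lemma C1_is_derive f df : C1 f df -> forall x v, is_derive x v f (\sum_i v 0 i * df i x).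
Proof.
move=> [cf ddf cdf] x v.
rewrite {1}(row_sum_delta v).
elim: (index_enum _) x => [|i s IH] x.
  by rewrite !big_nil; exact: is_derive0.
rewrite !big_cons.
apply: (@is_deriveDv _ _ f (fun x => v 0 i * df i x) (fun x => \sum_(j <- s) v 0 j * df j x)) => //.
  by move=> y; apply: is_deriveZv.
apply: (continuous_sum (f := fun j x => v 0 j * df j x)) => j; exact: continuousMc.
Qed.

Lemma C1_partial f df : C1 f df -> forall i, partial i f = df i.
Proof. by move=> [_ ddf _] i; apply/funext => x; case: (ddf i x). Qed.

Lemma I_ibp f df g dg i : C1 f df -> C1 g dg -> bsupp g ->
  I (fun x => f x * dg i x) = - I (fun x => df i x * g x).
Proof.
move=> cf cg sg; have cfg := C1M cf cg.
have Cg : Cc g by split => //; exact: C1_continuous cg.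
have Cdg : Cc (dg i).
  by split; [exact: (C1_continuous_grad cg (i := i))|exact: bsupp_derive sg (C1_derive cg i)].
have Cfg := CcMl (C1_continuous cf) Cg.
have := I_derive Cfg (C1_continuous_grad cfg (i := i)) (C1_derive cfg i).
rewrite ID; last 2 first.
- exact: CcMl (C1_continuous cf) Cdg.
- exact: CcMl (C1_continuous_grad cf (i := i)) Cg.
by move/eqP; rewrite addr_eq0 => /eqP.
Qed.

Lemma C1_translate f df (v : 'rV[R]_n) : C1 f df -> C1 (fun x => f (x + v)) (fun i x => df i (x + v)).
Proof.
move=> [cf ddf cdf].
have c (g : 'rV[R]_n -> R) : continuous g -> continuous (fun x : 'rV[R]_n => g (x + v)).
  move=> cg x; apply: continuous_comp; last exact: cg.
  exact: (cvgD (@cvg_id _ _) (cvg_cst v)).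
split; first exact: c.
  by move=> i x; apply: is_derive_translate.
by move=> i; exact: c.
Qed.

End C1.

(** * Cutoffs *)
Section cutoff.
Context {R : realType}.

(** The square of the positive part: the simplest function of class C1 that
    vanishes on a half-line. *)
Definition pos_sq (t : R) : R := Num.max 0 t ^+ 2.

Lemma is_derive_pos_sq (t : R) : is_derive t 1 pos_sq (2 * Num.max 0 t).
Proof.
suff H : h^-1 *: ((pos_sq \o shift t) (h *: 1) - pos_sq t) @[h --> 0^'] --> 2 * Num.max 0 t.
  by split; [apply/cvg_ex; eexists; exact: H|exact/cvg_lim].
apply/cvgrPdist_le => e e0; near=> h.
have h0 : h != 0 by near: h; exact: nbhs_dnbhs_neq.
have he : `|h| <= e by apply: ltW; near: h; exact: dnbhs0_lt.
rewrite -(ler_pM2l (x := `|h|)) ?normr_gt0// -normrM mulrBr /GRing.scale /= mulr1 [h * (h^-1 * _)]mulrA divff// mul1r.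
rewrite (@le_trans _ _ (h ^+ 2))//; last first.
  by rewrite -real_normK ?num_real// expr2 ler_wpM2l.
rewrite /= /pos_sq ler_norml.
by rewrite /Num.max; do 2 case: ifPn; rewrite -?leNgt => H1 H2; apply/andP; split; nra.
Unshelve. all: by end_near. Qed.

Lemma continuous_max0 : continuous (fun t : R => Num.max 0 t).
Proof.
rewrite (_ : (fun t => _) = fun t => (t + `|t|) * 2^-1); last first.
  by apply/funext => t; case: (leP 0 t) => t0; [rewrite ger0_norm|rewrite ltr0_norm]; lra.
move=> t; apply: cvgM; last exact: cvg_cst.
by apply: cvgD; [exact: cvg_id|apply: cvg_norm; exact: cvg_id].
Qed.

(** The constant 9 makes [chi] vanish for [|t| >= 2], where
    [(t ^+ 2 - 1) ^+ 2 >= 9]. *)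
Definition chi (t : R) : R := pos_sq (1 - pos_sq (t ^+ 2 - 1) / 9).
Definition dchi (t : R) : R := 2 * Num.max 0 (1 - pos_sq (t ^+ 2 - 1) / 9) *
  (- (2 * Num.max 0 (t ^+ 2 - 1) * (2 * t)) / 9).

Lemma is_derive_chi (t : R) : is_derive t 1 chi (dchi t).
Proof.
have d1 : is_derive t 1 (fun t : R => t ^+ 2 - 1) (2 * t).
  have did : is_derive t 1 (fun t : R => t) 1 by exact: is_derive_id.
  have dc : is_derive t 1 (fun _ : R => 1 : R) 0 by exact: is_derive_cst.
  apply: is_derive_eq (is_deriveB (is_deriveM did did) dc) _.
  by rewrite /GRing.scale /=; ring.
have d2 := @is_derive1_comp R pos_sq (fun t => t ^+ 2 - 1) t _ _
  (is_derive_pos_sq (t ^+ 2 - 1)) d1.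
have d3 : is_derive t 1 (fun t => 1 - pos_sq (t ^+ 2 - 1) / 9)
    (- (2 * Num.max 0 (t ^+ 2 - 1) * (2 * t)) / 9).
  have dc (c : R) : is_derive t 1 (fun _ : R => c) 0 by exact: is_derive_cst.
  apply: is_derive_eq (is_deriveB (dc 1) (is_deriveM d2 (dc 9^-1))) _.
  by rewrite /GRing.scale /=; ring.
exact: (@is_derive1_comp R pos_sq (fun t => 1 - pos_sq (t ^+ 2 - 1) / 9) t _ _
  (is_derive_pos_sq _) d3).
Qed.

Lemma continuous_chi : continuous chi.
Proof.
move=> t; apply: differentiable_continuous; apply/derivable1_diffP.
by case: (is_derive_chi t).
Qed.

Lemma continuous_dchi : continuous dchi.
Proof.
have cid : continuous (fun t : R => t) by move=> t; exact: cvg_id.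
have c1 : continuous (fun t : R => t ^+ 2 - 1).
  by move=> t; apply: cvgB; [exact: exprn_continuous|exact: cvg_cst].
have c2 : continuous (fun t : R => Num.max 0 (t ^+ 2 - 1)).
  by move=> t; apply: (continuous_comp (c1 t)); exact: continuous_max0.
have c3 : continuous (fun t : R => pos_sq (t ^+ 2 - 1)).
  have cps : continuous pos_sq.
    move=> t; apply: differentiable_continuous; apply/derivable1_diffP.
    by case: (is_derive_pos_sq t).
  by move=> t; apply: (continuous_comp (c1 t)); exact: cps.
have c4 : continuous (fun t : R => 1 - pos_sq (t ^+ 2 - 1) / 9).
  move=> t; apply: cvgB; first exact: cvg_cst.
  by apply: cvgM; [exact: c3|exact: cvg_cst].
move=> t; apply: cvgM.
  apply: cvgM; first exact: cvg_cst.
  by apply: (continuous_comp (c4 t)); exact: continuous_max0.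
apply: cvgM; last exact: cvg_cst.
apply: cvgN; apply: cvgM; first by apply: cvgM; [exact: cvg_cst|exact: c2].
by apply: cvgM; [exact: cvg_cst|exact: cvg_id].
Qed.

Lemma chi_ge0 t : 0 <= chi t.
Proof. exact: sqr_ge0. Qed.

Lemma max0P (t : R) : (t <= 0 /\ Num.max 0 t = 0) \/ (0 <= t /\ Num.max 0 t = t).
Proof.
case: (leP t 0) => t0; [left|right]; split => //; exact: ltW.
Qed.

Lemma chi_le1 t : chi t <= 1.
Proof.
rewrite /chi /pos_sq; have := sqr_ge0 (Num.max 0 (t ^+ 2 - 1)).
set w := _ ^+ 2 => w0; have [[_ ->]|[h ->]] := max0P (1 - w / 9).
  by rewrite expr0n.
by rewrite expr_le1//; lra.
Qed.

Lemma sqr_le1E (t : R) : `|t| <= 1 -> t ^+ 2 - 1 <= 0.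
Proof. by move=> t1; rewrite subr_le0 -real_normK ?num_real// expr_le1. Qed.

Lemma sqr_ge4E (t : R) : 2 <= `|t| -> 4 <= t ^+ 2.
Proof. by move=> t1; rewrite -real_normK ?num_real//; nra. Qed.

Lemma chi_eq1 t : `|t| <= 1 -> chi t = 1.
Proof.
move=> /sqr_le1E t1; rewrite /chi /pos_sq (max_idPl t1) expr0n mul0r subr0.
by rewrite (max_idPr ler01) expr1n.
Qed.

Lemma chi_eq0 t : 2 <= `|t| -> chi t = 0.
Proof.
move=> /sqr_ge4E t4; have h : 0 <= t ^+ 2 - 1 by lra.
rewrite /chi /pos_sq (max_idPr h) (@max_idPl _ _ _ _ _) ?expr0n//.
have : 3 ^+ 2 <= (t ^+ 2 - 1) ^+ 2 by rewrite lerXn2r// ?nnegrE; lra.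
lra.
Qed.

Lemma dchi_eq0 t : `|t| <= 1 \/ 2 <= `|t| -> dchi t = 0.
Proof.
case=> [/sqr_le1E t1|/sqr_ge4E t4].
  by rewrite /dchi (max_idPl t1) mulr0 mul0r oppr0 mul0r mulr0.
have h : 0 <= t ^+ 2 - 1 by lra.
rewrite /dchi /pos_sq (max_idPr h) (@max_idPl _ _ _ _ _) ?mulr0 ?mul0r//.
have : 3 ^+ 2 <= (t ^+ 2 - 1) ^+ 2 by rewrite lerXn2r// ?nnegrE; lra.
lra.
Qed.

Lemma dchi_le t : `|dchi t| <= 6.
Proof.
have [t2|t2] := leP 2 `|t|; first by rewrite dchi_eq0 ?normr0//; right.
have t4 : t ^+ 2 <= 4.
  by rewrite -real_normK ?num_real//; have := normr_ge0 t; nra.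
rewrite /dchi; have := sqr_ge0 (Num.max 0 (t ^+ 2 - 1)); rewrite -/(pos_sq _).
set w := pos_sq _ => w0.
have A : 0 <= Num.max 0 (1 - w / 9) <= 1 by rewrite le_max lexx/= ge_max; lra.
have B : 0 <= Num.max 0 (t ^+ 2 - 1) <= 3 by rewrite le_max lexx/= ge_max; lra.
move: A B; set a := Num.max _ _; set b := Num.max _ _ => /andP[a0 a1] /andP[b0 b3].
rewrite !normrM normrV ?unitfE// normrN !normrM (ger0_norm a0) (ger0_norm b0).
have t0 := normr_ge0 t; rewrite [leLHS](_ : _ = 8 / 9 * (a * b * `|t|)); last first.
  by rewrite !(@normr_nat R); field.
have ab : a * b <= 1 * 3 by exact: ler_pM.
have : a * b * `|t| <= 3 * 2 by apply: ler_pM; rewrite ?mulr_ge0//; lra.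
lra.
Qed.

End cutoff.

Section tensor.
Context {R : realType} {n : nat}.
Local Notation e_ i := (delta_mx 0 i : 'rV[R]_n).
Implicit Types (c dc : 'I_n -> R -> R) (x : 'rV[R]_n).

Definition tensor c x : R := \prod_j c j (x 0 j).
Definition dtensor c dc (i : 'I_n) x : R :=
  dc i (x 0 i) * \prod_(j | j != i) c j (x 0 j).

Lemma continuous_coordc (h : R -> R) (i : 'I_n) : continuous h ->
  continuous (fun x : 'rV[R]_n => h (x 0 i)).
Proof.
move=> ch x; apply: (@continuous_comp _ _ _ (fun y : 'rV[R]_n => y 0 i) h).
  exact: coord_continuous.
exact: ch.
Qed.

Lemma C1_tensor c dc : (forall i, continuous (dc i)) ->
  (forall i (t : R), is_derive t 1 (c i) (dc i t)) -> C1 (tensor c) (dtensor c dc).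
Proof.
move=> cdc dc1; have cc i : continuous (c i).
  by move=> t; apply: differentiable_continuous; apply/derivable1_diffP; case: (dc1 i t).
split.
- by apply: (continuous_prod (f := fun j x => c j (x 0 j))) => j; exact: continuous_coordc.
- move=> i x; apply/is_derive_line0.
  pose k := \prod_(j | j != i) c j (x 0 j).
  rewrite (_ : (fun t => _) = fun t => c i (x 0 i + t) * k); last first.
    apply/funext => t; rewrite /tensor (bigD1 i)//= !mxE !eqxx mulr1; congr (_ * _).
    by apply: eq_bigr => j ji; rewrite !mxE eqxx (negbTE ji) /= mulr0 addr0.
  have d0 : is_derive (0 : R) 1 (fun t => x 0 i + t) 1.
    have dcst : is_derive (0 : R) 1 (fun _ : R => x 0 i) 0 by exact: is_derive_cst.
    by apply: is_derive_eq (is_deriveD dcst (is_derive_id (0 : R) 1)) _; rewrite add0r.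
  have d1 : is_derive (0 : R) 1 (fun t => c i (x 0 i + t)) (dc i (x 0 i)).
    rewrite -[X in is_derive _ _ _ X]mulr1.
    apply: (@is_derive1_comp _ (c i) (fun t => x 0 i + t)) => //.
    by rewrite addr0.
  have dk : is_derive (0 : R) 1 (fun _ : R => k) 0 by exact: is_derive_cst.
  apply: is_derive_eq (is_deriveM d1 dk) _.
  by rewrite /GRing.scale /= mulr0 add0r mulrC.
- move=> i; apply: continuousM; first exact: continuous_coordc.
  by apply: (continuous_prod (f := fun j x => c j (x 0 j))) => j; exact: continuous_coordc.
Qed.

Lemma tensor_ge0 c x : (forall j t, 0 <= c j t) -> 0 <= tensor c x.
Proof. by move=> c0; apply: prodr_ge0. Qed.

Lemma bsupp_tensor c (k : R) : (forall j t, k < `|t| -> c j t = 0) -> bsupp (tensor c).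
Proof. by move=> c0; exists k => x i xk; rewrite /tensor (bigD1 i)//= c0// mul0r. Qed.

End tensor.

Section zeta.
Context {R : realType} {n : nat}.
Implicit Types (x : 'rV[R]_n) (r : R).

(** Cutoffs are products over the coordinates: their supports are cubes, and
    their integrals along a coordinate line are explicit. *)
Definition zeta r : 'rV[R]_n -> R := tensor (fun _ t => chi (t / r)).
Definition dzeta r : 'I_n -> 'rV[R]_n -> R :=
  dtensor (fun _ t => chi (t / r)) (fun _ t => dchi (t / r) / r).

Lemma is_derive_chi_scaled r (t : R) : is_derive t 1 (fun t : R => chi (t / r)) (dchi (t / r) / r).
Proof.
apply: (@is_derive1_comp _ chi (fun t => t / r)); first exact: is_derive_chi.
have dc : is_derive t 1 (fun _ : R => r^-1) 0 by exact: is_derive_cst.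
apply: is_derive_eq (is_deriveM (is_derive_id t 1) dc) _.
by rewrite /GRing.scale /= mulr0 add0r mulr1.
Qed.

Lemma continuous_scaled (h : R -> R) r : continuous h -> continuous (fun t : R => h (t / r)).
Proof.
move=> ch t; apply: (@continuous_comp R R R (fun t => t / r) h).
  by apply: cvgM; [exact: cvg_id|exact: cvg_cst].
exact: ch.
Qed.

Lemma C1_zeta r : C1 (zeta r) (dzeta r).
Proof.
apply: C1_tensor => i; last exact: is_derive_chi_scaled.
move=> t; apply: cvgM; last exact: cvg_cst.
by apply: continuous_scaled; exact: continuous_dchi.
Qed.

Lemma norm_div_gt0 (t r : R) : 0 < r -> `|t / r| = `|t| / r.
Proof. by move=> r0; rewrite normrM normfV (gtr0_norm r0). Qed.

Lemma zeta_eq0 r x i : 0 < r -> 2 * r <= `|x 0 i| -> zeta r x = 0.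
Proof.
move=> r0 xi; rewrite /zeta /tensor (bigD1 i)//= chi_eq0 ?mul0r//.
by rewrite norm_div_gt0// ler_pdivlMr.
Qed.

Lemma zeta_eq1 r x : 0 < r -> (forall i, `|x 0 i| <= r) -> zeta r x = 1.
Proof.
move=> r0 xr; rewrite /zeta /tensor big1// => j _; rewrite chi_eq1//.
by rewrite norm_div_gt0// ler_pdivrMr// mul1r.
Qed.

Lemma Cc_zeta r : 0 < r -> Cc (zeta r).
Proof.
move=> r0; split; first exact: C1_continuous (C1_zeta r).
by exists (2 * r) => x i /ltW xi; exact: zeta_eq0 xi.
Qed.

Lemma zeta_ge0 r x : 0 <= zeta r x.
Proof. by apply: tensor_ge0 => j t; exact: chi_ge0. Qed.

Lemma zeta_le1 r x : zeta r x <= 1.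
Proof. by apply: prodr_ile1 => j _; rewrite chi_ge0 chi_le1. Qed.

Lemma dzeta_le r i x : 0 < r -> `|dzeta r i x| <= 6 / r.
Proof.
move=> r0; rewrite /dzeta /dtensor normrM norm_div_gt0// -[leRHS]mulr1.
apply: ler_pM => //; first by rewrite divr_ge0// ltW.
  by rewrite ler_pM2r ?invr_gt0// dchi_le.
rewrite ger0_norm; last by apply: prodr_ge0 => j _; exact: chi_ge0.
by apply: prodr_ile1 => j _; rewrite chi_ge0 chi_le1.
Qed.

(** The gradient of a cutoff lives where the cutoff at twice the scale is one
    and the cutoff at half the scale vanishes. *)
Lemma dzeta_support r i x : 0 < r ->
  dzeta r i x = 0 \/ zeta (2 * r) x = 1 /\ zeta (r / 2) x = 0.
Proof.
move=> r0; have [xr|xr] := leP (`|x 0 i|) r.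
  left; rewrite /dzeta /dtensor dchi_eq0 ?mul0r//; left.
  by rewrite norm_div_gt0// ler_pdivrMr// mul1r.
have [xr2|] := pselect (forall j, `|x 0 j| <= 2 * r).
  right; split; first by apply: zeta_eq1 => //; lra.
  by apply: (@zeta_eq0 _ _ i); lra.
move=> /existsNP[j /negP]; rewrite -ltNge => xj; left.
have h : 2 <= `|x 0 j / r| by rewrite norm_div_gt0// ler_pdivlMr// ltW.
rewrite /dzeta /dtensor; have [ji|ji] := eqVneq j i.
  by rewrite dchi_eq0 ?mul0r//; right; rewrite -ji.
by rewrite (bigD1 j)//= chi_eq0 ?mul0r ?mulr0.
Qed.

Lemma dzeta_le_zeta r i x : 0 < r -> `|dzeta r i x| <= 6 / r * zeta (2 * r) x.
Proof.
move=> r0; have [->|[-> _]] := dzeta_support i x r0.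
  by rewrite normr0 mulr_ge0 ?zeta_ge0// divr_ge0// ltW.
by rewrite mulr1 dzeta_le.
Qed.

End zeta.

(** * Exchange of derivatives under the integral *)
Section null_lagrangian.
Context {R : realType} {n : nat}.
Implicit Types (f : 'rV[R]_n -> R) (x : 'rV[R]_n).
Local Notation e_ i := (delta_mx 0 i : 'rV[R]_n).

Lemma cvg_quotient (V : normedModType R) (f : V -> R) (x v : V) (d : R) (t_ : nat -> R) :
  is_derive x v f d -> (forall k, t_ k != 0) -> t_ k @[k --> \oo] --> 0 ->
  (f (x + t_ k *: v) - f x) / t_ k @[k --> \oo] --> d.
Proof.
move=> df t0 tc.
have H : h^-1 *: ((f \o shift x) (h *: v) - f x) @[h --> 0^'] --> d.
  by case: df => df <-.
have /cvgr_dnbhsP/(_ t_ (conj t0 tc)) := H.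
apply: cvg_trans; apply: near_eq_cvg; near=> k.
by rewrite /= mulrC [_ + x]addrC.
Unshelve. all: by end_near. Qed.

Definition harm (k : nat) : R := k.+1%:R^-1.

Lemma harm_gt0 k : 0 < harm k. Proof. by rewrite invr_gt0. Qed.

Lemma harm_le1 k : harm k <= 1. Proof. by rewrite invf_le1// ler1n. Qed.

Lemma cvg_harm : harm k @[k --> \oo] --> 0. Proof. exact: cvg_harmonic. Qed.

(** Mixed derivatives can be exchanged under the integral although neither
    factor is twice differentiable: difference quotients replace one of the
    two derivatives, and they commute with the other one. *)
Lemma I_exchange_derivatives (A B : 'rV[R]_n -> R) (dA dB : 'I_n -> 'rV[R]_n -> R) i j :
  C1 A dA -> C1 B dB -> bsupp B ->
  I (fun x => dA i x * dB j x) = I (fun x => dA j x * dB i x).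
Proof.
move=> cA cB sB.
have CB : Cc B by split => //; exact: C1_continuous cB.
have CdB l : Cc (dB l).
  split; first exact: (C1_continuous_grad cB (i := l)).
  exact: bsupp_derive sB (C1_derive cB l).
have cdA l : continuous (dA l) by exact: (C1_continuous_grad cA (i := l)).
pose DA (t : R) x := (A (x + t *: e_ i) - A x) / t.
pose DB (t : R) x := (B (x + t *: e_ i) - B x) / t.
have key t : t != 0 -> I (fun x => DA t x * dB j x) = I (fun x => dA j x * DB (- t) x).
  move=> t0.
  have cDA : C1 (DA t) (fun l x => (dA l (x + t *: e_ i) - dA l x) / t).
    have := C1Z t^-1 (C1D (C1_translate (t *: e_ i) cA) (C1Z (-1) cA)).
    congr C1; first by apply/funext => x; rewrite /DA mulN1r mulrC.
    by apply/funext => l; apply/funext => x; rewrite mulN1r mulrC.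
  rewrite (I_ibp j cDA cB sB).
  have cAt l : continuous (fun x => dA l (x + t *: e_ i)).
    exact: (C1_continuous_grad (C1_translate (t *: e_ i) cA) (i := l)).
  have C2 : Cc (fun x => dA j x * B x) by exact: CcMl.
  have C1' : Cc (fun x => dA j (x + t *: e_ i) * B x) by exact: CcMl.
  have C3 : Cc (fun x => dA j x * B (x + - t *: e_ i)).
    by apply: CcMl => //; exact: Cc_shift.
  rewrite (_ : (fun x => _ * B x) =
    (fun x => t^-1 * (dA j (x + t *: e_ i) * B x - dA j x * B x))); last first.
    by apply/funext => x; ring.
  rewrite (_ : (fun x => _ * DB _ x) =
    (fun x => - t^-1 * (dA j x * B (x + - t *: e_ i) - dA j x * B x))); last first.
    by apply/funext => x; rewrite /DB invrN; ring.
  rewrite !IZ ?IB//; try exact: CcB.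
  rewrite mulNr; congr (- (_ * (_ - _))).
  rewrite -(I_shift i t C3); congr I; apply/funext => x.
  by rewrite -addrA -scalerDl subrr scale0r addr0.
have [ki sBi] := (CdB i).2; have [kj sBj] := (CdB j).2.
pose k := `|ki| + `|kj|.
have k0 : 0 <= k by rewrite addr_ge0.
have kik : ki <= k by rewrite (le_trans (ler_norm _))// lerDl.
have kjk : kj <= k by rewrite (le_trans (ler_norm _))// lerDr.
have k1 : 0 < k + 1 by rewrite ltr_pwDr.
pose zt := zeta (k + 1) : 'rV[R]_n -> R.
have box_shift (x : 'rV[R]_n) (s : R) l K : `|s| <= 1 -> `|x 0 l| <= K ->
    `|(x + s *: e_ i) 0 l| <= K + 1.
  move=> s1 xl; rewrite !mxE eqxx /=; rewrite (le_trans (ler_normD _ _))// lerD//.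
  by case: (l == i); rewrite ?mulr1 ?mulr0 ?normr0.
have [MA MA0 HA] := bounded_on_box (k + 1) (cdA i).
have [MB HB] := Cc_bounded (CdB i).
have MB0 : 0 <= MB by exact: le_trans (normr_ge0 _) (HB 0).
have h0 (k' : nat) : harm k' != 0 by rewrite gt_eqF// harm_gt0.
have h1 (k' : nat) : `|harm k'| <= 1 by rewrite gtr0_norm ?harm_gt0// harm_le1.
have lim1 : I (fun x => DA (harm k') x * dB j x) @[k' --> \oo] --> I (fun x => dA i x * dB j x).
  apply: (I_cvg (psi := fun x => MA * `|dB j x|)).
  - move=> k'; apply: CcMl => //.
    apply: continuousM; last exact: cst_continuous.
    apply: continuousA; last exact/continuous_opp/(C1_continuous cA).
    exact: C1_continuous (C1_translate (harm k' *: e_ i) cA).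
  - exact: CcMl.
  - split; first exact/continuousMc/continuous_norm/(CdB j).1.
    by have [l dl] := (CdB j).2; exists l => x m /dl ->; rewrite normr0 mulr0.
  - move=> k' x; rewrite normrM.
    have [xk|] := pselect (forall l, `|x 0 l| <= k); last first.
      move=> /existsNP[l /negP]; rewrite -ltNge => xl.
      by rewrite (sBj x l) ?normr0 ?mulr0// (le_lt_trans kjk).
    rewrite ler_wpM2r//.
    have [xi xik] := MVT_line (C1_derive cA i) x (harm k').
    rewrite /DA => ->; rewrite mulrAC divff// mul1r.
    by apply: HA => l; apply: box_shift; rewrite ?xk// (le_trans xik).
  - move=> x; apply: cvgM; last exact: cvg_cst.
    by apply: cvg_quotient; [exact: C1_derive|exact: h0|exact: cvg_harm].
have lim2 : I (fun x => dA j x * DB (- harm k') x) @[k' --> \oo] --> I (fun x => dA j x * dB i x).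
  apply: (I_cvg (psi := fun x => MB * `|dA j x| * zt x)).
  - move=> k'; apply: CcMl => //; apply: CcMr; last exact: cst_continuous.
    by apply: CcB => //; exact: Cc_shift.
  - exact: CcMl.
  - apply: CcMl; last exact: Cc_zeta.
    exact/continuousMc/continuous_norm.
  - move=> k' x; rewrite normrM [MB * _]mulrC -mulrA ler_wpM2l//.
    have [xi xik E] := MVT_line (C1_derive cB i) x (- harm k').
    rewrite /DB E mulrAC divff ?oppr_eq0// mul1r.
    have [xk|] := pselect (forall l, `|x 0 l| <= k + 1).
      by rewrite /zt zeta_eq1// mulr1.
    move=> /existsNP[l /negP]; rewrite -ltNge => xl.
    rewrite (sBi _ l) ?normr0 ?mulr_ge0 ?zeta_ge0//.
    rewrite ltNge; apply/negP => xe; move: xl; rewrite ltNge => /negP; apply.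
    have := box_shift (x + xi *: e_ i) (- xi) l k.
    rewrite -addrA -scalerDl subrr scale0r addr0 normrN; apply.
      by rewrite (le_trans xik)// normrN.
    exact: le_trans xe kik.
  - move=> x; apply: cvgM; first exact: cvg_cst.
    apply: cvg_quotient; first exact: C1_derive.
      by move=> k'; rewrite oppr_eq0.
    by rewrite -oppr0; apply: cvgN; exact: cvg_harm.
have E : (fun k' => I (fun x => DA (harm k') x * dB j x)) =
    (fun k' => I (fun x => dA j x * DB (- harm k') x)).
  by apply/funext => k'; exact: key.
move: lim1; rewrite E => lim1.
exact: (cvg_unique _ lim1 lim2).
Qed.

End null_lagrangian.

(** * Interior gradient bound *)
Section gradient_bound.
Context {R : realType}.

(** A one-sided bound suffices because [t] takes both signs. *)
Lemma derive_le_lipschitz (g : R -> R) (d C del : R) : 0 < del ->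
  is_derive (0 : R) 1 g d -> (forall t, `|t| < del -> g t - g 0 <= C * `|t|) -> `|d| <= C.
Proof.
move=> del0 dg gC.
have H (eps : R) : `|eps| = 1 -> eps * d <= C.
  move=> eps1.
  have eps0 : eps != 0 by rewrite -normr_eq0 eps1 oner_eq0.
  have tc : eps * harm k @[k --> \oo] --> 0.
    by rewrite -[X in _ --> X](mulr0 eps); apply: cvgM; [exact: cvg_cst|exact: cvg_harm].
  have tn k : eps * harm k != 0 by rewrite mulf_neq0// gt_eqF// harm_gt0.
  have q := cvg_quotient dg tn tc.
  have {}q : eps * ((g (0 + eps * harm k *: 1) - g 0) / (eps * harm k)) @[k --> \oo] --> eps * d.
    by apply: cvgM => //; exact: cvg_cst.
  apply: (ler_cvg_to q (cvg_cst C)); near=> k.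
  have hk := @harm_gt0 R k.
  have hd : harm k < del.
    near: k; exact: (cvgr_lt _ (@cvg_harm R)).
  rewrite add0r [_ *: 1]mulr1 invfM mulrCA !mulrA -(mulrA _ eps) divff// mulr1.
  have ek : `|eps * harm k| = harm k by rewrite normrM eps1 mul1r gtr0_norm.
  by rewrite ler_pdivrMr//; have := gC (eps * harm k); rewrite ek; apply.
rewrite ler_norml lerNl; apply/andP; split.
  by rewrite -mulN1r; apply: H; rewrite normrN normr1.
by rewrite -[leLHS]mul1r; apply: H; rewrite normr1.
Unshelve. all: by end_near. Qed.

Section enorm.
Context {n : nat}.
Implicit Types (x z : 'rV[R]_n).

Lemma enorm_ge0 x : 0 <= enorm x. Proof. exact: sqrtr_ge0. Qed.

Lemma enorm_sqr x : enorm x ^+ 2 = \sum_i x 0 i ^+ 2.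
Proof. by rewrite sqr_sqrtr// sumr_ge0// => i _; exact: sqr_ge0. Qed.

Lemma coord_le_enorm x i : `|x 0 i| <= enorm x.
Proof.
rewrite -ler_sqr ?nnegrE ?enorm_ge0// enorm_sqr real_normK ?num_real//.
by rewrite (bigD1 i)//= lerDl sumr_ge0// => j _; exact: sqr_ge0.
Qed.

Lemma enorm_eq0 x : enorm x = 0 -> x = 0.
Proof.
move=> x0; apply/rowP => i; rewrite mxE; apply/eqP; rewrite -normr_le0 -x0.
exact: coord_le_enorm.
Qed.

Lemma enormZ (a : R) x : enorm (a *: x) = `|a| * enorm x.
Proof.
apply/eqP; rewrite -(eqrXn2 (n := 2))// ?mulr_ge0 ?enorm_ge0// exprMn !enorm_sqr.
rewrite real_normK ?num_real// mulr_sumr; apply/eqP/eq_bigr => i _.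
by rewrite mxE exprMn.
Qed.

Lemma enorm_sqr_line x i t :
  enorm (x + t *: delta_mx 0 i) ^+ 2 = enorm x ^+ 2 + 2 * t * x 0 i + t ^+ 2.
Proof.
rewrite !enorm_sqr (bigD1 i)//= [in RHS](bigD1 i)//= !mxE !eqxx mulr1.
rewrite (eq_bigr (fun j => x 0 j ^+ 2)) => [|j ji]; first by ring.
by rewrite !mxE eqxx (negbTE ji) mulr0 addr0.
Qed.

Lemma enorm_line_le x i t : enorm (x + t *: delta_mx 0 i) <= enorm x + `|t|.
Proof.
rewrite -ler_sqr ?nnegrE ?addr_ge0 ?enorm_ge0// enorm_sqr_line sqrrD.
rewrite real_normK ?num_real// lerD2r lerD2l -mulrA -[leRHS]mulr_natl ler_pM2l//.
rewrite (le_trans (ler_norm _))// normrM mulrC ler_wpM2r//.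
exact: coord_le_enorm.
Qed.

Lemma enorm_line_lip x i t :
  `|enorm (x + t *: delta_mx 0 i) - enorm x| <= `|t|.
Proof.
rewrite ler_distl; have := enorm_line_le x i t.
have := enorm_line_le (x + t *: delta_mx 0 i) i (- t).
rewrite -addrA -scalerDl subrr scale0r addr0 normrN; lra.
Qed.

End enorm.

Section origin.
Context {n : nat}.
Variables (u : 'rV[R]_n -> R) (du : 'I_n -> 'rV[R]_n -> R)
  (ddu : 'I_n -> 'I_n -> 'rV[R]_n -> R).
Hypotheses (cu : C1 u du) (cdu : forall i, C1 (du i) (ddu i)).
Local Notation e_ i := (delta_mx 0 i : 'rV[R]_n).

Lemma is_derive_along (x v : 'rV[R]_n) (f : 'rV[R]_n -> R) df (t : R) : C1 f df ->
  is_derive t 1 (fun t => f (x + t *: v)) (\sum_j v 0 j * df j (x + t *: v)).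
Proof. by move=> cf; exact: (is_derive_line f x v t _).1 (C1_is_derive cf _ _). Qed.

Lemma is_derive_along_e (x : 'rV[R]_n) (f : 'rV[R]_n -> R) df i (t : R) : C1 f df ->
  is_derive t 1 (fun t => f (x + t *: e_ i)) (df i (x + t *: e_ i)).
Proof. by move=> cf; exact: (is_derive_line f x (e_ i) t _).1 (C1_derive cf _ _). Qed.

Lemma is_derive_quad (a b c t : R) :
  is_derive t 1 (fun t => a + b * t + c * t ^+ 2) (b + 2 * c * t).
Proof.
have did : is_derive t 1 (fun t : R => t) 1 by exact: is_derive_id.
have dc (k : R) : is_derive t 1 (fun _ : R => k) 0 by exact: is_derive_cst.
apply: is_derive_eq (is_deriveD (is_deriveD (dc a) (is_deriveM (dc b) did))
  (is_deriveM (dc c) (is_deriveM did did))) _.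
by rewrite /GRing.scale /=; ring.
Qed.

(** The second order condition at an interior maximum of the doubled function
    [u x - u y - K (r - A r^2) - 3 |x|^2], with [r = |x - y|], in the pair of
    directions [e_i] at [x] and its mirror image at [y]. *)
Lemma doubling_second_order (x y z : 'rV[R]_n) (i : 'I_n) (K A r del : R) :
  let c := z 0 i / r in
  let q := e_ i - (2 * c / r) *: z in
  0 < del ->
  (forall t, `|t| < del ->
    u (x + t *: e_ i) - u (y + t *: q)
      - K * ((r + 2 * t * c) - A * (r + 2 * t * c) ^+ 2)
      - 3 * enorm (x + t *: e_ i) ^+ 2 <=
    u x - u y - K * (r - A * r ^+ 2) - 3 * enorm x ^+ 2) ->
  ddu i i x - \sum_j \sum_k q 0 j * q 0 k * ddu j k y + 8 * A * K * c ^+ 2 - 6 <= 0.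
Proof.
move=> c q del0 gmax.
pose a0 := - K * (r - A * r ^+ 2) - 3 * enorm x ^+ 2.
pose a1 := - K * (2 * c - 4 * A * r * c) - 6 * x 0 i.
pose a2 := 4 * K * A * c ^+ 2 - 3.
pose g (t : R) := u (x + t *: e_ i) - u (y + t *: q) + (a0 + a1 * t + a2 * t ^+ 2).
pose dg (t : R) := du i (x + t *: e_ i) - (\sum_j q 0 j * du j (y + t *: q))
   + (a1 + (2 * a2) * t + 0 * t ^+ 2).
have gE t : g t = u (x + t *: e_ i) - u (y + t *: q)
      - K * ((r + 2 * t * c) - A * (r + 2 * t * c) ^+ 2)
      - 3 * enorm (x + t *: e_ i) ^+ 2.
  by rewrite enorm_sqr_line /g /a0 /a1 /a2; ring.
apply: (@second_derivative_test R g dg _ del) => //.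
- move=> t; apply: is_derive_eq
    (is_deriveD (is_deriveB (is_derive_along_e x i t cu) (is_derive_along y q t cu))
      (is_derive_quad a0 a1 a2 t)) _.
  by rewrite /dg mul0r addr0.
- have dsum : is_derive (0 : R) 1 (\sum_(j < n) (fun t => q 0 j * du j (y + t *: q)))
      (\sum_j (q 0 j * \sum_k q 0 k * ddu j k (y + 0 *: q))).
    apply: is_derive_sum => j.
    have dc (k : R) : is_derive (0 : R) 1 (fun _ : R => k) 0 by exact: is_derive_cst.
    apply: is_derive_eq (is_deriveM (dc (q 0 j)) (is_derive_along y q 0 (cdu j))) _.
    by rewrite /GRing.scale /=; ring.
  have := is_deriveD (is_deriveB (is_derive_along_e x i 0 (cdu i)) dsum)
      (is_derive_quad a1 (2 * a2) 0 0).
  rewrite (_ : (_ + _)%R = dg); last first.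
    by apply/funext => t; rewrite /dg /= fct_sumE.
  move=> H; apply: is_derive_eq H _; rewrite !scale0r !addr0 /a2.
  rewrite (eq_bigr (fun j => \sum_k q 0 j * q 0 k * ddu j k y)) => [|j _]; first by ring.
  by rewrite mulr_sumr; apply: eq_bigr => k _; rewrite mulrA.
- move=> t td; rewrite !gE (le_trans (gmax t td))//.
  by rewrite !scale0r !addr0 mulr0 mul0r addr0.
Qed.

(** The vectors [q i] are the images of the basis by the reflection across the
    hyperplane orthogonal to [z], hence an orthonormal basis, and the trace of
    [H] does not depend on the orthonormal basis. *)
Lemma reflection_trace (z : 'rV[R]_n) (r : R) (H : 'I_n -> 'I_n -> R) :
  0 < r -> \sum_i z 0 i ^+ 2 = r ^+ 2 ->
  let q i := e_ i - (2 * (z 0 i / r) / r) *: z in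
  \sum_i \sum_j \sum_k q i 0 j * q i 0 k * H j k = \sum_j H j j.
Proof.
move=> r0 zr q; have rn0 : r != 0 by rewrite gt_eqF.
have qE i j : q i 0 j = (i == j)%:R - 2 / r ^+ 2 * z 0 j * z 0 i.
  by rewrite !mxE eqxx /= eq_sym; field.
rewrite exchange_big /=; apply: eq_bigr => j _.
rewrite exchange_big /= (bigD1 j)//= [X in _ + X]big1 ?addr0 => [|k kj].
  rewrite -mulr_suml -[RHS]mul1r; congr (_ * _).
  rewrite (eq_bigr (fun i => (i == j)%:R * (1 - 4 / r ^+ 2 * z 0 j ^+ 2)
     + 4 / r ^+ 4 * z 0 j ^+ 2 * z 0 i ^+ 2)) => [|i _]; last first.
    by rewrite !qE; case: eqVneq => [->|_] /=; field.
  rewrite big_split /= -mulr_suml -mulr_sumr zr (bigD1 j)//= eqxx /= big1 => [|i ij].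
    by field.
  by rewrite (negbTE ij).
rewrite -mulr_suml (_ : \sum_i _ = 0) ?mul0r//.
rewrite (eq_bigr (fun i => - (2 / r ^+ 2 * z 0 j * z 0 k) * ((i == j)%:R + (i == k)%:R)
     + 4 / r ^+ 4 * z 0 j * z 0 k * z 0 i ^+ 2)) => [|i _]; last first.
  rewrite !qE; case: eqVneq => [->|_] /=.
    by rewrite eq_sym (negbTE kj) /=; field.
  by case: eqVneq => [->|_] /=; field.
rewrite big_split /= -!mulr_sumr zr big_split /=.
rewrite (bigD1 j)//= eqxx /= big1 => [|i ij]; last by rewrite (negbTE ij).
rewrite (bigD1 k)//= eqxx /= big1 => [|i ij]; last by rewrite (negbTE ij).
by field.
Qed.

Variables (b : 'I_n -> 'rV[R]_n -> R) (h : 'rV[R]_n -> R) (B H : R).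
Hypotheses (u1 : forall x, `|u x| <= 1)
  (equ : forall x, \sum_i ddu i i x + \sum_i b i x * du i x = h x)
  (bB : forall i x, `|b i x| <= B) (hH : forall x, `|h x| <= H)
  (B0 : 0 <= B) (H0 : 0 <= H).

(** [A] makes the concavity of [psi] beat the first order terms of the equation;
    [rho] is so small that [psi r] stays between [r / 2] and [r] for [r] in the
    range at hand; [K rho >= 4] prevents a positive maximum with [z] on the
    boundary of its cube, and the other terms of [K] make the second order
    condition at an interior maximum contradict the equation. *)
Let A : R := n%:R * B + 1.
Let rho : R := (4 * A * (n%:R + 1))^-1.
Let K : R := 4 / rho + n%:R + H + 2 * (n%:R * B) + 1.

Let A1 : 1 <= A. Proof. by rewrite lerDr mulr_ge0. Qed.
Let rho0 : 0 < rho.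
Proof. by rewrite invr_gt0 mulr_gt0 ?ltr_pwDr// mulr_gt0//; have := A1; lra. Qed.
Let nrho : n%:R * rho <= (4 * A)^-1.
Proof.
have a0 : 0 < 4 * A by have := A1; lra.
have n1 : 0 < n%:R + 1 :> R by rewrite ltr_pwDr.
have -> : n%:R * rho = (n%:R / (n%:R + 1)) * (4 * A)^-1.
  by rewrite /rho; field; rewrite !gt_eqF//; lra.
rewrite -[leRHS]mul1r ler_pM2r ?invr_gt0// ler_pdivrMr// mul1r; lra.
Qed.
Let K0 : 0 < K.
Proof.
have := divr_gt0 (ltr0n R 4) rho0; rewrite /K.
by have := mulr_ge0 (ler0n R n) B0; have := ler0n R n; have := H0; lra.
Qed.
Let K4 : 4 <= K * rho.
Proof.
rewrite -ler_pdivrMr// /K.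
by have := mulr_ge0 (ler0n R n) B0; have := ler0n R n; have := H0; lra.
Qed.

Let psi (r : R) := r - A * r ^+ 2.

Let psi_ge r : 0 <= r <= (4 * A)^-1 -> r / 2 <= psi r.
Proof.
move=> /andP[r0 r1]; have a0 : 0 < A by have := A1; lra.
have : A * r <= 1 / 4.
  have -> : 1 / 4 = A * (4 * A)^-1 by field; rewrite gt_eqF.
  by rewrite ler_pM2l.
rewrite /psi; nra.
Qed.

Let psi_lip r r' : 0 <= r <= (4 * A)^-1 -> 0 <= r' <= (4 * A)^-1 ->
  `|psi r - psi r'| <= `|r - r'|.
Proof.
move=> /andP[r0 r1] /andP[r'0 r'1]; have a0 : 0 < A by have := A1; lra.
have Ar s : s <= (4 * A)^-1 -> A * s <= 1 / 4.
  have -> : 1 / 4 = A * (4 * A)^-1 by field; rewrite gt_eqF.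
  by rewrite ler_pM2l.
have -> : psi r - psi r' = (r - r') * (1 - (A * r + A * r')) by rewrite /psi; ring.
rewrite normrM -[leRHS]mulr1 ler_wpM2l//.
have := Ar _ r1; have := Ar _ r'1.
have := mulr_ge0 (ltW a0) r0; have := mulr_ge0 (ltW a0) r'0.
rewrite ler_norml; lra.
Qed.

Let Phi (x z : 'rV[R]_n) := u x - u (x - z) - K * psi (enorm z) - 3 * enorm x ^+ 2.

Let Dx := [set x : 'rV[R]_n | forall i, `|x 0 i| <= 1].
Let Dz := [set z : 'rV[R]_n | forall i, `|z 0 i| <= rho].

Let Dz_enorm z : Dz z -> 0 <= enorm z <= (4 * A)^-1.
Proof.
move=> zr; rewrite enorm_ge0 /=; apply: le_trans nrho.
by apply: enorm_le_box => //; exact: ltW.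
Qed.

Let Phi_max : exists x z, [/\ Dx x, Dz z & forall x' z', Dx x' -> Dz z' -> Phi x' z' <= Phi x z].
Proof.
have cD : compact (Dx `*` Dz) by apply: compact_setX; exact: box_compact.
have cPhi : continuous (fun p : 'rV[R]_n * 'rV[R]_n => Phi p.1 p.2).
  have cf : continuous (fun p : 'rV[R]_n * 'rV[R]_n => p.1) by move=> p; exact: cvg_fst.
  have cs : continuous (fun p : 'rV[R]_n * 'rV[R]_n => p.2) by move=> p; exact: cvg_snd.
  have ce (g : 'rV[R]_n * 'rV[R]_n -> 'rV[R]_n) : continuous g ->
      continuous (fun p => enorm (g p)).
    by move=> cg p; apply: (continuous_comp (cg p)); exact: enorm_continuous.
  have cu' := C1_continuous cu.
  move=> p; apply: cvgB; last first.
    apply: cvgM; first exact: cvg_cst.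
    apply: (@continuous_comp _ _ _ (fun p => enorm p.1) (fun t : R => t ^+ 2)).
      exact: ce.
    exact: exprn_continuous.
  apply: cvgB; last first.
    apply: cvgM; first exact: cvg_cst.
    apply: cvgB; first exact: (ce _ cs).
    apply: cvgM; first exact: cvg_cst.
    apply: (@continuous_comp _ _ _ (fun p => enorm p.2) (fun t : R => t ^+ 2)).
      exact: ce.
    exact: exprn_continuous.
  apply: cvgB; first by apply: (continuous_comp (cf p)); exact: cu'.
  apply: (@continuous_comp _ _ _ (fun p : 'rV[R]_n * 'rV[R]_n => p.1 - p.2) u).
    by apply: cvgB; [exact: cf|exact: cs].
  exact: cu'.
have ne : (Dx `*` Dz) !=set0.
  by exists (0, 0); split => i /=; rewrite mxE normr0 ?ler01// ltW.
have [[x z] /set_mem[/= Dxx Dzz] mx] := compact_EVT_max ne cD (continuous_subspaceT cPhi).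
by exists x, z; split => // x' z' dx dz; apply: (mx (x', z')); rewrite inE.
Qed.

Let room (a : 'I_n -> R) (M : R) : (forall i, a i < M) ->
  exists2 del, 0 < del & forall i, a i + del <= M.
Proof.
move=> aM; pose m := \big[Order.max/M - 1]_i a i.
have mM : m < M by apply: bigmax_lt => [|i _]; [lra|exact: aM].
exists (M - m) => [|i]; first by rewrite subr_gt0.
by have : a i <= m by [exact: le_bigmax]; lra.
Qed.

Let box_line (x : 'rV[R]_n) i t k : (forall j, `|x 0 j| + `|t| <= k) ->
  forall j, `|(x + t *: e_ i) 0 j| <= k.
Proof.
move=> xk j; apply: le_trans (xk j); rewrite !mxE (le_trans (ler_normD _ _))// lerD2l.
by rewrite normrM; case: (j == i); rewrite /= ?normr1 ?normr0 ?mulr1 ?mulr0.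
Qed.

(** Suppose that the maximum is positive.  Then it is interior, and [z <> 0].
    The first order conditions bound the gradients of [u] at [x] and at
    [x - z] by [K + 9] and [K].  The second order conditions in the directions
    [e_i] at [x] and their reflections at [x - z] add up, by
    [reflection_trace], to an upper bound for the difference of the two
    Laplacians, which the equation contradicts because of the concavity term
    [8 A K]. *)
Lemma doubling_le0 x z : Dx x -> Dz z -> Phi x z <= 0.
Proof.
suff [x0 [z0 [dx dz mx le0]]] : exists x z, [/\ Dx x, Dz z,
    (forall x' z', Dx x' -> Dz z' -> Phi x' z' <= Phi x z) & Phi x z <= 0].
  by move=> dx' dz'; exact: le_trans (mx _ _ dx' dz') le0.
have [{}x [{}z [dx dz mx]]] := Phi_max.
exists x, z; split => //; rewrite leNgt; apply/negP => P0.
have hz := Dz_enorm dz; have pz := psi_ge hz.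
set r := enorm z in hz pz.
have r0 : 0 <= r by case/andP: hz.
have u2 : u x - u (x - z) <= 2.
  have := u1 x; have := u1 (x - z); rewrite !ler_norml; lra.
have K0' := K0; have Kp : 0 <= K * psi r by apply: (mulr_ge0 (ltW K0')); lra.
have PE : Phi x z = u x - u (x - z) - K * psi r - 3 * enorm x ^+ 2 by [].
have xint i : `|x 0 i| < 1.
  rewrite ltNge; apply/negP => xi; have e1 := le_trans xi (coord_le_enorm x i).
  have : 1 <= enorm x ^+ 2 by rewrite -(expr1n _ 2) lerXn2r ?nnegrE ?enorm_ge0.
  by move: P0; rewrite PE; lra.
have zint i : `|z 0 i| < rho.
  rewrite ltNge; apply/negP => zi; have e1 := le_trans zi (coord_le_enorm z i).
  have : K * (rho / 2) <= K * psi r.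
    by rewrite ler_pM2l//; apply: le_trans pz; rewrite ler_pM2r// invr_gt0.
  have := sqr_ge0 (enorm x); have := K4; rewrite mulrA.
  by move: P0; rewrite PE; lra.
have rp : 0 < r.
  rewrite lt_neqAle r0 andbT; apply/eqP => r00.
  have z0 : z = 0 by apply: enorm_eq0; rewrite -/r -r00.
  move: P0; rewrite PE z0 subr0 subrr.
  by have := sqr_ge0 (enorm x); lra.
have [d1 d10 xd1] := room xint; have [d2 d20 zd2] := room zint.
pose del := Num.min d1 (Num.min (d2 / 2) (Num.min (r / 2) 1)).
have del0 : 0 < del by rewrite !lt_min d10 /=; apply/and3P; split; lra.
have [dd1 [dd2 [ddr dd3]]] : del <= d1 /\ del <= d2 / 2 /\ del <= r / 2 /\ del <= 1.
  have : del <= del by []; rewrite {2}/del !le_min => /and4P[*].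
  by [].
have Dx_line i t : `|t| < del -> Dx (x + t *: e_ i).
  by move=> td; apply: box_line => j; have := xd1 j; lra.
have Dz_line i t : `|t| < del -> Dz (z + t *: e_ i).
  by move=> td; apply: box_line => j; have := zd2 j; lra.
have psi_line i t : `|t| < del -> K * psi (enorm (z + t *: e_ i)) - K * psi r <= K * `|t| /\
   K * psi r - K * psi (enorm (z + t *: e_ i)) <= K * `|t|.
  move=> td; rewrite -!mulrBr !ler_pM2l//.
  have := le_trans (psi_lip (Dz_enorm (Dz_line i t td)) hz) (enorm_line_lip z i t).
  by rewrite ler_norml => hh; split; lra.
have dux i : `|du i x| <= K + 9.
  apply: (derive_le_lipschitz (g := fun t => u (x + t *: e_ i)) del0).
    by have := is_derive_along_e x i 0 cu; rewrite scale0r addr0.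
  move=> t td; have := mx _ _ (Dx_line i t td) (Dz_line i t td).
  have -> : Phi (x + t *: e_ i) (z + t *: e_ i) = u (x + t *: e_ i) - u (x - z)
      - K * psi (enorm (z + t *: e_ i)) - 3 * enorm (x + t *: e_ i) ^+ 2.
    by rewrite /Phi opprD addrACA subrr addr0.
  rewrite PE enorm_sqr_line scale0r addr0.
  have [p1 p2] := psi_line i t td.
  have tx : t * x 0 i <= `|t|.
    rewrite (le_trans (ler_norm _))// normrM -[leRHS]mulr1 ler_wpM2l//; exact: ltW.
  have tt : t ^+ 2 <= `|t|.
    by rewrite -real_normK ?num_real// expr2 -[leRHS]mulr1 ler_wpM2l//; lra.
  lra.
have duy i : `|du i (x - z)| <= K.
  rewrite -normrN.
  apply: (derive_le_lipschitz (g := fun t => - u (x - z + t *: e_ i)) del0).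
    by have := is_deriveN (is_derive_along_e (x - z) i 0 cu); rewrite scale0r addr0.
  move=> t td; have td' : `|- t| < del by rewrite normrN.
  have := mx _ _ dx (Dz_line i _ td').
  rewrite PE /Phi scaleNr opprB addrA scale0r addr0 [x + _ - z]addrAC.
  have [p1 p2] := psi_line i _ td'.
  by rewrite scaleNr normrN in p1 p2; lra.
have c1 i : `|z 0 i / r| <= 1.
  by rewrite normrM normfV (gtr0_norm rp) ler_pdivrMr// mul1r coord_le_enorm.
pose q i := e_ i - (2 * (z 0 i / r) / r) *: z.
have second i : ddu i i x - \sum_j \sum_k q i 0 j * q i 0 k * ddu j k (x - z)
    + 8 * A * K * (z 0 i / r) ^+ 2 - 6 <= 0.
  apply: (doubling_second_order del0) => t td.
  set c := z 0 i / r.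
  have tc : `|2 * t * c| <= 2 * `|t|.
    rewrite normrM (normrM 2 t) (@normr_nat R) -[leRHS]mulr1.
    by apply: ler_wpM2l; [rewrite mulr_ge0|exact: c1].
  have rtc : 0 <= r + 2 * t * c by move: tc; rewrite ler_norml; lra.
  pose z' := (1 + 2 * t * c / r) *: z.
  have z'E : enorm z' = r + 2 * t * c.
    rewrite enormZ -/r -[X in _ * X](gtr0_norm rp) -normrM mulrDl mul1r divfK ?gt_eqF//.
    by rewrite ger0_norm.
  have dz' : Dz z'.
    move=> j; rewrite mxE mulrDl mul1r (le_trans (ler_normD _ _))//.
    have : `|2 * t * c / r * z 0 j| <= 2 * `|t|.
      rewrite -mulrA normrM -[leRHS]mulr1 ler_pM// mulrC normrM normfV (gtr0_norm rp).
      by rewrite ler_pdivrMr// mul1r coord_le_enorm.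
    have := zd2 j; lra.
  have := mx _ _ (Dx_line i t td) dz'.
  rewrite PE /Phi z'E.
  suff -> : x + t *: e_ i - z' = x - z + t *: (e_ i - (2 * c / r) *: z) by [].
  by apply/rowP => j; rewrite !mxE; ring.
have zr : \sum_i z 0 i ^+ 2 = r ^+ 2 by rewrite -enorm_sqr.
have rn0 : r != 0 by rewrite gt_eqF.
have : \sum_i (ddu i i x - \sum_j \sum_k q i 0 j * q i 0 k * ddu j k (x - z)
    + 8 * A * K * (z 0 i / r) ^+ 2 - 6) <= 0.
  by apply: sumr_le0 => i _; exact: second.
rewrite !big_split /= sumrN reflection_trace// sumr_const card_ord -mulr_sumr.
have -> : \sum_i (z 0 i / r) ^+ 2 = 1.
  rewrite (eq_bigr (fun i => z 0 i ^+ 2 / r ^+ 2)) => [|i _]; last by rewrite expr_div_n.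
  by rewrite -mulr_suml zr divff// expf_neq0.
have sumb (y : 'rV[R]_n) (C : R) : 0 <= C -> (forall i, `|du i y| <= C) ->
    `|\sum_i b i y * du i y| <= n%:R * (B * C).
  move=> C0 duC; rewrite (le_trans (ler_norm_sum _ _ _))//.
  rewrite (le_trans (ler_sum _ (G := fun=> B * C) _)) => [//|i _|].
    by rewrite normrM ler_pM.
  by rewrite sumr_const card_ord mulr_natl.
have := sumb x (K + 9) _ dux; have := sumb (x - z) K (ltW K0) duy.
have := equ x; have := equ (x - z); have := hH x; have := hH (x - z).
move=> h1 h2 e1 e2 s1 /(_ _) s2.
have {}s2 : `|\sum_i b i x * du i x| <= n%:R * (B * (K + 9)) by apply: s2; lra.
rewrite mulNrn -[6 *+ n]mulr_natr; move: h1 h2 s1 s2; rewrite !ler_norml.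
have KE : 8 * A * K = 8 * (n%:R * B * K) + 8 * K by rewrite /A; ring.
have nB : 0 <= n%:R * B by rewrite mulr_ge0.
have -> : n%:R * (B * (K + 9)) = n%:R * B * K + 9 * (n%:R * B) by ring.
have -> : n%:R * (B * K) = n%:R * B * K by ring.
rewrite KE mulr1.
have nBK : 0 <= n%:R * B * K by rewrite mulr_ge0// ltW.
have rr : 0 < 4 / rho by rewrite divr_gt0.
have KK : K = 4 / rho + n%:R + H + 2 * (n%:R * B) + 1 by [].
have nn : 0 <= n%:R :> R by [].
have := H0.
move: (n%:R * B) (n%:R * B * K) (4 / rho) KK nB nBK rr => nb nbk rh KK nB nBK rr.
lra.
Qed.

(** At [x = 0] the inequality of [doubling_le0] is a Lipschitz estimate. *)
Lemma gradient_bound_origin i : `|du i 0| <= K.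
Proof.
rewrite -normrN.
apply: (derive_le_lipschitz (g := fun t => - u (0 + t *: e_ i)) rho0).
  by have := is_deriveN (is_derive_along_e 0 i 0 cu); rewrite scale0r addr0.
move=> t td.
have Dx0 : Dx 0 by move=> j; rewrite mxE normr0.
have Dzt : Dz (0 + (- t) *: e_ i).
  by apply: box_line => j; rewrite mxE normr0 add0r normrN ltW.
have := doubling_le0 Dx0 Dzt.
have e0 : enorm (0 : 'rV[R]_n) = 0.
  by rewrite /enorm big1 ?sqrtr0// => j _; rewrite mxE expr0n.
have et : enorm ((- t) *: e_ i) <= `|t|.
  by have := enorm_line_le 0 i (- t); rewrite add0r e0 add0r normrN.
have pt : psi (enorm ((- t) *: e_ i)) <= `|t|.
  apply: le_trans et; rewrite /psi gerBl mulr_ge0 ?sqr_ge0//.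
  by have := A1; lra.
rewrite /Phi e0 !add0r scale0r scaleNr opprK -scaleNr expr0n mulr0 subr0 => H1.
have : K * psi (enorm (- t *: e_ i)) <= K * `|t| by rewrite ler_pM2l.
lra.
Qed.

End origin.

(** The hypotheses are invariant under translation with the same constants, so
    the bound at the origin is a bound everywhere. *)
Lemma gradient_bound n (u : 'rV[R]_n -> R) du ddu (b : 'I_n -> 'rV[R]_n -> R)
    (h : 'rV[R]_n -> R) (B H : R) :
  C1 u du -> (forall i, C1 (du i) (ddu i)) -> (forall x, `|u x| <= 1) ->
  (forall x, \sum_i ddu i i x + \sum_i b i x * du i x = h x) ->
  (forall i x, `|b i x| <= B) -> (forall x, `|h x| <= H) -> 0 <= B -> 0 <= H ->
  exists2 M, 0 < M & forall i x, `|du i x| <= M.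
Proof.
move=> cu cdu u1 equ bB hH B0 H0.
have [M HM] : exists M, forall i x, `|du i x| <= M.
  eexists => i x; rewrite -[x in du i x]add0r.
  exact: (gradient_bound_origin (C1_translate x cu) (fun j => C1_translate x (cdu j))
    (b := fun j y => b j (y + x)) (h := fun y => h (y + x)) (fun y => u1 _)
    (fun y => equ _) (fun j y => bB j _) (fun y => hH _) B0 H0 i).
exists (`|M| + 1) => [|i x]; first by rewrite ltr_pwDr.
rewrite (le_trans (HM i x))// (le_trans (ler_norm M))//; lra.
Qed.

End gradient_bound.

(** * Energy growth *)
Section trapezoid.
Context {R : realType}.
Implicit Types (r t : R).

(** A trapezoid, equal to 1 on [-r, r] and to 0 off [-2r, 2r].  It replaces
    [chi] in the last variable because its primitive is explicit and bounded by
    [3 r]. *)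
Definition trap r t : R :=
  (Num.max 0 (t + 2 * r) - Num.max 0 (t + r) - Num.max 0 (t - r) + Num.max 0 (t - 2 * r)) / r.

Definition trap_primitive r t : R :=
  (pos_sq (t + 2 * r) - pos_sq (t + r) - pos_sq (t - r) + pos_sq (t - 2 * r)) / (2 * r).

Lemma is_derive_pos_sq_shift a t : is_derive t 1 (fun t => pos_sq (t + a)) (2 * Num.max 0 (t + a)).
Proof.
have H := is_derive_pos_sq (t + a).
exact: (@is_derive_translate R R pos_sq t a 1 _ H).
Qed.

Lemma is_derive_trap r t : 0 < r -> is_derive t 1 (trap_primitive r) (trap r t).
Proof.
move=> r0; have H a := is_derive_pos_sq_shift a t.
have dc : is_derive t 1 (fun _ : R => (2 * r)^-1) 0 by exact: is_derive_cst.
apply: is_derive_eq (is_deriveM (is_deriveD (is_deriveB (is_deriveB (H (2 * r)) (H r))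
  (H (- r))) (H (- (2 * r)))) dc) _.
by rewrite /GRing.scale /= /trap; field; rewrite gt_eqF.
Qed.

Lemma continuous_trap r : continuous (trap r).
Proof.
have H a : continuous (fun t : R => Num.max 0 (t + a)).
  move=> t; apply: (@continuous_comp R R R (fun t => t + a) (fun t => Num.max 0 t)).
    by apply: cvgD; [exact: cvg_id|exact: cvg_cst].
  exact: continuous_max0.
move=> t; apply: cvgM; last exact: cvg_cst.
apply: cvgD; last exact: H.
by apply: cvgB; last exact: H; apply: cvgB; exact: H.
Qed.

(** The pieces between the breakpoints; the last one covers both the descending
    part and the zero part beyond it. *)
Lemma trap_pieces r t : 0 < r ->
  [\/ [/\ t <= - (2 * r), trap r t = 0 & trap_primitive r t = 0],
      [/\ - (2 * r) <= t <= - r, trap r t = (t + 2 * r) / r &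
          trap_primitive r t = (t + 2 * r) ^+ 2 / (2 * r)],
      [/\ - r <= t <= r, trap r t = 1 & trap_primitive r t = t + 3 / 2 * r] |
      [/\ r <= t, trap r t = Num.max 0 (2 * r - t) / r &
          trap_primitive r t = 3 * r - Num.max 0 (2 * r - t) ^+ 2 / (2 * r)]].
Proof.
move=> r0; rewrite /trap /trap_primitive /pos_sq.
have rn0 : r != 0 by rewrite gt_eqF.
have [[h1 ->]|[h1 ->]] := max0P (t + 2 * r).
  have [[h2 ->]|[h2 ->]] := max0P (t + r); last by exfalso; lra.
  have [[h3 ->]|[h3 ->]] := max0P (t - r); last by exfalso; lra.
  have [[h4 ->]|[h4 ->]] := max0P (t - 2 * r); last by exfalso; lra.
  by apply: Or41; split; [lra|field|field].
have [[h2 ->]|[h2 ->]] := max0P (t + r).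
  have [[h3 ->]|[h3 ->]] := max0P (t - r); last by exfalso; lra.
  have [[h4 ->]|[h4 ->]] := max0P (t - 2 * r); last by exfalso; lra.
  by apply: Or42; split; [apply/andP; split; lra|field|field].
have [[h3 ->]|[h3 ->]] := max0P (t - r).
  have [[h4 ->]|[h4 ->]] := max0P (t - 2 * r); last by exfalso; lra.
  by apply: Or43; split; [apply/andP; split; lra|field|field].
apply: Or44; have [[h4 ->]|[h4 ->]] := max0P (t - 2 * r).
  have -> : Num.max 0 (2 * r - t) = 2 * r - t by apply/max_idPr; lra.
  by split; [lra|field|field].
have -> : Num.max 0 (2 * r - t) = 0 by apply/max_idPl; lra.
by split; [lra|field|field].
Qed.

Lemma trap_bounds r t : 0 < r -> 0 <= trap r t <= 1.
Proof.
move=> r0; have [[h -> _]|[/andP[h h'] -> _]|[_ -> _]|[h -> _]] := trap_pieces t r0.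
- by rewrite lexx ler01.
- by rewrite divr_ge0 ?ler_pdivrMr//; lra.
- by rewrite ler01 lexx.
- have [[h1 ->]|[h1 ->]] := max0P (2 * r - t).
    by rewrite mul0r lexx ler01.
  by rewrite divr_ge0 ?ler_pdivrMr//; lra.
Qed.

Lemma trap_eq1 r t : 0 < r -> `|t| <= r -> trap r t = 1.
Proof.
move=> r0; rewrite ler_norml => /andP[t1 t2].
have rn0 : r != 0 by rewrite gt_eqF.
have [[h -> _]|[/andP[h h'] -> _]|[_ -> _]|[h -> _]] := trap_pieces t r0 => //.
- by exfalso; lra.
- have -> : t = - r by lra.
  by field.
- have -> : t = r by lra.
  by rewrite (_ : 2 * r - r = r); [rewrite (max_idPr (ltW r0)) divff|ring].
Qed.

Lemma trap_eq0 r t : 0 < r -> 2 * r <= `|t| -> trap r t = 0.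
Proof.
move=> r0 tr; have tt : 2 * r <= t \/ t <= - (2 * r).
  by move: tr; rewrite ler_normr => /orP[|]; [left|right; lra].
have [[h -> _]|[/andP[h h'] -> _]|[/andP[h h'] -> _]|[h -> _]] := trap_pieces t r0 => //.
- have -> : t = - (2 * r) by case: tt => ?; lra.
  by rewrite addNr mul0r.
- by exfalso; case: tt => ?; lra.
- by rewrite (max_idPl _) ?mul0r//; case: tt => ?; lra.
Qed.

Lemma trap_primitive_bounds r t : 0 < r -> 0 <= trap_primitive r t <= 3 * r.
Proof.
move=> r0; have r2 : 0 < 2 * r by lra.
have [[h _ ->]|[/andP[h h'] _ ->]|[/andP[h h'] _ ->]|[h _ ->]] := trap_pieces t r0.
- by apply/andP; split; lra.
- by rewrite divr_ge0 ?sqr_ge0 ?ler_pdivrMr ?ltW//; nra.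
- by apply/andP; split; lra.
- have [[h1 ->]|[h1 ->]] := max0P (2 * r - t).
    by rewrite expr0n mul0r subr0; apply/andP; split; lra.
  rewrite gerBl divr_ge0 ?sqr_ge0 ?(ltW r2)// andbT subr_ge0 ler_pdivrMr//; nra.
Qed.

Lemma trap_primitive_left r t : 0 < r -> t <= - (2 * r) -> trap_primitive r t = 0.
Proof.
move=> r0 tr.
have [[h _ ->]|[/andP[h h'] _ ->]|[/andP[h h'] _ ->]|[h _ ->]] := trap_pieces t r0 => //.
- have -> : t = - (2 * r) by lra.
  by rewrite addNr expr0n mul0r.
- by exfalso; lra.
- by exfalso; lra.
Qed.

Lemma trap_primitive_right r t : 0 < r -> 2 * r <= t -> trap_primitive r t = 3 * r.
Proof.
move=> r0 tr.
have [[h _ ->]|[/andP[h h'] _ ->]|[/andP[h h'] _ ->]|[h _ ->]] := trap_pieces t r0 => //; try lra.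
by rewrite (max_idPl _) ?expr0n ?mul0r ?subr0//; lra.
Qed.

End trapezoid.

Lemma C1_sum {R : realType} {n : nat} (J : Type) (s : seq J)
    (f : J -> 'rV[R]_n -> R) (df : J -> 'I_n -> 'rV[R]_n -> R) :
  (forall j, C1 (f j) (df j)) ->
  C1 (fun x => \sum_(j <- s) f j x) (fun i x => \sum_(j <- s) df j i x).
Proof.
move=> cf; elim: s => [|j s IH].
  have := @C1_cst R n 0; congr C1; first by apply/funext => x; rewrite big_nil.
  by apply/funext => i; apply/funext => x; rewrite big_nil.
have := C1D (cf j) IH; congr C1; first by apply/funext => x; rewrite big_cons.
by apply/funext => i; apply/funext => x; rewrite big_cons.
Qed.

Lemma C1N {R : realType} {n : nat} (f : 'rV[R]_n -> R) df : C1 f df ->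
  C1 (fun x => - f x) (fun i x => - df i x).
Proof.
move=> /(C1Z (-1)); congr C1; first by apply/funext => x; rewrite mulN1r.
by apply/funext => i; apply/funext => x; rewrite mulN1r.
Qed.

Section energy.
Context {R : realType} {n : nat}.
Local Notation e_ i := (delta_mx 0 i : 'rV[R]_n).
Local Notation leb := (@lebesgue_measure R).
Variables (il : 'I_n) (G L u fu Fu : 'rV[R]_n -> R) (dG dL du : 'I_n -> 'rV[R]_n -> R)
  (ddu : 'I_n -> 'I_n -> 'rV[R]_n -> R) (c eps M Mf CF : R).
Hypotheses (cG : C1 G dG) (cL : C1 L dL) (cu : C1 u du) (cdu : forall i, C1 (du i) (ddu i))
  (cFu : C1 Fu (fun i x => fu x * du i x)) (cfu : continuous fu)
  (sym : forall i j x, ddu i j x = ddu j i x)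
  (G0 : forall x, 0 < G x) (L0 : forall x, 0 <= L x) (un0 : forall x, 0 < du il x)
  (dGn : forall x, dG il x = 0) (dLn : forall x, dL il x = 0)
  (u1 : forall x, `|u x| <= 1)
  (equ : forall x, \sum_i (dG i x * du i x + G x * ddu i i x) = - (L x * fu x))
  (M0 : 0 < M) (duM : forall i x, `|du i x| <= M)
  (Mf0 : 0 <= Mf) (fuM : forall x, `|fu x| <= Mf)
  (Fuc : forall x, Fu x <= c)
  (FuC : forall x, c - Fu x <= CF * (1 - eps * u x))
  (eps1 : eps = 1 \/ eps = -1)
  (ucvg : forall x, u (x + (eps * k%:R) *: e_ il) @[k --> \oo] --> eps).

Definition grad_sq x : R := \sum_j du j x ^+ 2.
Definition energy x : R := 2^-1 * (G x * grad_sq x) + L x * (c - Fu x).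

Let cC (A : 'rV[R]_n -> R) dA : C1 A dA -> continuous A := fun H => C1_continuous H.

Let cdui i : continuous (du i). Proof. exact: cC (cdu i). Qed.

Lemma grad_sq_ge0 x : 0 <= grad_sq x.
Proof. by apply: sumr_ge0 => j _; exact: sqr_ge0. Qed.

Lemma energy_ge x : 2^-1 * (G x * grad_sq x) <= energy x.
Proof. by rewrite /energy lerDl mulr_ge0// subr_ge0. Qed.

Lemma energy_ge0 x : 0 <= energy x.
Proof.
apply: le_trans (energy_ge x); rewrite mulr_ge0 ?invr_ge0// mulr_ge0 ?grad_sq_ge0//.
exact: ltW.
Qed.

Lemma C1_grad_sq : C1 grad_sq (fun i x => \sum_j 2 * (du j x * ddu j i x)).
Proof.
have H j : C1 (fun x => du j x ^+ 2) (fun i x => 2 * (du j x * ddu j i x)).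
  have := C1M (cdu j) (cdu j); congr C1.
  by apply/funext => i; apply/funext => x; ring.
exact: C1_sum.
Qed.

(** The energy density does not depend explicitly on the last variable: its
    derivative in that direction is a divergence. *)
Definition energy_flux j x : R := G x * (du il x * du j x).

Lemma C1_energy_flux j : C1 (energy_flux j) (fun i x =>
  G x * (du il x * ddu j i x + ddu il i x * du j x) + dG i x * (du il x * du j x)).
Proof. exact: C1M cG (C1M (cdu il) (cdu j)). Qed.

Lemma C1_energy : exists2 de, C1 energy de & forall x, de il x =
  \sum_j (G x * (du il x * ddu j j x + ddu il j x * du j x) + dG j x * (du il x * du j x)).
Proof.
eexists; first exact: (C1D (C1Z 2^-1 (C1M cG C1_grad_sq)) (C1M cL (C1D (C1_cst c) (C1N cFu)))).
move=> x; rewrite /= dGn dLn !mul0r !addr0 add0r.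
have -> : 2^-1 * (G x * (\sum_j 2 * (du j x * ddu j il x))) = \sum_j G x * (ddu il j x * du j x).
  rewrite mulr_sumr mulr_sumr; apply: eq_bigr => j _.
  by rewrite (sym j il); field.
rewrite (_ : L x * _ = - (du il x * - (L x * fu x)) * -1); last by ring.
rewrite -equ mulr_sumr mulrN mulr1 opprK -big_split; apply: eq_bigr => j _ /=; ring.
Qed.

Lemma energy_identity Z dZ : C1 Z dZ -> bsupp Z ->
  I (fun x => energy x * dZ il x) = I (fun x => \sum_j energy_flux j x * dZ j x).
Proof.
move=> cZ sZ; have [de cde deE] := C1_energy.
have CZ : Cc Z by split => //; exact: cC cZ.
have CdZ j : Cc (dZ j).
  by split; [exact: (C1_continuous_grad cZ (i := j))|exact: bsupp_derive sZ (C1_derive cZ j)].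
rewrite (I_ibp il cde cZ sZ) I_sum; last first.
  by move=> j _; apply: CcMl => //; exact: cC (C1_energy_flux j).
rewrite (eq_bigr (fun j => - I (fun x =>
    (G x * (du il x * ddu j j x + ddu il j x * du j x) + dG j x * (du il x * du j x)) * Z x)));
    last by move=> j _; exact: (I_ibp j (C1_energy_flux j) cZ sZ).
rewrite sumrN -I_sum; last first.
  by move=> j _; apply: CcMl => //; exact: (C1_continuous_grad (C1_energy_flux j) (i := j)).
by congr (- I _); apply/funext => x; rewrite deE mulr_suml.
Qed.

Section window.
Variables (r T : R).
Hypothesis r0 : 0 < r.

(** The cutoff whose translates by [T e_il] are compared. *)
Definition window : 'rV[R]_n -> R :=
  tensor (fun j t => if j == il then trap r t else chi (t / r)).

(** The factors of a function of bounded support whose derivative in the last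
    variable is the difference of [window] and its translate: a single window
    has no primitive of bounded support. *)
Let Zc (j : 'I_n) (t : R) := if j == il then trap_primitive r t - trap_primitive r (t - T)
  else chi (t / r).
Let dZc (j : 'I_n) (t : R) := if j == il then trap r t - trap r (t - T) else dchi (t / r) / r.

Lemma C1_window_shift : C1 (tensor Zc) (dtensor Zc dZc).
Proof.
have ct : continuous (trap r) by exact: continuous_trap.
have ctT : continuous (fun t => trap r (t - T)).
  move=> t; apply: (@continuous_comp R R R (fun t => t - T) (trap r)); last exact: ct.
  by apply: cvgB; [exact: cvg_id|exact: cvg_cst].
apply: C1_tensor => i; rewrite /dZc /Zc; case: (i == il).
- by move=> t; exact: (cvgB (ct t) (ctT t)).
- move=> t; apply: cvgM; last exact: cvg_cst.
  by apply: continuous_scaled; exact: continuous_dchi.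
- move=> t; exact: (is_deriveB (is_derive_trap t r0)
    (@is_derive_translate R R (trap_primitive r) t (- T) 1 _ (is_derive_trap _ r0))).
- exact: is_derive_chi_scaled.
Qed.

Let N := 2 * r + `|T|.

Let Zc_eq0 t : N <= `|t| -> trap_primitive r t - trap_primitive r (t - T) = 0.
Proof.
have T1 := ler_norm T; have T2 := ler_norm (- T); rewrite normrN in T2.
rewrite ler_normr => /orP[h|h].
  by rewrite !trap_primitive_right ?subrr//; rewrite /N in h; lra.
by rewrite !trap_primitive_left ?subrr//; rewrite /N in h; lra.
Qed.

Lemma bsupp_window_shift : bsupp (tensor Zc).
Proof.
apply: (@bsupp_tensor _ _ _ N) => j t Nt; rewrite /Zc; case: ifP => _.
  by apply: Zc_eq0; exact: ltW.
rewrite chi_eq0// norm_div_gt0// ler_pdivlMr//.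
by apply: le_trans (ltW Nt); rewrite /N lerDl.
Qed.

(** A majorant of the gradient of the cutoff, at a scale where it can be
    integrated in the last variable. *)
Let Qc (j : 'I_n) (t : R) := if j == il then chi (t / N) else chi (t / (2 * r)).

Let N0 : 0 < N. Proof. by rewrite /N ltr_pwDl// mulr_gt0. Qed.

(** In the directions other than the last one, the slope [6 / r] of [chi]
    multiplies the height [3 r] of the primitive: the bound is 18 whatever the
    length [T] of the tube. *)
Lemma window_shift_grad_le j x : `|dtensor Zc dZc j x| <= 18 * tensor Qc x.
Proof.
have Qc0 l t : 0 <= Qc l t by rewrite /Qc; case: ifP => _; exact: chi_ge0.
(* if some coordinate lies outside the support of its factor, the gradient vanishes *)
have [xs|] := pselect (forall l, if l == il then `|x 0 l| <= N else `|x 0 l| <= 2 * r); last first.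
  move=> /existsNP[l xl].
  have [dl zl] : dZc l (x 0 l) = 0 /\ Zc l (x 0 l) = 0.
    move: xl; rewrite /dZc /Zc; case: ifP => _ /negP; rewrite -ltNge => xl.
      split; last by apply: Zc_eq0; exact: ltW.
      have T1 := ler_norm T; have T2 := ler_norm (- T); rewrite normrN in T2.
      rewrite !trap_eq0 ?subrr//; last by rewrite /N in xl; lra.
      by have := ler_normB (x 0 l) (x 0 l - T); rewrite opprB addrC subrK /N in xl *; have := ler_normB (x 0 l - T) (- T); rewrite opprK subrK normrN; lra.
    have h : 2 <= `|x 0 l / r| by rewrite norm_div_gt0// ler_pdivlMr// ltW.
    by rewrite dchi_eq0 ?mul0r ?chi_eq0//; right.
  rewrite (_ : dtensor _ _ _ _ = 0) ?normr0 ?mulr_ge0 ?tensor_ge0//.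
  rewrite /dtensor; have [<-|lj] := eqVneq l j; first by rewrite dl mul0r.
  by rewrite (bigD1 l)//= zl mul0r mulr0.
have Q1 : tensor Qc x = 1.
  rewrite /tensor big1// => l _; rewrite /Qc; have := xs l; case: ifP => _ xl.
    by rewrite chi_eq1// norm_div_gt0// ler_pdivrMr// mul1r.
  by rewrite chi_eq1// norm_div_gt0 ?mulr_gt0// ler_pdivrMr ?mulr_gt0// mul1r.
rewrite Q1 mulr1.
have P3 t : `|trap_primitive r t - trap_primitive r (t - T)| <= 3 * r.
  have := trap_primitive_bounds t r0; have := trap_primitive_bounds (t - T) r0.
  by rewrite ler_norml; lra.
have T1 t : `|trap r t - trap r (t - T)| <= 1.
  have := trap_bounds t r0; have := trap_bounds (t - T) r0.
  by rewrite ler_norml; lra.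
have ch (P : pred 'I_n) : \prod_(l | P l && (l != il)) `|Zc l (x 0 l)| <= 1.
  apply: prodr_ile1 => l /andP[_ lil]; rewrite normr_ge0 /= /Zc (negbTE lil).
  by rewrite ger0_norm ?chi_ge0 ?chi_le1.
rewrite /dtensor normrM normr_prod.
have [->|jil] := eqVneq j il.
  rewrite {1}/dZc eqxx (@le_trans _ _ (1 * 1))//; last by lra.
  apply: ler_pM => //.
    by apply: prodr_ge0.
  by have := ch xpredT; rewrite /=.
rewrite {1}/dZc (negbTE jil) (bigD1 il)/= 1?eq_sym// {1}/Zc eqxx.
rewrite (@le_trans _ _ (6 / r * (3 * r * 1)))//; last first.
  by rewrite (_ : 6 / r * (3 * r * 1) = 18)//; field; rewrite gt_eqF.
apply: ler_pM => //.
  by rewrite mulr_ge0// prodr_ge0.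
  by rewrite norm_div_gt0// ler_pM2r ?invr_gt0// dchi_le.
apply: ler_pM => //; exact: prodr_ge0.
Qed.

Lemma dwindow_shift x : dtensor Zc dZc il x = window x - window (x - T *: e_ il).
Proof.
have wE y : window y = trap r (y 0 il) * \prod_(j | j != il) chi (y 0 j / r).
  rewrite /window /tensor (bigD1 il)//= eqxx; congr (_ * _).
  by apply: eq_bigr => j jil; rewrite (negbTE jil).
rewrite /dtensor !wE {1}/dZc eqxx mulrBl !mxE !eqxx mulr1; congr (_ * _ - _ * _).
  by apply: eq_bigr => j jil; rewrite /Zc (negbTE jil).
apply: eq_bigr => j jil; rewrite /Zc (negbTE jil) !mxE eqxx (negbTE jil).
by rewrite mulr0 subr0.
Qed.

Lemma G_line x s : G (x + s *: e_ il) = G x.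
Proof.
have [xi _ /eqP] := MVT_line (C1_derive cG il) x s.
by rewrite dGn mulr0 subr_eq0 => /eqP.
Qed.

Lemma L_line x s : L (x + s *: e_ il) = L x.
Proof.
have [xi _ /eqP] := MVT_line (C1_derive cL il) x s.
by rewrite dLn mulr0 subr_eq0 => /eqP.
Qed.

Let C1Q : exists dQ, C1 (tensor Qc) dQ.
Proof.
eexists; apply: C1_tensor => [i|i t]; last first.
  rewrite /Qc; instantiate (1 := fun i t => if i == il then dchi (t / N) / N
    else dchi (t / (2 * r)) / (2 * r)).
  by rewrite /=; case: (i == il); exact: is_derive_chi_scaled.
rewrite /=; case: (i == il) => t; apply: cvgM; try exact: cvg_cst;
  by apply: continuous_scaled; exact: continuous_dchi.
Qed.

Let CQ : Cc (tensor Qc).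
Proof.
have [dQ cQ] := C1Q; split; first exact: cC cQ.
apply: (@bsupp_tensor _ _ _ (2 * N + 4 * r)) => j t tN.
have N0' := N0; have r0' := r0; have r2 : 0 < 2 * r by lra.
rewrite /Qc; case: ifP => _; rewrite chi_eq0//.
  by rewrite norm_div_gt0// ler_pdivlMr//; move: (N) tN N0' => N' tN N0'; lra.
by rewrite norm_div_gt0// ler_pdivlMr//; move: (N) tN N0' => N' tN N0'; lra.
Qed.

(** Integrated in the last variable, the derivative of [u] contributes at most
    the oscillation of [u]; this saves one power of [r]. *)
Lemma line_saving : I (fun x => G x * (du il x * tensor Qc x)) <=
  I (fun x => (2 * r)^-1 * (G x * zeta (2 * r) x)).
Proof.
have r20 : 0 < 2 * r by rewrite mulr_gt0.
have CA : Cc (fun x => G x * (du il x * tensor Qc x)).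
  by apply: CcMl; [exact: cC cG|apply: CcMl => //; exact: cdui].
have CB : Cc (fun x => (2 * r)^-1 * (G x * zeta (2 * r) x)).
  by apply: CcZ; apply: CcMl; [exact: cC cG|exact: Cc_zeta].
apply: (I_lines_le (i := il)) => // x.
pose k := G x * \prod_(l | l != il) chi (x 0 l / (2 * r)).
have k0 : 0 <= k.
  by rewrite mulr_ge0 ?(ltW (G0 x))// prodr_ge0// => l _; exact: chi_ge0.
have QE s : tensor Qc (x + s *: e_ il) =
    chi ((x 0 il + s) / N) * \prod_(l | l != il) chi (x 0 l / (2 * r)).
  rewrite /tensor (bigD1 il)//= /Qc eqxx !mxE !eqxx mulr1; congr (_ * _).
  apply: eq_bigr => l lil; rewrite (negbTE lil) !mxE eqxx (negbTE lil).
  by rewrite mulr0 addr0.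
have zE s : zeta (2 * r) (x + s *: e_ il) =
    chi ((x 0 il + s) / (2 * r)) * \prod_(l | l != il) chi (x 0 l / (2 * r)).
  rewrite /zeta /tensor (bigD1 il)//= !mxE !eqxx mulr1; congr (_ * _).
  apply: eq_bigr => l lil; rewrite !mxE eqxx (negbTE lil).
  by rewrite mulr0 addr0.
apply: (@le_trans _ _ (2 * k)%:E).
  pose K := 2 * N + `|x 0 il|.
  have K0 : 0 < K by have := N0; have := normr_ge0 (x 0 il); rewrite /K; lra.
  rewrite (@integral_support _ _ (- K) K); last first.
    move=> s; rewrite -ler_norml -ltNge => Ks.
    rewrite QE chi_eq0 ?mul0r ?mulr0// norm_div_gt0 ?N0// ler_pdivlMr ?N0//.
    have := ler_normB (x 0 il + s) (x 0 il); rewrite addrAC subrr add0r.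
    by rewrite /K in Ks; lra.
  have dF (s : R) : is_derive s 1 (fun s => k * u (x + s *: e_ il)) (k * du il (x + s *: e_ il)).
    have dc : is_derive s 1 (fun _ : R => k) 0 by exact: is_derive_cst.
    apply: is_derive_eq (is_deriveM dc ((is_derive_line u x (e_ il) s _).1 (C1_derive cu il _))) _.
    by rewrite /GRing.scale /= mulr0 addr0.
  have cl : continuous (fun s : R => x + s *: e_ il).
    by move=> s; apply: cvgD; [exact: cvg_cst|apply: cvgZl; exact: cvg_id].
  have cF : continuous (fun s : R => k * du il (x + s *: e_ il)).
    move=> s; apply: cvgM; first exact: cvg_cst.
    by apply: (continuous_comp (cl s)); exact: cdui.
  apply: (@le_trans _ _ (\int[leb]_(s in `[(- K)%R, K]) (k * du il (x + s *: e_ il))%:E)%E).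
    apply: ge0_le_integral => //.
    - by move=> s _; rewrite lee_fin mulr_ge0 ?(ltW (G0 _))// mulr_ge0 ?(ltW (un0 _))// tensor_ge0// => j t;
        rewrite /Qc; case: ifP => _; exact: chi_ge0.
    - apply: measurable_funTS; apply/measurable_EFinP.
      apply: continuous_measurable_fun; exact: (Cc_line x il CA).1.
    - apply: measurable_funTS; apply/measurable_EFinP.
      exact: continuous_measurable_fun.
    - move=> s _; rewrite lee_fin QE G_line -[leRHS]mulr1.
      rewrite [leLHS](_ : _ = k * du il (x + s *: e_ il) * chi ((x 0 il + s) / N)).
        by rewrite ler_wpM2l ?chi_le1// mulr_ge0// ltW.
      by rewrite /k; ring.
  have KK : - K < K by lra.
  rewrite (FTC_line KK cF dF) lee_fin -mulrBr [leRHS]mulrC ler_wpM2l//.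
  have := u1 (x + K *: e_ il); have := u1 (x + - K *: e_ il).
  by rewrite !ler_norml; lra.
pose a := - x 0 il - 2 * r; pose b := - x 0 il + 2 * r.
have ab : a < b by rewrite /a /b; lra.
have dF (s : R) : is_derive s 1 (fun s => (2 * r)^-1 * k * s) ((2 * r)^-1 * k).
  have dc : is_derive s 1 (fun _ : R => (2 * r)^-1 * k) 0 by exact: is_derive_cst.
  apply: is_derive_eq (is_deriveM dc (is_derive_id s 1)) _.
  by rewrite /GRing.scale /= mulr0 addr0 mulr1.
have cF : continuous (fun s : R => (2 * r)^-1 * k) by exact: cst_continuous.
apply: (@le_trans _ _ (\int[leb]_(s in `[a, b]) ((2 * r)^-1 * (G (x + s *: e_ il) * zeta (2 * r) (x + s *: e_ il)))%:E)%E).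
  rewrite (@eq_integral _ _ _ _ _ (fun s => ((2 * r)^-1 * k)%:E)); last first.
    move=> s /set_mem; rewrite /= in_itv /= => /andP[sa sb]; congr EFin.
    rewrite G_line zE chi_eq1 ?mul1r// norm_div_gt0// ler_pdivrMr// mul1r.
    by rewrite ler_norml; rewrite /a in sa; rewrite /b in sb; lra.
  rewrite (FTC_line ab cF dF) lee_fin -mulrBr (_ : b - a = 4 * r); last first.
    by rewrite /a /b; ring.
  by rewrite (_ : _ * _ * _ = 2 * k)//; field; rewrite gt_eqF.
apply: ge0_subset_integral => //.
  by apply/measurable_EFinP; apply: continuous_measurable_fun; exact: (Cc_line x il CB).1.
move=> s _; rewrite lee_fin !mulr_ge0 ?zeta_ge0 ?(ltW (G0 _))//.
by rewrite invr_ge0 ltW.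
Qed.

(** The energy identity tested with the function built from [Zc]: the flux is at
    most [M G d_n u], and [line_saving] integrates it. *)
Lemma window_shift_energy : Cc window /\
  I (fun x => energy x * window x) <=
  I (fun x => energy x * window (x - T *: e_ il)) +
    n%:R * (9 * M / r) * I (fun x => G x * zeta (2 * r) x).
Proof.
have Cw : Cc window.
  split.
    apply: (continuous_prod (f := fun j (x : 'rV[R]_n) =>
      if j == il then trap r (x 0 j) else chi (x 0 j / r))) => j.
    case: (j == il); first by apply: continuous_coordc; exact: continuous_trap.
    apply: (@continuous_coordc _ _ (fun t => chi (t / r))).
    by apply: continuous_scaled; exact: continuous_chi.
  apply: (@bsupp_tensor _ _ _ (2 * r)) => j t /ltW tr; case: ifP => _.
    exact: trap_eq0.
  by rewrite chi_eq0// norm_div_gt0// ler_pdivlMr.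
have Cw' : Cc (fun x => window (x - T *: e_ il)).
  by have := Cc_shift (- (T *: e_ il)) Cw.
split => //.
have [de cde _] := C1_energy; have ce := cC cde.
have -> : n%:R * (9 * M / r) * I (fun x => G x * zeta (2 * r) x) =
    n%:R * (18 * M) * I (fun x => (2 * r)^-1 * (G x * zeta (2 * r) x)).
  rewrite IZ; last by apply: CcMl; [exact: cC cG|apply: Cc_zeta; rewrite mulr_gt0].
  by field; rewrite gt_eqF.
rewrite -lerBlDl -IB; try exact: CcMl.
rewrite (_ : (fun x => _) = (fun x => energy x * dtensor Zc dZc il x)); last first.
  by apply/funext => x; rewrite dwindow_shift mulrBr.
rewrite (energy_identity C1_window_shift bsupp_window_shift).
have CA : Cc (fun x => G x * (du il x * tensor Qc x)).
  by apply: CcMl; [exact: cC cG|apply: CcMl => //; exact: cdui].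
apply: (@le_trans _ _ (n%:R * (18 * M) * I (fun x => G x * (du il x * tensor Qc x)))); last first.
  by rewrite ler_wpM2l ?line_saving// mulr_ge0// mulr_ge0// ltW.
rewrite -IZ//; apply: I_le.
- apply: Cc_sum => j _; apply: CcMl; first exact: cC (C1_energy_flux j).
  split; first exact: (C1_continuous_grad C1_window_shift (i := j)).
  exact: bsupp_derive bsupp_window_shift (C1_derive C1_window_shift j).
- exact: CcZ.
- move=> x; apply: (@le_trans _ _ (\sum_(j < n) (18 * M) * (G x * (du il x * tensor Qc x)))).
    apply: ler_sum => j _; rewrite (le_trans (ler_norm _))// normrM /energy_flux (normrM (G x)) (normrM (du il x)).
    rewrite (gtr0_norm (G0 x)) (gtr0_norm (un0 x)).
    rewrite (_ : 18 * M * _ = G x * (du il x * M) * (18 * tensor Qc x)); last by ring.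
    apply: ler_pM => //; last exact: window_shift_grad_le.
      by rewrite !mulr_ge0// ltW.
    by rewrite !ler_pM2l.
  by rewrite sumr_const card_ord -[leLHS]mulr_natl mulrA.
Qed.

End window.

Let W x : R := 1 - eps * u x.

Let W_norm x : `|u x - eps| = W x.
Proof.
have := u1 x; rewrite ler_norml /W => h.
case: eps1 => ->; first by rewrite ler0_norm; lra.
by rewrite ger0_norm; lra.
Qed.

Let cW : continuous W.
Proof.
have cu' := cC cu.
by move=> x; exact: (cvgB (cvg_cst _) (cvgM (cvg_cst _) (cu' x))).
Qed.

Let tail_const r := Mf + n%:R * (M * (3 / r)) + CF.

(** Caccioppoli's inequality for [u - eps]: the energy in a window is
    controlled by how far [u] is from its limit there. *)
Lemma energy_tail r (T : R) : 0 < r ->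
  I (fun x => energy x * zeta (2 * r) (x - T *: e_ il)) <=
  tail_const r * I (fun x => (G x + L x) * W x * zeta (4 * r) (x - T *: e_ il)).
Proof.
move=> r0; have r20 : 0 < 2 * r by lra. have r40 : 0 < 4 * r by lra.
pose X x : R := zeta (2 * r) (x - T *: e_ il).
pose X4 x : R := zeta (4 * r) (x - T *: e_ il).
have cX : C1 X (fun i x => dzeta (2 * r) i (x - T *: e_ il)).
  exact: (C1_translate (- (T *: e_ il)) (C1_zeta (2 * r))).
have CX : Cc X by exact: (Cc_shift (- (T *: e_ il)) (Cc_zeta (n := n) r20)).
have CX4 : Cc X4 by exact: (Cc_shift (- (T *: e_ il)) (Cc_zeta (n := n) r40)).
have X4E : 2 * (2 * r) = 4 * r by ring.
have XX4 x : X x <= X4 x.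
  rewrite /X; have [xs|] := pselect (forall i, `|(x - T *: e_ il) 0 i| <= 4 * r).
    by rewrite /X4 (@zeta_eq1 _ _ (4 * r))// zeta_le1.
  move=> /existsNP[i /negP]; rewrite -ltNge => xi.
  by rewrite (zeta_eq0 (i := i)) ?zeta_ge0//; lra.
have X0 x : 0 <= X x by exact: zeta_ge0.
have W0 x : 0 <= W x by rewrite -W_norm.
pose U j x := (u x - eps) * (G x * du j x).
have cU j : C1 (U j) (fun i x => (u x - eps) * (G x * ddu j i x + dG i x * du j x) + (du i x - 0) * (G x * du j x)).
  exact: (C1M (C1D cu (C1N (C1_cst eps))) (C1M cG (cdu j))).
have ibp j : I (fun x => U j x * dzeta (2 * r) j (x - T *: e_ il)) = - I (fun x =>
    ((u x - eps) * (G x * ddu j j x + dG j x * du j x) + (du j x - 0) * (G x * du j x)) * X x).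
  exact: (I_ibp j (cU j) cX CX.2).
have C1j j : Cc (fun x => U j x * dzeta (2 * r) j (x - T *: e_ il)).
  apply: CcMl; first exact: cC (cU j).
  split; first exact: (C1_continuous_grad cX (i := j)).
  exact: bsupp_derive CX.2 (C1_derive cX j).
have C2j j : Cc (fun x =>
    ((u x - eps) * (G x * ddu j j x + dG j x * du j x) + (du j x - 0) * (G x * du j x)) * X x).
  by apply: CcMl => //; exact: (C1_continuous_grad (cU j) (i := j)).
have cgs := cC C1_grad_sq; have cG' := cC cG; have cL' := cC cL.
have cu' := cC cu; have cFu' := cC cFu.
have cue : continuous (fun x => u x - eps).
  by move=> x; exact: (cvgB (cu' x) (cvg_cst _)).
have CA : Cc (fun x => G x * grad_sq x * X x) by apply: CcMl => //; exact: continuousM.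
have CB : Cc (fun x => (u x - eps) * (L x * fu x) * X x).
  by apply: CcMl => //; apply: continuousM => //; exact: continuousM.
have CD : Cc (fun x => L x * (c - Fu x) * X x).
  apply: CcMl => //; apply: continuousM => //.
  by move=> x; exact: (cvgB (cvg_cst _) (cFu' x)).
have CY : Cc (fun x => (G x + L x) * W x * X4 x).
  by apply: CcMl => //; apply: continuousM => //; exact: continuousA.
have caccioppoli : I (fun x => G x * grad_sq x * X x) =
    I (fun x => (u x - eps) * (L x * fu x) * X x) -
    \sum_j I (fun x => U j x * dzeta (2 * r) j (x - T *: e_ il)).
  rewrite (eq_bigr _ (fun j _ => ibp j)) sumrN opprK -I_sum// -ID//; last exact: Cc_sum.
  congr I; apply/funext => x; rewrite -mulr_suml.
  have -> : \sum_j ((u x - eps) * (G x * ddu j j x + dG j x * du j x) + (du j x - 0) * (G x * du j x))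
     = (u x - eps) * - (L x * fu x) + G x * grad_sq x.
    rewrite -equ mulr_sumr [G x * _]mulr_sumr -big_split; apply: eq_bigr => j _ /=; ring.
  ring.
have -> : (fun x => energy x * zeta (2 * r) (x - T *: e_ il)) =
    (fun x => 2^-1 * (G x * grad_sq x * X x) + L x * (c - Fu x) * X x).
  by apply/funext => x; rewrite /energy /X; ring.
rewrite ID ?IZ//; last exact: CcZ.
have tB : I (fun x => (u x - eps) * (L x * fu x) * X x) <=
    I (fun x => Mf * ((G x + L x) * W x * X4 x)).
  apply: I_le => //; first exact: CcZ.
  move=> x; rewrite (le_trans (ler_norm _))// !normrM W_norm (ger0_norm (L0 x)) (ger0_norm (X0 x)).
  rewrite (_ : Mf * _ = W x * ((G x + L x) * Mf) * X4 x); last by ring.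
  apply: ler_pM => //; first by rewrite !mulr_ge0.
  apply: ler_wpM2l => //; apply: ler_pM => //.
  by rewrite lerDr ltW.
have tU j : - I (fun x => U j x * dzeta (2 * r) j (x - T *: e_ il)) <=
    I (fun x => M * (3 / r) * ((G x + L x) * W x * X4 x)).
  rewrite -IN//; apply: I_le; [exact: CcN|exact: CcZ|move=> x].
  rewrite (le_trans (ler_norm _))// normrN normrM /U (normrM (u x - eps)) (normrM (G x)) W_norm.
  rewrite (gtr0_norm (G0 x)).
  have dz := dzeta_le_zeta j (x - T *: e_ il) r20.
  have E36 : 6 / (2 * r) = 3 / r by field; rewrite gt_eqF.
  rewrite X4E E36 in dz.
  rewrite (_ : _ * _ * (_ * _ * _) = W x * ((G x + L x) * M) * (3 / r * X4 x)); last by ring.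
  apply: ler_pM => //; first by rewrite !mulr_ge0// ltW.
  apply: ler_wpM2l => //; apply: ler_pM => //; first by rewrite ltW.
  by rewrite lerDl.
have tD : I (fun x => L x * (c - Fu x) * X x) <= I (fun x => CF * ((G x + L x) * W x * X4 x)).
  apply: I_le => //; first exact: CcZ.
  move=> x; rewrite (_ : CF * _ = (G x + L x) * (CF * W x) * X4 x); last by ring.
  apply: ler_pM => //; first by rewrite mulr_ge0// subr_ge0.
  apply: ler_pM => //; first by rewrite subr_ge0.
  by rewrite lerDr ltW.
rewrite !IZ// in tB tU tD.
have tS : - (\sum_j I (fun x => U j x * dzeta (2 * r) j (x - T *: e_ il))) <=
    n%:R * (M * (3 / r) * I (fun x => (G x + L x) * W x * X4 x)).
  rewrite -sumrN (le_trans (ler_sum _ (fun j _ => tU j)))//.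
  by rewrite sumr_const card_ord -[leLHS]mulr_natl.
rewrite caccioppoli /tail_const -/X4.
have Y0 : 0 <= I (fun x => (G x + L x) * W x * X4 x).
  apply: I_ge0 => x; rewrite mulr_ge0 ?zeta_ge0// mulr_ge0// addr_ge0//; exact: ltW.
have h1 : 0 <= Mf * I (fun x => (G x + L x) * W x * X4 x) by rewrite mulr_ge0.
have h2 : 0 <= n%:R * (M * (3 / r) * I (fun x => (G x + L x) * W x * X4 x)).
  by rewrite !mulr_ge0 ?invr_ge0// ltW.
move: tB tS tD h1 h2; set Y := I (fun x => (G x + L x) * W x * X4 x).
have -> : (Mf + n%:R * (M * (3 / r)) + CF) * Y =
  Mf * Y + n%:R * (M * (3 / r) * Y) + CF * Y by ring.
lra.
Qed.

(** Translating the cutoff back to the origin moves the translation to [u] only,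
    as the weights are constant in that direction; dominated convergence
    applies. *)
Lemma energy_tail_cvg r : 0 < r ->
  I (fun x => (G x + L x) * W x * zeta (4 * r) (x - (eps * k%:R) *: e_ il)) @[k --> \oo] --> 0.
Proof.
move=> r0; have r40 : 0 < 4 * r by lra.
have cGL : continuous (fun x => G x + L x) by apply: continuousA; [exact: cC cG|exact: cC cL].
have Cz := Cc_zeta (n := n) r40.
have -> : (fun k : nat => I (fun x => (G x + L x) * W x * zeta (4 * r) (x - (eps * k%:R) *: e_ il)))
  = (fun k => I (fun x => (G x + L x) * W (x + (eps * k%:R) *: e_ il) * zeta (4 * r) x)).
  apply/funext => k.
  rewrite -(I_shift il (eps * k%:R)); last first.
    apply: CcMl; first exact: continuousM.
    exact: (Cc_shift (- ((eps * k%:R) *: e_ il)) Cz).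
  congr I; apply/funext => x; rewrite (G_line x) (L_line x).
  by rewrite addrK.
rewrite (_ : 0 = I (fun x : 'rV[R]_n => 0 * zeta (4 * r) x)); last first.
  by rewrite IZ// mul0r.
apply: (I_cvg (psi := fun x => (G x + L x) * 2 * zeta (4 * r) x)).
- move=> k; apply: CcMl => //; apply: continuousM => //.
  move=> x; apply: (@continuous_comp _ _ _ (fun x : 'rV[R]_n => x + (eps * k%:R) *: e_ il) W).
    exact: (cvgD (@cvg_id _ _) (cvg_cst _)).
  exact: cW.
- exact: CcZ.
- by apply: CcMl => //; apply: continuousM => //; exact: cst_continuous.
- move=> k x; rewrite normrM (ger0_norm (zeta_ge0 _ _)) ler_wpM2r ?zeta_ge0//.
  have GL0 : 0 <= G x + L x by rewrite addr_ge0// ltW.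
  rewrite normrM (ger0_norm GL0) ler_wpM2l// -W_norm normr_id.
  rewrite (le_trans (ler_normB _ _))//.
  have := u1 (x + (eps * k%:R) *: e_ il).
  have -> : `|eps| = 1 by case: eps1 => ->; rewrite ?normrN normr1.
  lra.
- move=> x; apply: cvgM; last exact: cvg_cst.
  rewrite -[X in _ --> X](mulr0 (G x + L x)); apply: cvgM; first exact: cvg_cst.
  have -> : 0 = 1 - eps * eps by case: eps1 => ->; rewrite ?mulrNN mulr1 subrr.
  by apply: cvgB; [exact: cvg_cst|apply: cvgM; [exact: cvg_cst|exact: ucvg]].
Qed.

(** [window_shift_energy] in the limit of infinite translation. *)
Lemma gradient_growth r : 0 < r ->
  I (fun x => G x * grad_sq x * zeta (r / 2) x) <=
  n%:R * (18 * M / r) * I (fun x => G x * zeta (2 * r) x).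
Proof.
move=> r0; have r20 : 0 < 2 * r by lra. have rh0 : 0 < r / 2 by lra.
have [Cw _] := window_shift_energy 0 r0.
have [de cde _] := C1_energy; have ce := cC cde.
have cgs := cC C1_grad_sq; have cG' := cC cG.
have window_le x : window r x <= zeta (2 * r) x.
  have chi_scale t : chi (t / r) <= chi (t / (2 * r)).
    have [tr|tr] := leP (2 * r) `|t|.
      by rewrite chi_eq0 ?chi_ge0// norm_div_gt0// ler_pdivlMr.
    by rewrite [leRHS]chi_eq1 ?chi_le1// norm_div_gt0// ler_pdivrMr// mul1r ltW.
  have trap_chi t : trap r t <= chi (t / (2 * r)).
    have [tr|tr] := leP (2 * r) `|t|.
      by rewrite trap_eq0// chi_ge0.
    rewrite [leRHS]chi_eq1; first by have /andP[] := trap_bounds t r0.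
    by rewrite norm_div_gt0// ler_pdivrMr// mul1r ltW.
  apply: ler_prod => j _; case: (j == il); last by rewrite chi_ge0 chi_scale.
  by rewrite trap_chi andbT; have /andP[] := trap_bounds (x 0 j) r0.
have window_ge x : zeta (r / 2) x <= window r x.
  have [xs|] := pselect (forall i, `|x 0 i| <= r).
    rewrite (_ : window r x = 1) ?zeta_le1//.
    rewrite /window /tensor big1// => j _; case: ifP => _; first by rewrite trap_eq1.
    by rewrite chi_eq1// norm_div_gt0// ler_pdivrMr// mul1r.
  move=> /existsNP[i /negP]; rewrite -ltNge => xi.
  rewrite (zeta_eq0 (i := i)) ?tensor_ge0//; last by lra.
  by move=> j t; case: ifP => _; [have /andP[] := trap_bounds t r0|exact: chi_ge0].
have CGz : Cc (fun x => G x * zeta (2 * r) x) by apply: CcMl => //; exact: Cc_zeta.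
have key : I (fun x => energy x * window r x) <= n%:R * (9 * M / r) * I (fun x => G x * zeta (2 * r) x).
  have lim : tail_const r * I (fun x => (G x + L x) * W x * zeta (4 * r) (x - (eps * k%:R) *: e_ il)) +
      n%:R * (9 * M / r) * I (fun x => G x * zeta (2 * r) x) @[k --> \oo] -->
      tail_const r * 0 + n%:R * (9 * M / r) * I (fun x => G x * zeta (2 * r) x).
    apply: cvgD; last exact: cvg_cst.
    by apply: cvgM; [exact: cvg_cst|exact: energy_tail_cvg].
  rewrite mulr0 add0r in lim.
  apply: (ler_cvg_to (cvg_cst _) lim); apply: nearW => k.
  have [_ h] := window_shift_energy (eps * k%:R) r0.
  apply: (le_trans h); rewrite lerD2r.
  apply: le_trans (energy_tail (eps * k%:R) r0).
  apply: I_le.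
  - by apply: CcMl => //; exact: (Cc_shift (- ((eps * k%:R) *: e_ il)) Cw).
  - by apply: CcMl => //; exact: (Cc_shift (- ((eps * k%:R) *: e_ il)) (Cc_zeta (n := n) r20)).
  - by move=> x; rewrite ler_wpM2l// energy_ge0.
have cGgs : continuous (fun x => G x * grad_sq x) by exact: continuousM.
have CL : Cc (fun x => G x * grad_sq x * zeta (r / 2) x) by apply: CcMl => //; exact: Cc_zeta.
have : I (fun x => 2^-1 * (G x * grad_sq x * zeta (r / 2) x)) <= I (fun x => energy x * window r x).
  apply: I_le; [exact: CcZ|exact: CcMl|move=> x].
  rewrite mulrA; apply: ler_pM => //; last exact: energy_ge.
    by rewrite mulr_ge0 ?invr_ge0// mulr_ge0 ?grad_sq_ge0// ltW.
  exact: zeta_ge0.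
rewrite IZ// => h.
have -> : n%:R * (18 * M / r) * I (fun x => G x * zeta (2 * r) x) =
   2 * (n%:R * (9 * M / r) * I (fun x => G x * zeta (2 * r) x)) by ring.
lra.
Qed.

End energy.

(** * The divergence condition on the growth *)
Section divergence.
Context {R : realType}.
Local Notation leb := (@lebesgue_measure R).

Lemma integral_itv_co (h : R -> R) (a b : R) : a <= b ->
  (forall x y, a <= x -> x <= y -> 0 <= h y <= h x) ->
  measurable_fun setT h ->
  (\int[leb]_(x in `[a, b[) (h x)%:E <= ((b - a) * h a)%:E)%E.
Proof.
move=> ab hd mh.
apply: (@le_trans _ _ (\int[leb]_(x in `[a, b[) (cst (h a)%:E x))%E).
  apply: ge0_le_integral => //.
  - by move=> x /=; rewrite in_itv/= lee_fin => /andP[ax _]; have /andP[] := hd a x (lexx _) ax.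
  - by apply: measurable_funTS; apply/measurable_EFinP.
  - by move=> x /=; rewrite in_itv/= lee_fin => /andP[ax _]; have /andP[] := hd a x (lexx _) ax.
have h0 : 0 <= h a by have /andP[] := hd a a (lexx _) (lexx _).
rewrite integral_cst// mulrC EFinM; apply: lee_wpmul2l; first by rewrite lee_fin.
rewrite [leLHS](lebesgue_measure_itv `[a, b[)/= lte_fin.
by case: ifPn => // _; rewrite lee_fin subr_ge0.
Qed.

(** If [b i > 0], dividing by [b j * b j.+1] gives
    [1 / g (K * 4 ^+ j) <= C * (1 / b j - 1 / b j.+1)] for [j >= i].  The right-hand
    side telescopes, while the integral of [1 / (r * g r)] over
    the interval from [K * 4 ^+ j] to [K * 4 ^+ j.+1] is at most
    [3 / g (K * 4 ^+ j)] by monotonicity of [g]: the integral up to infinity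
    would be finite. *)
Lemma class_G_growth (g : R -> R) (b : nat -> R) (C K : R) :
  class_G g -> 0 < C -> 0 < K -> (forall j, 0 <= b j) ->
  (forall j, b j * b j.+1 <= C * g (K * 4 ^+ j) * (b j.+1 - b j)) ->
  forall j, b j = 0.
Proof.
case=> g0 gmono gdiv C0 K0 b0 step.
have K4 j : 0 < K * 4 ^+ j by rewrite mulr_gt0// exprn_gt0.
have bS j : b j <= b j.+1.
  rewrite -subr_ge0 -(pmulr_rge0 (x := C * g (K * 4 ^+ j))); last by rewrite mulr_gt0// g0.
  by apply: le_trans (step j); exact: mulr_ge0.
have bmono i j : (i <= j)%N -> b i <= b j.
  by elim: j => [|j IH]; [rewrite leqn0 => /eqP ->|rewrite leq_eqVlt => /orP[/eqP ->//|/IH h]; exact: le_trans h (bS j)].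
move=> i; apply/eqP/negPn/negP => bi0.
have bi : 0 < b i by rewrite lt_neqAle eq_sym bi0 b0.
have K1 : exists m0, 1 <= K * 4 ^+ m0.
  pose m0 := (Num.truncn K^-1).+1; exists m0.
  have : K^-1 <= 4 ^+ m0.
    apply: (@le_trans _ _ m0%:R); first by rewrite ltW// truncnS_gt.
    by rewrite -natrX ler_nat ltnW// ltn_expl.
  by rewrite -ler_pdivrMl// mulr1.
have [m0 Km0] := K1.
pose m := maxn i m0.
have bm : 0 < b m by apply: (lt_le_trans bi); apply: bmono; exact: leq_maxl.
pose rho j := K * 4 ^+ (m + j).
have rhoS j : rho j.+1 = 4 * rho j by rewrite /rho addnS exprS; ring.
have rho1 j : 1 <= rho j.
  apply: (le_trans Km0); rewrite ler_pM2l// ler_weXn2l ?ler1n//.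
  by rewrite (leq_trans (leq_maxr i m0))// leq_addr.
(* [1 / (x * g x)] for [x >= 1], extended to a nonincreasing function on the line *)
pose h x := (Num.max x 1 * g (Num.max x 1))^-1.
have max1 x : 1 <= Num.max x 1 :> R by rewrite le_max lexx orbT.
have h0 x : 0 < h x.
  have := max1 x => m1; have m0' : 0 < Num.max x 1 by lra.
  by rewrite invr_gt0 mulr_gt0// g0.
have hmono x y : x <= y -> h y <= h x.
  move=> xy; have mm : Num.max x 1 <= Num.max y 1.
    by rewrite ge_max !le_max xy lexx orbT.
  have := max1 x; have := max1 y => y1 x1.
  have x0 : 0 < Num.max x 1 by lra. have y0 : 0 < Num.max y 1 by lra.
  rewrite lef_pV2 ?posrE ?mulr_gt0 ?g0//; apply: ler_pM => //; try exact: ltW.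
    by rewrite ltW// g0.
  exact: gmono.
have mh : measurable_fun setT h by apply: nonincreasing_measurable.
have hE x : 1 <= x -> h x = (x * g x)^-1 by move=> x1; rewrite /h (max_idPl x1).
have intS a c : a <= c -> (\int[leb]_(x in `[a, c[) (h x)%:E <= ((c - a) * h a)%:E)%E.
  move=> ac; apply: integral_itv_co => // x y _ xy; by rewrite hmono// andbT ltW.
pose c0 := (rho 0 - 1) * h 1.
have bnd j : (\int[leb]_(x in `[1%R, rho j[) (h x)%:E <=
    (c0 + 3 * C * ((b m)^-1 - (b (m + j)%N)^-1))%:E)%E.
  elim: j => [|j IH].
    rewrite addn0 subrr mulr0 addr0; exact: intS.
  rewrite (@itv_bndbnd_setU _ _ _ (BLeft (rho j))); last 2 first.
  - by rewrite bnd_simp.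
  - by rewrite bnd_simp rhoS; have := rho1 j; lra.
  rewrite ge0_integral_setU//=; last 3 first.
  - by apply: measurable_funTS; apply/measurable_EFinP.
  - by move=> x _; rewrite lee_fin ltW.
  - apply/disj_setPS => y [/=]; rewrite !in_itv/= => /andP[_ yr] /andP[ry _].
    by move: yr; rewrite ltNge ry.
  have rj : rho j <= rho j.+1 by rewrite rhoS; have := rho1 j; lra.
  apply: (le_trans (leeD IH (intS _ _ rj))); rewrite -EFinD lee_fin.
  have rp : 0 < rho j by have := rho1 j; lra.
  have gp : 0 < g (rho j) by exact: g0.
  have -> : (rho j.+1 - rho j) * h (rho j) = 3 * (g (rho j))^-1.
    by rewrite hE// rhoS; field; rewrite !gt_eqF.
  have bj : 0 < b (m + j)%N by apply: (lt_le_trans bm); apply: bmono; exact: leq_addr.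
  have bj1 : 0 < b (m + j).+1 by exact: lt_le_trans bj (bS _).
  have st := step (m + j)%N; rewrite -/(rho j) in st.
  suff : (g (rho j))^-1 <= C * ((b (m + j)%N)^-1 - (b (m + j).+1)^-1).
    by rewrite addnS; lra.
  have -> : (b (m + j)%N)^-1 - (b (m + j).+1)^-1 =
      (b (m + j).+1 - b (m + j)%N) / (b (m + j)%N * b (m + j).+1).
    by field; rewrite !gt_eqF.
  rewrite mulrA ler_pdivlMr ?mulr_gt0// -[leRHS](mulKf (x := g (rho j))) ?gt_eqF//.
  by rewrite ler_pM2l ?invr_gt0//; move: st; rewrite mulrA [g _ * C]mulrC.
have fin : (\int[leb]_(x in `[1%R, +oo[) (h x)%:E <= (c0 + 3 * C * (b m)^-1)%:E)%E.
  have rho_mono p q : (p <= q)%N -> rho p <= rho q.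
    by move=> pq; rewrite ler_pM2l// ler_weXn2l ?ler1n// leq_add2l.
  pose F (j : nat) : set (measurableTypeR R) := `[1%R, rho j[%classic.
  have -> : `[1%R, +oo[%classic = \bigcup_j F j.
    apply/seteqP; split => [x|x [j _]] /=; last first.
      by rewrite !in_itv/= andbT => /andP[].
    rewrite in_itv/= andbT => x1; exists (Num.truncn x).+1 => //=.
    rewrite /F /= in_itv/= x1 /=; apply: (lt_le_trans (truncnS_gt x)).
    apply: (@le_trans _ _ (4 ^+ (Num.truncn x).+1)).
      by rewrite -natrX ler_nat ltnW// ltn_expl.
    rewrite /rho exprD mulrA ler_peMl ?exprn_ge0//.
    by have := rho1 0%N; rewrite /rho addn0.
  have cv : (\int[leb]_(x in F i0) (h x)%:E)%E @[i0 --> \oo] -->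
      (\int[leb]_(x in \bigcup_j F j) (h x)%:E)%E.
    apply: ge0_nondecreasing_set_cvg_integral => //.
    - move=> p q pq; apply/subsetPset => x; rewrite /F /= !in_itv/= => /andP[-> /= xp].
      exact: lt_le_trans xp (rho_mono _ _ pq).
    - by move=> j; exact: measurable_itv.
    - by move=> j; apply: measurable_funTS; apply/measurable_EFinP.
    - by move=> j x _; rewrite lee_fin ltW.
  rewrite -(cvg_lim _ cv)//; apply: lime_le; first by apply/cvg_ex; eexists; exact: cv.
  apply: nearW => j; apply: (le_trans (bnd j)); rewrite lee_fin lerD2l.
  by apply: ler_wpM2l; [rewrite mulr_ge0// ltW|rewrite gerBl invr_ge0 b0].
have hdiv : (\int[leb]_(r in `[1%R, +oo[) (h r)%:E)%E = +oo%E.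
  rewrite -[RHS]gdiv; apply: eq_integral => x /set_mem.
  by rewrite /= in_itv/= andbT => x1; rewrite hE.
by move: fin; rewrite hdiv leye_eq.
Qed.

End divergence.

(** * Liouville property of the quotient of two partial derivatives *)
Section liouville.
Context {R : realType} {n : nat}.
Local Notation e_ i := (delta_mx 0 i : 'rV[R]_n).
Variables (il i0 : 'I_n) (G L fu c0 : 'rV[R]_n -> R) (dG dL du : 'I_n -> 'rV[R]_n -> R)
  (ddu : 'I_n -> 'I_n -> 'rV[R]_n -> R).
Hypotheses (cG : C1 G dG) (cL : C1 L dL) (cdu : forall i, C1 (du i) (ddu i))
  (cfu : C1 fu (fun i x => c0 x * du i x))
  (sym : forall i j x, ddu i j x = ddu j i x)
  (G0 : forall x, 0 < G x) (un0 : forall x, 0 < du il x)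
  (dGn : forall x, dG il x = 0) (dLn : forall x, dL il x = 0)
  (dGi : forall x, dG i0 x = 0) (dLi : forall x, dL i0 x = 0)
  (equ : forall x, \sum_i (dG i x * du i x + G x * ddu i i x) = - (L x * fu x)).

Let cC (A : 'rV[R]_n -> R) dA : C1 A dA -> continuous A := fun H => C1_continuous H.
Let cdC (A : 'rV[R]_n -> R) dA i : C1 A dA -> continuous (dA i) :=
  fun H => C1_continuous_grad H (i := i).

(** A derivative of [u] in a direction along which the weights are constant
    is a weak solution of the linearized equation. *)
Lemma linearized_equation i xi dxi : (forall x, dG i x = 0) -> (forall x, dL i x = 0) ->
  C1 xi dxi -> bsupp xi ->
  I (fun x => G x * \sum_j ddu i j x * dxi j x) =
  I (fun x => L x * (c0 x * du i x) * xi x).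
Proof.
move=> dGi' dLi' cxi sxi.
have Cxi : Cc xi by split => //; exact: cC cxi.
have Cdxi j : Cc (dxi j).
  by split; [exact: cdC cxi|exact: bsupp_derive sxi (C1_derive cxi j)].
have cA j := C1M cG (cdu j).
rewrite (_ : (fun x => G x * _) = (fun x => \sum_j
    (G x * ddu j i x + dG i x * du j x) * dxi j x)); last first.
  apply/funext => x; rewrite mulr_sumr; apply: eq_bigr => j _.
  by rewrite dGi' (sym i j); ring.
rewrite I_sum; last by move=> j _; apply: CcMl => //; exact: cdC (cA j).
rewrite (eq_bigr (fun j => I (fun x =>
    (G x * ddu j j x + dG j x * du j x) * dxi i x))); last first.
  by move=> j _; exact: (I_exchange_derivatives i j (cA j) cxi sxi).
rewrite -I_sum; last by move=> j _; apply: CcMl => //; exact: cdC (cA j).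
have cLf := C1M cL cfu.
rewrite (_ : (fun x => _) = (fun x => - (L x * fu x * dxi i x))); last first.
  apply/funext => x; rewrite -mulr_suml -mulNr -equ; congr (_ * _).
  by apply: eq_bigr => j _; rewrite addrC.
rewrite IN; last by apply: CcMl => //; exact: cC cLf.
rewrite (I_ibp i cLf cxi sxi) opprK; congr I; apply/funext => x.
by rewrite dLi' mul0r addr0.
Qed.

Let phi := du il.
Let v := du i0.

(** [phi ^+ 2] times the gradient of [v / phi]. *)
Definition wronskian (j : 'I_n) x : R := phi x * ddu i0 j x - v x * ddu il j x.

(** The linearized equation for [v] tested with [phi * psi], minus the one for
    [phi] tested with [v * psi]: the terms of order zero cancel. *)
Lemma wronskian_equation psi dpsi : C1 psi dpsi -> bsupp psi ->
  I (fun x => G x * \sum_j wronskian j x * dpsi j x) = 0.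
Proof.
move=> cpsi spsi.
have Cpsi : Cc psi by split => //; exact: cC cpsi.
have sM (A : 'rV[R]_n -> R) : bsupp (fun x => A x * psi x).
  by have [k sk] := spsi; exists k => x l /sk ->; rewrite mulr0.
have cphi := cdu il; have cv := cdu i0.
have E1 := linearized_equation dGi dLi (C1M cphi cpsi) (sM _).
have E2 := linearized_equation dGn dLn (C1M cv cpsi) (sM _).
have Cd j : Cc (dpsi j).
  by split; [exact: (cdC (i := j) cpsi)|exact: bsupp_derive spsi (C1_derive cpsi j)].
have Csum (A B : 'I_n -> 'rV[R]_n -> R) (w : 'rV[R]_n -> R) : (forall j, continuous (A j)) ->
    continuous w -> (forall j, continuous (B j)) ->
    Cc (fun x => G x * \sum_j A j x * (w x * dpsi j x + B j x * psi x)).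
  move=> cA cw cB; apply: CcMl; first exact: cC cG.
  apply: Cc_sum => j _; apply: CcMl => //; apply: CcD; exact: CcMl.
have := congr1 (fun z => z - I (fun x => G x * \sum_j ddu il j x * (v x * dpsi j x + ddu i0 j x * psi x))) E1.
rewrite -IB; last 2 first.
- apply: (Csum (fun j => ddu i0 j) (fun j => ddu il j) phi) => [j||j]; [exact: cdC cv|exact: cC cphi|exact: cdC cphi].
- apply: (Csum (fun j => ddu il j) (fun j => ddu i0 j) v) => [j||j]; [exact: cdC cphi|exact: cC cv|exact: cdC cv].
rewrite E2 (_ : (fun x => L x * (c0 x * du i0 x) * _) =
  (fun x => L x * (c0 x * du il x) * (du i0 x * psi x))); last first.
  by apply/funext => x; ring.
rewrite subrr => H; rewrite -[RHS]H; congr I; apply/funext => x.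
rewrite -mulrBr -sumrB; congr (_ * _); apply: eq_bigr => j _.
by rewrite /wronskian /phi /v; ring.
Qed.

(** This is [G * phi ^+ 2 * |D (v / phi)| ^+ 2]. *)
Definition quotient_energy x : R := G x * \sum_j (wronskian j x / phi x) ^+ 2.

Lemma quotient_energy_ge0 x : 0 <= quotient_energy x.
Proof. by rewrite mulr_ge0 ?(ltW (G0 x))// sumr_ge0// => j _; exact: sqr_ge0. Qed.

Let cWr j : continuous (wronskian j).
Proof.
have cphi := cdu il; have cv := cdu i0.
apply: continuousA; first by apply: continuousM; [exact: cC cphi|exact: cdC cv].
by apply: continuous_opp; apply: continuousM; [exact: cC cv|exact: cdC cphi].
Qed.

Lemma continuous_quotient_energy : continuous quotient_energy.
Proof.
apply: continuousM; first exact: cC cG.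
apply: (continuous_sum (f := fun j x => (wronskian j x / phi x) ^+ 2)) => j.
apply: (@continuous_comp1 _ _ (fun t : R => t ^+ 2)); first exact: exprn_continuous.
apply: continuousM => //; exact: cC (C1V un0 (cdu il)).
Qed.

Definition localized_energy r : R := I (fun x => zeta r x ^+ 2 * quotient_energy x).
Definition caccioppoli_error r : R :=
  n%:R * (6 / r) ^+ 2 * I (fun x => G x * v x ^+ 2 * zeta (2 * r) x).

Let Cc_density r : 0 < r -> Cc (fun x => zeta r x ^+ 2 * quotient_energy x).
Proof.
move=> r0; have Cz := Cc_zeta (n := n) r0.
have : Cc (fun x => zeta r x * (zeta r x * quotient_energy x)).
  by apply: CcMl; [exact: Cz.1|apply: CcMr => //; exact: continuous_quotient_energy].
by congr Cc; apply/funext => x; ring.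
Qed.

(** [wronskian_equation] with the test function [zeta ^+ 2 * v / phi]. *)
Lemma localized_energy_identity r : 0 < r ->
  localized_energy r =
  I (fun x => - (G x * \sum_j (wronskian j x / phi x) * (2 * zeta r x * (v x * dzeta r j x)))).
Proof.
move=> r0; have cphi := cdu il; have cv := cdu i0; have cz := @C1_zeta R n r.
have Cz := Cc_zeta (n := n) r0.
have cpsi := C1M (C1M cz cz) (C1M cv (C1V un0 cphi)).
have spsi : bsupp (fun x => zeta r x * zeta r x * (v x * (phi x)^-1)).
  by have [k sk] := Cz.2; exists k => x l /sk ->; rewrite !mul0r.
have Cdz (j : 'I_n) : Cc (dzeta r j).
  by split; [exact: (cdC (i := j) cz)|exact: bsupp_derive Cz.2 (C1_derive cz j)].
have CE := Cc_density r0.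
have CF : Cc (fun x => G x * \sum_j (wronskian j x / phi x) * (2 * zeta r x * (v x * dzeta r j x))).
  apply: CcMl; first exact: cC cG.
  apply: Cc_sum => j _; apply: CcMl.
    by apply: continuousM => //; exact: cC (C1V un0 cphi).
  apply: CcMl; first by apply: continuousMc; exact: cC cz.
  by apply: CcMl => //; exact: cC cv.
rewrite IN// /localized_energy; apply/eqP; rewrite -addr_eq0 -ID//; apply/eqP.
rewrite -[RHS](wronskian_equation cpsi spsi); congr I; apply/funext => x.
rewrite /quotient_energy mulrCA -mulrDr; congr (_ * _).
rewrite mulr_sumr -big_split; apply: eq_bigr => j _ /=.
have p0 : phi x != 0 by rewrite gt_eqF ?un0.
rewrite /wronskian -/(v x) -/(phi x) -exprVn; field => //.
Qed.

Lemma zeta_half_le (r : R) (x : 'rV[R]_n) : 0 < r -> zeta (r / 2) x <= zeta (2 * r) x :> R.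
Proof.
move=> r0; have [xs|] := pselect (forall i : 'I_n, `|x 0 i| <= 2 * r).
  by rewrite (@zeta_eq1 _ _ (2 * r))// ?zeta_le1//; lra.
move=> /existsNP[i /negP]; rewrite -ltNge => xi.
by rewrite (zeta_eq0 (i := i)) ?zeta_ge0//; lra.
Qed.

Lemma localized_energy_ge0 r : 0 <= localized_energy r.
Proof.
by apply: I_ge0 => x; apply: mulr_ge0; [exact: sqr_ge0|exact: quotient_energy_ge0].
Qed.

Lemma localized_energy_le r : 0 < r -> localized_energy (r / 2) <= localized_energy (2 * r).
Proof.
move=> r0; apply: I_le; [by apply: Cc_density; lra|by apply: Cc_density; lra|move=> x].
by rewrite ler_wpM2r ?quotient_energy_ge0// lerXn2r ?nnegrE ?zeta_ge0// zeta_half_le.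
Qed.

(** Young's inequality in [localized_energy_identity] gives two bounds for
    [a(r)]: [a(r) <= 4 E], and, as the gradient of [zeta_r] lives where
    [zeta_(2r) = 1] and [zeta_(r/2) = 0],
    [a(r) <= th (a(2r) - a(r/2)) + E / th] for every [th > 0].  With
    [th = 2 E / a(r/2)] the second one becomes
    [a(r/2) ^+ 2 <= 4 E (a(2r) - a(r/2))]; the first one bounds
    [a(r/2) (a(2r) - a(r/2))], and the two add up to the claim. *)
Lemma caccioppoli_step r : 0 < r ->
  localized_energy (r / 2) * localized_energy (2 * r) <=
  8 * caccioppoli_error r * (localized_energy (2 * r) - localized_energy (r / 2)).
Proof.
move=> r0; have r20 : 0 < 2 * r by lra. have rh0 : 0 < r / 2 by lra.
have cphi := cdu il; have cv := cdu i0; have cz := @C1_zeta R n r.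
have cG' := cC cG; have cv' := cC cv.
have CE := Cc_density.
have CF : Cc (fun x => G x * \sum_j (wronskian j x / phi x) * (2 * zeta r x * (v x * dzeta r j x))).
  have Cz := Cc_zeta (n := n) r0.
  apply: CcMl => //; apply: Cc_sum => j _; apply: CcMl.
    by apply: continuousM => //; exact: cC (C1V un0 cphi).
  apply: CcMl; first by apply: continuousMc; exact: cC cz.
  apply: CcMl => //; split; first exact: (cdC (i := j) cz).
  exact: bsupp_derive Cz.2 (C1_derive cz j).
have CD : Cc (fun x => G x * v x ^+ 2 * zeta (2 * r) x).
  apply: CcMl; last exact: Cc_zeta.
  apply: continuousM => //; apply: (@continuous_comp1 _ _ (fun t : R => t ^+ 2)) => //.
  exact: exprn_continuous.
have bound x : \sum_j (G x * (v x * dzeta r j x) ^+ 2) <=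
    n%:R * (6 / r) ^+ 2 * (G x * v x ^+ 2 * zeta (2 * r) x).
  apply: (@le_trans _ _ (\sum_(j < n) (6 / r) ^+ 2 * (G x * v x ^+ 2 * zeta (2 * r) x))).
    apply: ler_sum => j _; rewrite exprMn.
    rewrite [leLHS](_ : _ = dzeta r j x ^+ 2 * (G x * v x ^+ 2)); last by ring.
    rewrite [leRHS](_ : _ = (6 / r) ^+ 2 * zeta (2 * r) x * (G x * v x ^+ 2)); last by ring.
    apply: (ler_wpM2r (mulr_ge0 (ltW (G0 x)) (sqr_ge0 (v x)))).
    have [->|[-> _]] := dzeta_support j x r0.
      by rewrite expr0n mulr_ge0 ?sqr_ge0 ?zeta_ge0.
    rewrite mulr1 -real_normK ?num_real// lerXn2r ?nnegrE// ?dzeta_le//.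
    by rewrite divr_ge0// ltW.
  by rewrite sumr_const card_ord -[leLHS]mulr_natl mulrA.
set a := localized_energy (r / 2); set a' := localized_energy (2 * r).
set E := caccioppoli_error r; set ar := localized_energy r.
have a0 : 0 <= a by exact: localized_energy_ge0.
have E0 : 0 <= E.
  apply: mulr_ge0; first by apply: mulr_ge0 => //; exact: sqr_ge0.
  apply: I_ge0 => x; apply: mulr_ge0; last exact: zeta_ge0.
  by apply: mulr_ge0; [exact: ltW|exact: sqr_ge0].
have aa' : a <= a' by exact: localized_energy_le.
have aar : a <= ar.
  apply: I_le; [exact: CE|exact: CE|move=> x].
  rewrite ler_wpM2r ?quotient_energy_ge0// lerXn2r ?nnegrE ?zeta_ge0//.
  have [xs|] := pselect (forall i : 'I_n, `|x 0 i| <= r).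
    by rewrite (@zeta_eq1 _ _ r)// ?zeta_le1.
  move=> /existsNP[i /negP]; rewrite -ltNge => xi.
  by rewrite (zeta_eq0 (i := i)) ?zeta_ge0//; lra.
(* Young's inequality, with the cutoff kept on the left *)
have young1 : ar <= 2^-1 * ar + 2 * E.
  rewrite {1}/ar localized_energy_identity// /ar /localized_energy /E /caccioppoli_error.
  have C1' := CcZ 2^-1 (CE r r0); have C2' := CcZ 2 (CcZ (n%:R * (6 / r) ^+ 2) CD).
  rewrite -(IZ _ (CE r r0)) -(IZ _ CD) -(IZ 2 (CcZ _ CD)) -ID//.
  apply: I_le; [exact: CcN|exact: CcD|move=> x].
  apply: le_trans (lerD (lexx _) (ler_wpM2l _ (bound x))); last by [].
  rewrite /quotient_energy.
  rewrite !mulr_sumr -sumrN -big_split; apply: ler_sum => j _ /=.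
  set w := wronskian j x / phi x; set d := v x * dzeta r j x; set z := zeta r x.
  have : 0 <= G x * (2^-1 * (z * w + 2 * d) ^+ 2).
    apply: mulr_ge0; first exact: ltW.
    by apply: mulr_ge0; [rewrite invr_ge0|exact: sqr_ge0].
  rewrite -subr_ge0; congr (0 <= _); by field.
have ar4 : ar <= 4 * E by lra.
(* Young's inequality, with the support of the gradient of the cutoff *)
have young2 th : 0 < th -> ar <= th * (a' - a) + th^-1 * E.
  move=> th0; rewrite /ar localized_energy_identity// /a /a' /localized_energy /E /caccioppoli_error.
  have C3 := CcB (CE _ r20) (CE _ rh0).
  have C1' := CcZ th C3; have C2' := CcZ th^-1 (CcZ (n%:R * (6 / r) ^+ 2) CD).
  rewrite -(IB (CE _ r20) (CE _ rh0)) -(IZ _ C3) -(IZ _ CD) -(IZ th^-1 (CcZ _ CD)) -ID//.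
  apply: I_le; [exact: CcN|exact: CcD|move=> x].
  have th'0 : 0 <= th^-1 by rewrite invr_ge0 ltW.
  apply: le_trans (lerD (lexx _) (ler_wpM2l th'0 (bound x))).
  rewrite -mulrBl /quotient_energy.
  rewrite !mulr_sumr -sumrN -big_split; apply: ler_sum => j _ /=.
  have [->|[-> ->]] := dzeta_support j x r0.
    rewrite !mulr0 oppr0 expr0n !mulr0 addr0; apply: mulr_ge0; first exact: ltW.
    apply: mulr_ge0; first by rewrite subr_ge0 lerXn2r ?nnegrE ?zeta_ge0// zeta_half_le.
    by apply: mulr_ge0; [exact: ltW|exact: sqr_ge0].
  set w := wronskian j x / phi x; set d := v x * dzeta r j x; set z := zeta r x.
  rewrite expr1n expr0n subr0 mul1r.
  have z0 : 0 <= z by exact: zeta_ge0.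
  have z1 : z <= 1 by exact: zeta_le1.
  rewrite -subr_ge0.
  rewrite (_ : _ - _ = G x * th^-1 * ((th * w + z * d) ^+ 2 + (1 - z ^+ 2) * d ^+ 2)); last first.
    by field; rewrite gt_eqF.
  apply: mulr_ge0; first by apply: mulr_ge0 => //; exact: ltW.
  apply: addr_ge0; first exact: sqr_ge0.
  by apply: mulr_ge0; [rewrite subr_ge0 expr_le1|exact: sqr_ge0].
have [a00|an0] := eqVneq a 0.
  have a'0 : 0 <= a' := le_trans a0 aa'.
  by rewrite a00 mul0r subr0; apply: mulr_ge0 => //; exact: mulr_ge0.
have ap : 0 < a by rewrite lt_neqAle eq_sym an0.
have Ep : 0 < E by lra.
have h := young2 (2 * E / a) (divr_gt0 (mulr_gt0 (ltr0n R 2) Ep) ap).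
have a2 : a ^+ 2 <= 4 * E * (a' - a).
  have {}h : a <= 2 * E / a * (a' - a) + (2 * E / a)^-1 * E by lra.
  have E1 : (2 * E / a)^-1 * E = a / 2 by field; rewrite !gt_eqF.
  have E2 : a * (2 * E / a * (a' - a)) = 2 * E * (a' - a) by field; rewrite gt_eqF.
  rewrite E1 in h; have : a * (a / 2) <= a * (2 * E / a * (a' - a)) by rewrite ler_pM2l//; lra.
  rewrite E2; lra.
have a4 : a * (a' - a) <= 4 * E * (a' - a) by rewrite ler_wpM2r ?subr_ge0//; lra.
lra.
Qed.

Lemma wronskian_eq0_proportional : (forall j x, wronskian j x = 0) ->
  exists c, forall x, v x = c * phi x.
Proof.
move=> w0; have p0 x : phi x != 0 by rewrite gt_eqF ?un0.
have cq := C1M (cdu i0) (C1V un0 (cdu il)).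
exists (v 0 / phi 0) => x.
have [xi _] := MVT_line (C1_is_derive cq ^~ x) 0 1.
rewrite scale1r add0r big1 => [|j _]; last first.
  suff -> : forall y, du i0 y * (- (du il y) ^- 2 * ddu il j y) + ddu i0 j y * (du il y)^-1 =
    wronskian j y / phi y ^+ 2 by rewrite w0 mul0r mulr0.
  by move=> y; rewrite /wronskian /phi /v; field; exact: p0.
by rewrite mulr0 -/(phi _) -/(v _) => /eqP; rewrite subr_eq0 => /eqP <-; rewrite divfK.
Qed.

(** For [r = 2 * 4 ^+ j] the radii [r / 2] and [2 * r] of [caccioppoli_step] are
    consecutive powers of 4, and [class_G_growth] applies. *)
Lemma caccioppoli_error_proportional g C K : class_G g -> 0 < C -> 0 < K ->
  (forall r, 1 <= r -> caccioppoli_error r <= C * g (K * r)) ->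
  exists c, forall x, v x = c * phi x.
Proof.
move=> gG C0 K0 err; apply: wronskian_eq0_proportional => j x.
pose b k := localized_energy (4 ^+ k).
have four k : 1 <= 4 ^+ k :> R by rewrite exprn_ege1//; lra.
have b0 : forall k, b k = 0.
  apply: (@class_G_growth _ g b (8 * C) (2 * K) gG) => [||k|k].
  - by lra.
  - by lra.
  - exact: localized_energy_ge0.
  - have f0 : 0 < 2 * 4 ^+ k :> R by have := four k; lra.
    have := caccioppoli_step f0; have := localized_energy_le f0.
    rewrite (_ : 2 * 4 ^+ k / 2 = 4 ^+ k :> R); last by field.
    rewrite (_ : 2 * (2 * 4 ^+ k) = 4 ^+ k.+1 :> R); last by rewrite exprS; ring.
    rewrite -/(b k) -/(b k.+1) => bb h; apply: (le_trans h).
    rewrite ler_wpM2r ?subr_ge0// -mulrA ler_wpM2l//.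
    rewrite (_ : 2 * K * 4 ^+ k = K * (2 * 4 ^+ k)); last by ring.
    by apply: err; have := four k; lra.
have q0 : quotient_energy x = 0.
  apply/eqP/negP => /negP qn; have qp : 0 < quotient_energy x.
    by rewrite lt_neqAle eq_sym qn quotient_energy_ge0.
  have [k xk] : exists k, forall i, `|x 0 i| <= 4 ^+ k.
    exists (Num.bound (\sum_i `|x 0 i|)) => i.
    apply: (@le_trans _ _ (\sum_i `|x 0 i|)).
      by rewrite (bigD1 i)//= lerDl sumr_ge0.
    apply: (@le_trans _ _ (Num.bound (\sum_i `|x 0 i|))%:R).
      by apply/ltW/archi_boundP; exact: sumr_ge0.
    by rewrite -natrX ler_nat ltnW// ltn_expl.
  have f0 : 0 < 4 ^+ k :> R by have := four k; lra.
  have : 0 < b k.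
    apply: (@I_gt0 _ _ _ x (Cc_density f0)) => [y|].
      by apply: mulr_ge0; [exact: sqr_ge0|exact: quotient_energy_ge0].
    by rewrite zeta_eq1// expr1n mul1r.
  by rewrite b0 ltxx.
have : \sum_i (wronskian i x / phi x) ^+ 2 = 0.
  by move/eqP: q0; rewrite mulf_eq0 gt_eqF ?G0//= => /eqP.
move/eqP; rewrite psumr_eq0 => [/allP/(_ j (mem_index_enum _))/=|i _]; last exact: sqr_ge0.
by rewrite sqrf_eq0 mulf_eq0 invr_eq0 (gt_eqF (un0 x)) orbF => /eqP.
Qed.

End liouville.

(** * Functions on a closed interval *)
Section interval.
Context {R : realType}.

Lemma has_derivative_on_continuous (D : set R) (F f : R -> R) :
  has_derivative_on D F f -> {within D, continuous F}.
Proof.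
move=> dF; apply/subspace_continuousP => t Dt.
apply/cvgrPdist_le => e e0.
have h : ((F y - F t) / (y - t)) * (y - t) @[y --> within D t^'] --> f t * 0.
  apply: cvgM; first exact: dF.
  rewrite -(subrr t); apply: cvgB; last exact: cvg_cst.
  apply: cvg_trans (@cvg_id _ (nbhs t)); apply: cvg_within_filter; apply: cvg_within_filter; exact: cvg_id.
rewrite mulr0 in h; move/cvgrPdist_le : h => /(_ _ e0).
rewrite !near_withinE; apply: filterS => y hy Dy.
have [->|yt] := eqVneq y t; first by rewrite subrr normr0 ltW.
have := hy yt Dy; rewrite sub0r normrN divfK ?subr_eq0//.
by rewrite distrC.
Qed.

Lemma has_derivative_on_interior (F f : R -> R) (t : R) :
  has_derivative_on `[-1, 1] F f -> -1 < t < 1 -> is_derive t 1 F (f t).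
Proof.
move=> dF t1.
have Dt : `[-1, 1]%classic t by rewrite /= in_itv/=; lra.
suff H : h^-1 *: ((F \o shift t) (h *: 1) - F t) @[h --> 0^'] --> f t.
  by split; [apply/cvg_ex; eexists; exact: H|exact/cvg_lim].
have := dF t Dt => /cvgrPdist_le H; apply/cvgrPdist_le => e e0.
move: (H e e0); rewrite !near_withinE => /nbhs_ballP[del /= del0 hdel].
pose d := Num.min del (Num.min (1 - t) (t + 1)).
have d0 : 0 < d by rewrite !lt_min del0 /=; apply/andP; split; lra.
have [dd [d1 d2]] : d <= del /\ d <= 1 - t /\ d <= t + 1.
  have : d <= d by []; rewrite {2}/d !le_min => /and3P[*]; by [].
apply/nbhs_ballP; exists d => //= h.
rewrite -ball_normE /= sub0r normrN => hd h0.
have hn := ler_norm h; have hn' := ler_norm (- h); rewrite normrN in hn'.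
have := hdel (h + t); rewrite -ball_normE /= opprD addrCA subrr addr0 normrN.
move=> /(_ (lt_le_trans hd dd)) H1.
have : h + t != t by rewrite -subr_eq0 addrK.
move=> /H1; rewrite in_itv /= addrK [h *: 1]mulr1 => H2.
rewrite [_ *: _]mulrC; apply: H2; apply/andP; split; lra.
Qed.

Lemma within_interior_continuous (f : R -> R) (t : R) :
  {within `[-1, 1], continuous f} -> -1 < t < 1 -> {for t, continuous f}.
Proof.
have ltrN1x1 : -1 < 1 :> R by lra.
move=> cf t1; have : {in `]-1, 1[, continuous f}.
  by have [] := (continuous_within_itvP f ltrN1x1).1 cf.
by apply; rewrite in_itv.
Qed.

Lemma within_bounded (f : R -> R) : {within `[-1, 1], continuous f} ->
  exists2 M, 0 <= M & forall t, -1 <= t <= 1 -> `|f t| <= M.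
Proof.
move=> cf; have := continuous_compact cf (@segment_compact R (-1) 1).
move=> /compact_bounded[M [_ HM]]; exists (`|M| + 1) => [|t t1].
  by rewrite addr_ge0.
apply: (HM (`|M| + 1)); first by rewrite (le_lt_trans (ler_norm _))// ltrDl.
by exists t => //=; rewrite in_itv.
Qed.

(** The mean value theorem between [t] and the end [eps] of the interval, where
    [F] is continuous though only one-sidedly differentiable. *)
Lemma primitive_lipschitz (F f : R -> R) (M : R) : has_derivative_on `[-1, 1] F f ->
  (forall t, -1 <= t <= 1 -> `|f t| <= M) ->
  forall t eps, -1 < t < 1 -> eps = 1 \/ eps = -1 -> F eps - F t <= M * (1 - eps * t).
Proof.
move=> dF fM t eps t1.
have cF := has_derivative_on_continuous dF.
have mvt a b : -1 <= a -> b <= 1 -> a < b ->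
    exists2 c, c \in `]a, b[ & F b - F a = f c * (b - a).
  move=> a1 b1 ab; apply: (MVT ab) => [c|].
    rewrite in_itv/= => /andP[ac cb]; apply: has_derivative_on_interior => //; lra.
  by apply: continuous_subspaceW cF => c /=; rewrite !in_itv/=; lra.
have /andP[tl tr] := t1; case=> ->.
  have [c c1 ->] := mvt t 1 (ltW tl) (lexx 1) tr.
  rewrite in_itv/= in c1; rewrite mul1r ler_wpM2r ?(le_trans (ler_norm _) (fM _ _))//; lra.
have [c c1 E] := mvt (-1) t (lexx _) (ltW tr) tl.
rewrite in_itv/= in c1; rewrite -opprB E -mulNr mulN1r !opprK [1 + t]addrC.
by rewrite ler_wpM2r//; [lra|rewrite (le_trans (ler_norm _))// normrN fM//; lra].
Qed.

End interval.

(** * Weights depending on the first variables *)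
Section weights.
Context {R : realType} {d s : nat}.

Lemma of_class_C1 n (f : 'rV[R]_n -> R) : of_class_C 1 f -> C1 f (fun i => partial i f).
Proof.
move=> [cf df]; split => // [i x|i]; last by have [_] := df i.
by have [/(_ x)/derivableP] := df i.
Qed.

Lemma of_class_C2 n (f : 'rV[R]_n -> R) : of_class_C 2 f ->
  C1 f (fun i => partial i f) /\ (forall i, C1 (partial i f) (fun j => partial j (partial i f))).
Proof.
move=> [cf df]; split; last by move=> i; have [_ /of_class_C1] := df i.
split => // [i x|i]; last by have [_ []] := df i.
by have [/(_ x)/derivableP] := df i.
Qed.

Lemma lsubmx_line (x : 'rV[R]_(d + s)) i (t : R) :
  lsubmx (x + t *: delta_mx 0 i) =
  lsubmx x + (if fintype.split i is inl j then t *: delta_mx 0 j else 0).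
Proof.
apply/rowP => k; rewrite !mxE.
case: (split_ordP i) => j ->; rewrite !mxE eqxx /=; first by rewrite eq_lshift.
by rewrite eq_lrshift mulr0.
Qed.

Lemma continuous_lsubmx : continuous (@lsubmx R 1 d s).
Proof. by move=> x; apply: differentiable_continuous; exact: differentiable_lsubmx. Qed.

Definition lift_grad (dg : 'I_d -> 'rV[R]_d -> R) (i : 'I_(d + s)) (x : 'rV[R]_(d + s)) : R :=
  if fintype.split i is inl j then dg j (lsubmx x) else 0.

Lemma C1_lift (g : 'rV[R]_d -> R) dg : C1 g dg ->
  C1 (fun x : 'rV[R]_(d + s) => g (lsubmx x)) (lift_grad dg).
Proof.
move=> [cg ddg cdg].
have c (h : 'rV[R]_d -> R) : continuous h -> continuous (fun x : 'rV[R]_(d + s) => h (lsubmx x)).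
  move=> ch x; apply: (@continuous_comp _ _ _ (@lsubmx R 1 d s) h).
    exact: continuous_lsubmx.
  exact: ch.
split; first exact: c.
- move=> i x; apply/is_derive_line0.
  rewrite (_ : (fun t => _) = fun t : R => g (lsubmx x + (if fintype.split i is inl j then t *: delta_mx 0 j else 0))); last first.
    by apply/funext => t; rewrite lsubmx_line.
  rewrite /lift_grad; case: (fintype.split i) => j; last by rewrite addr0; exact: is_derive_cst.
  exact: (is_derive_line0 g (lsubmx x) (delta_mx 0 j) _).1 (ddg j (lsubmx x)).
- move=> i; rewrite /lift_grad; case: (fintype.split i) => j; first exact: c.
  exact: cst_continuous.
Qed.

End weights.

(** * Reduction of the number of variables *)
Section reduction.
Context {R : realType} {d s : nat}.
Local Notation e_ i := (delta_mx 0 i : 'rV[R]_(d + s)).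

(** The linear map keeps the first [d] coordinates and the linear form with
    coefficients [c k] in the others.  On its kernel the derivative of [u]
    vanishes, so the mean value theorem shows that [u] is constant on its
    fibres. *)
Lemma at_most_dimensional_proportional (u : 'rV[R]_(d + s) -> R) du (c : 'I_s -> R) (il : 'I_(d + s)) :
  C1 u du -> (forall k x, du (rshift d k) x = c k * du il x) -> at_most_dimensional d.+1 u.
Proof.
move=> cu prop.
have sr k : fintype.split (rshift d k) = inr k :> 'I_d + 'I_s by exact: (unsplitK (inr k)).
have sl j : fintype.split (lshift s j) = inl j :> 'I_d + 'I_s by exact: (unsplitK (inl j)).
pose A : 'M[R]_(d + s, d.+1) := \matrix_(i, j)
  match fintype.split i with
  | inl i' => (i' == j :> nat)%:R
  | inr k => if j == ord_max then c k else 0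
  end.
pose Lz : {linear 'rV[R]_(d + s) -> 'rV[R]_d.+1} := mulmxr A.
have kernel x y : Lz x = Lz y -> u x = u y.
  move=> Lxy; have [v vE] : exists v, v = y - x by exists (y - x).
  have Lv : v *m A = 0 by rewrite vE mulmxBl; apply/eqP; rewrite subr_eq0; apply/eqP.
  have vl (j : 'I_d) : v 0 (lshift s j) = 0.
    have := congr1 (fun m : 'rV[R]_d.+1 => m 0 (lift ord_max j)) Lv.
    rewrite !mxE big_split_ord /= [X in _ + X]big1 ?addr0 => [|k _]; last first.
      by rewrite mxE sr eq_sym (negbTE (neq_lift _ _)) mulr0.
    rewrite (bigD1 j)//= big1 => [|i ij].
      by rewrite !mxE sl lift_max eqxx mulr1 addr0.
    by rewrite !mxE sl lift_max (_ : (i == j :> nat) = false) ?mulr0//; exact: negbTE.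
  have vr : \sum_(k < s) v 0 (rshift d k) * c k = 0.
    have := congr1 (fun m : 'rV[R]_d.+1 => m 0 ord_max) Lv.
    rewrite !mxE big_split_ord /= [X in X + _]big1 ?add0r => [|k _]; last by rewrite vl mul0r.
    move=> E; rewrite -[RHS]E; apply: eq_bigr => k _.
    by rewrite !mxE sr eqxx.
  have [xi _] := MVT_line (C1_is_derive cu ^~ v) x 1.
  rewrite scale1r {1}vE [x + _]addrC subrK => E; apply/esym/eqP; rewrite -subr_eq0 E mul1r.
  rewrite big_split_ord /= big1 ?add0r => [|j _]; last by rewrite vl mul0r.
  rewrite (eq_bigr (fun k => v 0 (rshift d k) * c k * du il (x + xi *: v))) => [|k _].
    by rewrite -mulr_suml vr mul0r.
  by rewrite prop mulrA.
(* [w z] is the value of [u] at any point of the fibre over [z] *)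
exists Lz, (fun z => if pselect (exists x, Lz x = z) is left H then u (projT1 (cid H)) else 0).
move=> x; case: pselect => [H|[]]; last by exists x.
by apply: kernel; case: (cid H).
Qed.

Lemma bounded_off_compact n (h : 'rV[R]_n -> R) (K : set 'rV[R]_n) (k : R) :
  continuous h -> compact K -> (forall x, ~ K x -> `|h x| <= k) ->
  exists2 B, 0 <= B & forall x, `|h x| <= B.
Proof.
move=> ch cK hk.
have := continuous_compact (continuous_subspaceT ch) cK.
move=> /compact_bounded[M [_ HM]]; exists (`|M| + 1 + `|k|) => [|x].
  by rewrite !addr_ge0.
have [Kx|Kx] := pselect (K x).
  apply: ler_wpDr => //; apply: (HM (`|M| + 1)); last by exists x.
  by rewrite (le_lt_trans (ler_norm _))// ltrDl.
rewrite (le_trans (hk x Kx))// (le_trans (ler_norm k))// lerDr addr_ge0//.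
Qed.

(** The quotients are continuous, hence bounded on the compact set as well. *)
Lemma weights_comparable (gam lam : 'rV[R]_d -> R) dgam (K : set 'rV[R]_d) (k : R) :
  C1 gam dgam -> continuous lam -> (forall x, 0 < gam x) -> (forall x, 0 <= lam x) -> compact K ->
  (forall j x, ~ K x -> `|dgam j x| <= k * gam x) -> (forall x, ~ K x -> lam x <= k * gam x) ->
  exists2 B, 0 <= B & (forall j x, `|dgam j x / gam x| <= B) /\ (forall x, lam x / gam x <= B).
Proof.
move=> cg cl g0 l0 cK dk lk.
have cV := C1_continuous (C1V g0 cg).
have cdg j : continuous (dgam j) by exact: (C1_continuous_grad cg (i := j)).
have H1 j : exists2 B, 0 <= B & forall x, `|dgam j x / gam x| <= B.
  apply: (@bounded_off_compact _ _ K k) => //; first exact: continuousM.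
  by move=> x /(dk j) h; rewrite normrM normfV (gtr0_norm (g0 x)) ler_pdivrMr.
have [B2 B20 HB2] : exists2 B, 0 <= B & forall x, `|lam x / gam x| <= B.
  apply: (@bounded_off_compact _ _ K k) => //; first exact: continuousM.
  move=> x /lk h; rewrite normrM normfV (gtr0_norm (g0 x)) ler_pdivrMr//.
  by rewrite ger0_norm.
have [B1 HB1] : exists B : 'I_d -> R, forall j, 0 <= B j /\ forall x, `|dgam j x / gam x| <= B j.
  exists (fun j => projT1 (cid2 (H1 j))) => j; by case: (cid2 (H1 j)).
exists (\sum_j B1 j + B2) => [|].
  by rewrite addr_ge0// sumr_ge0// => j _; case: (HB1 j).
have S0 : 0 <= \sum_j B1 j by rewrite sumr_ge0// => j _; case: (HB1 j).
split=> [j x|x]; last first.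
  by rewrite (le_trans (ler_norm _))// (le_trans (HB2 x))// lerDr.
rewrite (le_trans ((HB1 j).2 x))// (bigD1 j)//= -addrA lerDl addr_ge0//.
by rewrite sumr_ge0// => i _; case: (HB1 i).
Qed.

Lemma set_last_line (x : 'rV[R]_(d + s)) (il : 'I_(d + s)) (t : R) : il.+1 = (d + s)%N ->
  set_last x t = x + (t - x 0 il) *: e_ il.
Proof.
move=> ilS; apply/rowP => i; rewrite !mxE eqxx /=.
have [->|iil] := eqVneq i il.
  by rewrite ilS eqxx mulr1 addrC subrK.
case: eqP => [h|_]; last by rewrite mulr0 addr0.
by case/eqP: iil; apply: val_inj; apply: succn_inj; rewrite h ilS.
Qed.

Lemma cvg_along_last (u : 'rV[R]_(d + s) -> R) (il : 'I_(d + s)) (eps : R) : il.+1 = (d + s)%N ->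
  asymptotically_convergent u -> eps = 1 \/ eps = -1 ->
  forall x, u (x + (eps * k%:R) *: e_ il) @[k --> \oo] --> eps.
Proof.
move=> ilS uc eps1 x; have [up um] := uc x.
have E k : u (x + (eps * k%:R) *: e_ il) = u (set_last x (x 0 il + eps * k%:R)).
  by rewrite (set_last_line x _ ilS) [x 0 il + _]addrC addrK.
rewrite (_ : (fun k : nat => _) = (fun k => u (set_last x (x 0 il + eps * k%:R)))); last first.
  by apply/funext => k; rewrite E.
case: eps1 => ->.
  apply: (cvg_comp _ _ _ up); apply/cvgryPge => M; near=> k.
  rewrite mul1r -lerBlDl; near: k; exact: nbhs_infty_ger.
apply: (cvg_comp _ _ _ um); apply/cvgrNyPle => M; near=> k.
rewrite mulN1r lerBlDr -lerBlDl; near: k; exact: nbhs_infty_ger.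
Unshelve. all: by end_near. Qed.

End reduction.

(** * Growth of the weighted volume *)
Section growth.
Context {R : realType} {d s : nat}.

(** The cutoff [zeta (8 * r)] lives in a cube of half-side [16 * r], whose
    projection to [R^d] lies in the ball of radius [16 * (d + 1) * r].  The two
    assumptions on the growth balance the exponent of [r]: [s <= 3] with [g],
    or [s <= 2] with [r * g r]. *)
Lemma weighted_volume_growth (gam : 'rV[R]_d -> R) (g : R -> R) (k : R) :
  continuous gam -> (forall x, 0 < gam x) -> class_G g ->
  ((forall r, 1 < r -> (ball_integral gam r <= (k * g r)%:E)%E) /\ (d + s <= d + 3)%N) \/
  ((forall r, 1 < r -> (ball_integral gam r <= (k * r * g r)%:E)%E) /\ (d + s <= d + 2)%N) ->
  exists C K : R, [/\ 0 < C, 0 < K & forall r, 1 <= r ->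
    I (fun x : 'rV[R]_(d + s) => gam (lsubmx x) * zeta (8 * r) x) <= C * r ^+ 3 * g (K * r)].
Proof.
move=> cg g0 [gp _ _] H.
pose K : R := 16 * (d%:R + 1).
have K16 : 16 <= K by rewrite /K ler_peMr// lerDr.
exists (32 ^+ 3 * (`|k| + 1) * K), K; split => [||r r1].
- have k0 := normr_ge0 k; apply: mulr_gt0; last by lra.
  by apply: mulr_gt0; [exact: exprn_gt0|lra].
- by lra.
have r0 : 0 < r by lra.
have Kr : 1 < K * r by nra.
have Krp : 0 < K * r by lra.
have gK := gp _ Krp.
have cgl : continuous (fun x : 'rV[R]_(d + s) => gam (lsubmx x)).
  by move=> x; apply: (@continuous_comp _ _ _ (@lsubmx R 1 d s) gam); [exact: continuous_lsubmx|exact: cg].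
have r80 : 0 < 8 * r by lra.
have vol : ((I (fun x : 'rV[R]_(d + s) => gam (lsubmx x) * zeta (8 * r) x))%:E <=
    ((32 * r) ^+ s)%:E * ball_integral gam (K * r))%E.
  rewrite (_ : 32 * r = 2 * (16 * r)); last by ring.
  apply: I_le_ball_integral => //.
  - by move=> x; exact: ltW.
  - by apply: CcMl => //; exact: Cc_zeta.
  - by lra.
  - by rewrite /K; have := ler0n R d; nra.
  - by move=> x; rewrite ler_piMr ?zeta_le1// ltW.
  - move=> x /existsNP[i /negP]; rewrite -ltNge => xi.
    by rewrite (zeta_eq0 (i := i)) ?mulr0//; lra.
have r32 : 1 <= 32 * r by lra.
have sp0 : 0 <= (32 * r) ^+ s by apply: exprn_ge0; lra.
have bd (m : nat) (w : R) : (ball_integral gam (K * r) <= w%:E)%E -> w <= (`|k| + 1) * K * r ^+ (3 - m) * g (K * r) ->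
    (d + s <= d + m)%N -> (m <= 3)%N ->
    I (fun x : 'rV[R]_(d + s) => gam (lsubmx x) * zeta (8 * r) x) <=
    32 ^+ 3 * (`|k| + 1) * K * r ^+ 3 * g (K * r).
  move=> wb ww; rewrite leq_add2l => sm m3; rewrite -lee_fin (le_trans vol)//.
  apply: (@le_trans _ _ (((32 * r) ^+ s)%:E * w%:E)%E); first by rewrite lee_wpmul2l// lee_fin.
  rewrite -EFinM lee_fin (le_trans (ler_wpM2l sp0 ww))//.
  have k0 := normr_ge0 k.
  rewrite (_ : 32 ^+ 3 * (`|k| + 1) * K * r ^+ 3 * g (K * r) =
    (32 ^+ 3 * r ^+ m) * ((`|k| + 1) * K * r ^+ (3 - m) * g (K * r))); last first.
    have -> : r ^+ 3 = r ^+ m * r ^+ (3 - m) by rewrite -exprD subnKC.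
    by ring.
  apply: ler_wpM2r.
    apply: mulr_ge0; last exact: ltW.
    by apply: mulr_ge0; [apply: mulr_ge0; lra|apply: exprn_ge0; lra].
  rewrite exprMn; apply: ler_pM => //; try (apply: exprn_ge0; lra).
    by apply: ler_weXn2l; [lra|exact: leq_trans m3].
  by apply: ler_weXn2l.
have kn := ler_norm k; have k0 := normr_ge0 k.
case: H => -[hb sd].
  apply: (bd 3 _ (hb _ Kr)) => //; rewrite expr0 mulr1 ler_pM2r//.
  by nra.
apply: (bd 2 _ (hb _ Kr)) => //; rewrite expr1 ler_pM2r// -mulrA ler_pM2r//.
by rewrite (le_trans kn)// lerDl.
Qed.

End growth.

(** * Regularity of the solution *)
Section solution.
Context {R : realType} {d s : nat}.
Variables (gam lam : 'rV[R]_d -> R) (f : R -> R) (u : 'rV[R]_(d + s) -> R).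
Local Notation du := (fun i => partial i u).
Local Notation ddu := (fun i j => partial j (partial i u)).

Lemma solution_expanded dgam : C1 gam dgam -> classical_solution gam lam f u ->
  forall x, \sum_i (lift_grad dgam i x * du i x + gam (lsubmx x) * ddu i i x) =
    - (lam (lsubmx x) * f (u x)).
Proof.
move=> cg [/of_class_C2[_ cdu] _ equ] x.
rewrite -equ opprK /divergence; apply: eq_bigr => i _.
rewrite (_ : (fun y => _) = (fun y => gam (lsubmx y) * du i y)); last first.
  by apply/funext => y; rewrite !mxE.
by rewrite (C1_partial (C1M (C1_lift cg) (cdu i))) addrC.
Qed.

Lemma hessian_sym : of_class_C 2 u -> forall i j x, ddu i j x = ddu j i x.
Proof.
move=> /of_class_C2[cu cdu] i j.
exact: (schwarz (C1_derive cu i) (C1_derive cu j) (C1_derive (cdu i) j) (C1_derive (cdu j) i)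
  (C1_continuous_grad (cdu i) (i := j)) (C1_continuous_grad (cdu j) (i := i))).
Qed.

(** A strictly increasing function attains neither of its bounds.  The values of
    [u] thus stay in the open interval, where [f] and [F] are differentiable on
    both sides. *)
Lemma monotone_strict_bounds (il : 'I_(d + s)) : of_class_C 2 u ->
  (forall x, -1 <= u x <= 1) -> (forall x, 0 < du il x) -> forall x, -1 < u x < 1.
Proof.
move=> /of_class_C2[cu _] u1 un0 x.
have [xi _ E] := MVT_line (C1_derive cu il) x 1.
have [xi' _ E'] := MVT_line (C1_derive cu il) x (-1).
have h := un0 (x + xi *: delta_mx 0 il); have h' := un0 (x + xi' *: delta_mx 0 il).
have := u1 (x + 1 *: delta_mx 0 il); have := u1 (x + -1 *: delta_mx 0 il).
lra.
Qed.

Lemma C1_comp_interval (h dh : R -> R) : has_derivative_on `[-1, 1] h dh ->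
  {within `[-1, 1], continuous dh} -> of_class_C 2 u -> (forall x, -1 < u x < 1) ->
  C1 (h \o u) (fun i x => dh (u x) * du i x).
Proof.
move=> dhd cdh /of_class_C2[cu _] u1.
have ccomp (k : R -> R) : {within `[-1, 1], continuous k} -> continuous (k \o u).
  move=> ck x; apply: continuous_comp; first exact: (C1_continuous cu).
  exact: within_interior_continuous.
split.
- by apply: ccomp; exact: has_derivative_on_continuous dhd.
- move=> i x; apply: is_derive1_comp_line; first exact: (C1_derive cu).
  exact: has_derivative_on_interior.
- move=> i; apply: continuousM; first exact: ccomp.
  exact: (C1_continuous_grad cu (i := i)).
Qed.

End solution.

Theorem theorem2 (R : realType) (d s : nat) (d_ge1 : (1 <= d)%N)
  (s_ge1 : (1 <= s)%N)
  (gam lam : 'rV[R]_d -> R)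
  (gam_smooth : smooth gam) (lam_smooth : smooth lam)
  (gam_gt0 : forall x, 0 < gam x)
  (lam_gt0 : exists x0, 0 <= lam x0 /\ forall x, x <> x0 -> 0 < lam x)
  (f F : R -> R)
  (f_C1 : C1_on `[-1, 1] f)
  (F_primitive : has_derivative_on `[-1, 1] F f)
  (F_le : forall t : R, -1 < t < 1 -> F t <= Num.min (F (-1)) (F 1))
  (u : 'rV[R]_(d + s) -> R)
  (u_sol : classical_solution gam lam f u)
  (u_monotone : monotone_in_last u)
  (u_conv : asymptotically_convergent u)
  (weights_bound : exists2 k : R, 0 < k &
     exists2 K : set 'rV[R]_d, compact K &
       forall x, ~ K x -> enorm (grad gam x) <= k * gam x /\ lam x <= k * gam x)
  (energy_bound : exists (g : R -> R) (k : R), class_G g /\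
     (((forall r, 1 < r -> (ball_integral gam r <= (k * g r)%:E)%E) /\
       (d + s <= d + 3)%N) \/
      ((forall r, 1 < r -> (ball_integral gam r <= (k * r * g r)%:E)%E) /\
       (d + s <= d + 2)%N))) :
  at_most_dimensional d.+1 u.
Proof.
have [u2 u1 _] := u_sol; have [cu cdu] := of_class_C2 u2.
have sym := hessian_sym u2.
have cg := of_class_C1 (gam_smooth 1%N); have cl := of_class_C1 (lam_smooth 1%N).
have equ := solution_expanded cg u_sol.
have cG : C1 (fun x : 'rV[R]_(d + s) => gam (lsubmx x)) _ := C1_lift cg.
have cL : C1 (fun x : 'rV[R]_(d + s) => lam (lsubmx x)) _ := C1_lift cl.
have lift0 (w : 'rV[R]_d -> R) k x : lift_grad (fun i => partial i w) (rshift d k : 'I_(d + s)) x = 0.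
  by rewrite /lift_grad (unsplitK (inr k)).
have lam0 x : 0 <= lam x.
  have [x0 [l0 lp]] := lam_gt0; have [->//|/eqP xx0] := eqVneq x x0.
  by rewrite ltW// lp.
have G0 (x : 'rV[R]_(d + s)) : 0 < gam (lsubmx x) by [].
have [kl ilS] : exists kl : 'I_s, (rshift d kl).+1 = (d + s)%N.
  have ls : (s.-1 < s)%N by rewrite prednK.
  by exists (Ordinal ls) => /=; rewrite -addnS prednK.
set il := rshift d kl in ilS.
have un0 x : 0 < partial il u x by exact: u_monotone.
have ui := monotone_strict_bounds u2 u1 un0.
have [df [dfd cdf]] := f_C1.
have cf := has_derivative_on_continuous dfd.
have cfu := C1_comp_interval dfd cdf u2 ui.
have cFu := C1_comp_interval F_primitive cf u2 ui.
have [Mf Mf0 fM] := within_bounded cf.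
have fuM x : `|(f \o u) x| <= Mf by exact: fM.
have u1' x : `|u x| <= 1 by rewrite ler_norml.
(* with this choice of [eps], the potential part of the energy is nonnegative *)
have [eps eps1 Feps] : exists2 eps : R, eps = 1 \/ eps = -1 & forall x, F (u x) <= F eps.
  case: (leP (F (-1)) (F 1)) => h; [exists (-1)|exists 1]; try by [left|right].
    by move=> x; apply: (le_trans (F_le _ (ui x))); rewrite ge_min lexx.
  by move=> x; apply: (le_trans (F_le _ (ui x))); rewrite ge_min lexx orbT.
have FuC x : F eps - (F \o u) x <= Mf * (1 - eps * u x).
  by have := primitive_lipschitz F_primitive fM (ui x) eps1.
have ucvg := cvg_along_last ilS u_conv eps1.
(* divided by [gam], the equation has bounded coefficients *)
have [k k0 [K cK kK]] := weights_bound.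
have [B B0 [gB lB]] : exists2 B, 0 <= B &
    (forall j x, `|partial j gam x / gam x| <= B) /\ (forall x, lam x / gam x <= B).
  apply: (weights_comparable cg (C1_continuous cl) gam_gt0 lam0 cK (k := k)) => [j x /kK[h _]|x /kK[]//].
  by apply: le_trans h; have := coord_le_enorm (grad gam x) j; rewrite mxE.
have [M M0 duM] : exists2 M, 0 < M & forall i x, `|partial i u x| <= M.
  pose b i (x : 'rV[R]_(d + s)) := lift_grad (fun i => partial i gam) i x / gam (lsubmx x).
  apply: (gradient_bound (b := b) (B := B) (H := B * Mf)
    (h := fun x => - (lam (lsubmx x) * f (u x)) / gam (lsubmx x)) cu cdu u1') => // [x|i x|x|].
  - rewrite -equ mulr_suml -big_split; apply: eq_bigr => i _ /=.
    by rewrite /b; field; rewrite gt_eqF.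
  - rewrite /b /lift_grad; case: (fintype.split i) => j; first exact: gB.
    by rewrite mul0r normr0.
  - have q0 : 0 <= lam (lsubmx x) / gam (lsubmx x) := divr_ge0 (lam0 _) (ltW (G0 x)).
    rewrite mulNr normrN mulrAC normrM (ger0_norm q0).
    by apply: ler_pM => //; exact: fuM.
  - exact: mulr_ge0.
have growth := gradient_growth cG cL cu cdu cFu (C1_continuous cfu) sym G0 (fun x => lam0 _) un0
  (lift0 gam kl) (lift0 lam kl) u1' equ M0 duM Mf0 fuM Feps FuC eps1 ucvg.
have [g [kg [gG vol]]] := energy_bound.
have [C [K' [C0 K'0 volume]]] := weighted_volume_growth (C1_continuous cg) gam_gt0 gG vol.
have prop (i : 'I_s) : exists c, forall x, partial (rshift d i) u x = c * partial il u x.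
  pose n : R := (d + s)%:R.
  have n0 : 0 < n by rewrite ltr0n addn_gt0 d_ge1.
  apply: (caccioppoli_error_proportional cG cL cdu cfu sym G0 un0 (lift0 gam kl) (lift0 lam kl)
    (lift0 gam i) (lift0 lam i) equ gG (C := n ^+ 2 * 162 * M * C) (K := K')) => // [|r r1].
    by rewrite !mulr_gt0 ?exprn_gt0.
  have r0 : 0 < r by lra.
  have r40 : 0 < 4 * r by lra.
  have r20 : 0 < 2 * r by lra.
  have cG' := C1_continuous cG.
  have cgs : continuous (grad_sq (fun i => partial i u)) by exact: (C1_continuous (C1_grad_sq cdu)).
  have csq : continuous (fun x => partial (rshift d i) u x ^+ 2).
    by apply: (@continuous_comp1 _ _ (fun t : R => t ^+ 2)); [exact: exprn_continuous|exact: (C1_continuous (cdu _))].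
  have Cz := Cc_zeta (n := (d + s)%N) r20.
  have le1 : I (fun x : 'rV[R]_(d + s) => gam (lsubmx x) * partial (rshift d i) u x ^+ 2 * zeta (2 * r) x) <=
      n * (18 * M / (4 * r)) * (C * r ^+ 3 * g (K' * r)).
    apply: (@le_trans _ _ (I (fun x : 'rV[R]_(d + s) => gam (lsubmx x) * grad_sq (fun i => partial i u) x *
        zeta (2 * r) x))).
      apply: I_le; [by apply: CcMl => //; exact: continuousM|by apply: CcMl => //; exact: continuousM|move=> x].
      apply: ler_wpM2r; first exact: zeta_ge0.
      apply: ler_wpM2l; first exact: ltW.
      by rewrite /grad_sq (bigD1 (rshift d i))//= lerDl sumr_ge0// => j _; exact: sqr_ge0.
    have := growth _ r40.
    rewrite (_ : 4 * r / 2 = 2 * r); last by field.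
    rewrite (_ : 2 * (4 * r) = 8 * r); last by ring.
    move=> h; apply: (le_trans h); apply: ler_wpM2l; last exact: volume.
    by rewrite mulr_ge0 ?divr_ge0 ?mulr_ge0// ltW.
  rewrite /caccioppoli_error -/n.
  have nn0 : 0 <= n * (6 / r) ^+ 2 by apply: mulr_ge0; [exact: ltW|exact: sqr_ge0].
  apply: (le_trans (ler_wpM2l nn0 le1)); rewrite le_eqVlt; apply/orP; left; apply/eqP.
  by field; rewrite gt_eqF.
have [c cE] : exists c : 'I_s -> R, forall i x, partial (rshift d i) u x = c i * partial il u x.
  by exists (fun i => projT1 (cid (prop i))) => i; case: (cid (prop i)).
exact: (at_most_dimensional_proportional (c := c) (il := il) cu).
Qed.
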